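(* Let $d\in\mathbb N$ and $r>1/q$. Then (1) for $1<q\le 2$, $$\mathbf W^r_q\hookrightarrow\mathbf W^{a,b}_A\quad\text{with } a=r-1/q,\ b=1-1/q;$$ (2) for $1\le q\le 2$, $$\mathbf H^r_q\hookrightarrow\mathbf W^{a,b}_A\quad\text{with } a=r-1/q,\ b=1.$$ Here $\mathbf F\hookrightarrow\mathbf G$ means that there is a constant $C>0$ (depending only on $r,q,d$) such that for every $f\in\mathbf F$ one has $C^{-1}f\in\mathbf G$.
   Context: Functions are (complex valued) $2\pi$-periodic in each of $d$ variables, on $\mathbb T^d:=[0,2\pi]^d$, with $\|f\|_q:=\left((2\pi)^{-d}\int_{\mathbb T^d}|f|^q d\mathbf x\right)^{1/q}$, $1\le q<\infty$. Fourier coefficients: $\hat f(\mathbf k):=(2\pi)^{-d}\int_{\mathbb T^d}f(\mathbf x)e^{-i(\mathbf k,\mathbf x)}d\mathbf x$, $\mathbf k\in\mathbb Z^d$. $[x]$ denotes the integer part of $x$, and $\mathbb N_0=\mathbb N\cup\{0\}$. Class $\mathbf W^r_q$. For $r>0$ let $F_r(x):=1+2\sum_{k=1}^\infty k^{-r}\cos(kx-r\pi/2)$ for $x\in\mathbb R$, and $F_r(\mathbf x):=\prod_{j=1}^d F_r(x_j)$. Then $\mathbf W^r_q:=\{f: f=\varphi*F_r,\ \|\varphi\|_q\le1\}$, where $(\varphi*F_r)(\mathbf x):=(2\pi)^{-d}\int_{\mathbb T^d}\varphi(\mathbf y)F_r(\mathbf x-\mathbf y)d\mathbf y$. Class $\mathbf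 H^r_q$. For $\mathbf t=(t_1,\dots,t_d)$ let $\Delta^l_{t_j,j}$ be the $l$-th difference operator with step $t_j$ in the variable $x_j$ (the $l$-th power of $f\mapsto f(\dots,x_j+t_j,\dots)-f(\dots,x_j,\dots)$); for $e\subset\{1,\dots,d\}$ let $\Delta^l_{\mathbf t}(e):=\prod_{j\in e}\Delta^l_{t_j,j}$, with $\Delta^l_{\mathbf t}(\varnothing)$ the identity. With $l:=[r]+1$, $\mathbf H^r_q$ is the set of $f\in L_q(\mathbb T^d)$ such that $\|\Delta^l_{\mathbf t}(e)f\|_q\le\prod_{j\in e}|t_j|^r$ for every $e\subset\{1,\dots,d\}$ and every $\mathbf t$. Class $\mathbf W^{a,b}_A$. For $\mathbf s\in\mathbb N_0^d$ let $\rho(\mathbf s):=\{\mathbf k\in\mathbb Z^d:[2^{s_j-1}]\le|k_j|<2^{s_j},\ j=1,\dots,d\}$, $\delta_{\mathbf s}(f,\mathbf x):=\sum_{\mathbf k\in\rho(\mathbf s)}\hat f(\mathbf k)e^{i(\mathbf k,\mathbf x)}$, $f_j:=\sum_{\|\mathbf s\|_1=j}\delta_{\mathbf s}(f)$ for $j\in\mathbb N_0$, and $\|f\|_A:=\sum_{\mathbf k}|\hat f(\mathbf k)|$. For $a\ge 0$ and $b\in\mathbb R$, $$\mathbf W^{a,b}_A:=\{f\in L_1(\mathbb T^d):\ \|f_j\|_A\le2^{-aj}(\bar j)^{(d-1)b},\ \bar j:=\max(j,1),\ j\in\mathbb N\}.$$ *)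

(* Defs.v *)
From HB Require Import structures.
From mathcomp Require Import all_boot all_order all_algebra.
From mathcomp Require Import all_classical all_reals all_analysis.
From mathcomp Require Import complex.

Set Implicit Arguments.
Unset Strict Implicit.
Unset Printing Implicit Defensive.

Import Order.TTheory GRing.Theory Num.Theory numFieldNormedType.Exports.
Import ComplexField.Normc.

Local Open Scope classical_set_scope.
Local Open Scope complex_scope.
Local Open Scope ring_scope.

(* Points of R^d; measurableTypeR R is R with its Borel sigma-algebra, as used
   by lebesgue_measure, and d.-tuple carries the product sigma-algebra. *)
Notation pts R d := (d.-tuple (measurableTypeR R)).

Section lebesgue_pts.
Context {R : realType}.

Definition consp n (p : measurableTypeR R * pts R n) : pts R n.+1 :=
  [tuple of p.1 :: p.2].

Lemma measurable_consp n : measurable_fun setT (@consp n).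
Proof. exact: measurable_cons. Qed.

Section step.
Variables (n : nat) (mu : {sigma_finite_measure set (pts R n) -> \bar R}).

Definition lebesgue_step : set (pts R n.+1) -> \bar R :=
  pushforward (@lebesgue_measure R \x mu)%E (@consp n).

Let step0 : lebesgue_step set0 = 0%E.
Proof. by rewrite /lebesgue_step /pushforward preimage_set0 measure0. Qed.

Let step_ge0 A : (0 <= lebesgue_step A)%E.
Proof. by rewrite /lebesgue_step /pushforward; exact: measure_ge0. Qed.

Let step_sigma_additive : semi_sigma_additive lebesgue_step.
Proof.
move=> F mF tF mUF; rewrite /lebesgue_step /pushforward preimage_bigcup.
have mc := @measurable_consp n.
apply: measure_semi_sigma_additive.
- by move=> k; rewrite -[X in measurable X]setTI; exact: mc.
- apply/trivIsetP => /= i j _ _ ij; rewrite -preimage_setI.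
  by move/trivIsetP : tF => /(_ _ _ _ _ ij) ->//; rewrite preimage_set0.
- by rewrite -preimage_bigcup -[X in measurable X]setTI; exact: mc.
Qed.

HB.instance Definition _ := isMeasure.Build _ _ _ lebesgue_step
  step0 step_ge0 step_sigma_additive.

Let unconsp (x : pts R n.+1) : measurableTypeR R * pts R n :=
  (tnth x ord0, [tuple of behead x]).

Let unconsp_consp p : unconsp (consp p) = p.
Proof. by case: p => a t; congr pair; apply: val_inj. Qed.

Let measurable_unconsp : measurable_fun setT unconsp.
Proof.
apply/measurable_fun_pairP; split.
- exact: measurable_tnth.
- exact: measurable_behead.
Qed.

Let step_sigma_finite : sigma_finite setT lebesgue_step.
Proof.
have /sigma_finiteP[F [TF ndF Foo]] := sigma_finiteT (@lebesgue_measure R).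
have /sigma_finiteP[G [TG ndG Goo]] := sigma_finiteT mu.
exists (fun k => unconsp @^-1` (F k `*` G k)).
  rewrite -preimage_bigcup; apply/esym; rewrite -subTset => x _ /=.
  have : [set: measurableTypeR R] (unconsp x).1 by [].
  have : [set: pts R n] (unconsp x).2 by [].
  rewrite {1}TG {1}TF => -[k _ Gk] [m _ Fm]; exists (maxn m k) => //; split.
  - by move: (unconsp x).1 Fm; exact/subsetPset/ndF/leq_maxl.
  - by move: (unconsp x).2 Gk; exact/subsetPset/ndG/leq_maxr.
move=> k; have [mF Fk] := Foo k; have [mG Gk] := Goo k; split.
  rewrite -[X in measurable X]setTI; apply: measurable_unconsp => //.
  exact: measurableX.
rewrite /lebesgue_step /pushforward (_ : _ @^-1` _ = F k `*` G k).
  by rewrite product_measure1E// lte_mul_pinfty// ge0_fin_numE.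
by apply/funext => p; rewrite -[in RHS](unconsp_consp p).
Qed.

HB.instance Definition _ := Measure_isSigmaFinite.Build _ _ _ lebesgue_step
  step_sigma_finite.

End step.

(* d-dimensional Lebesgue measure, as an iterated product measure *)
Fixpoint lebesgue_pts d : {sigma_finite_measure set (pts R d) -> \bar R} :=
  if d is n.+1 then lebesgue_step (lebesgue_pts n) else \d_([tuple]).

End lebesgue_pts.

Section classes.
Context {R : realType} {d : nat}.
Implicit Types (f g phi : pts R d -> R[i]) (x y : pts R d) (q r a b : R).

Definition shift_pt x (j : 'I_d) (t : R) : pts R d :=
  [tuple ((tnth x i : R) + (if i == j then t else 0) : R) | i < d].

Definition sub_pt x y : pts R d :=
  [tuple ((tnth x i : R) - (tnth y i : R) : R) | i < d].

Definition torus : set (pts R d) :=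
  [set x | forall i, 0 <= (tnth x i : R) <= 2 * pi].

Definition periodic f := forall x j, f (shift_pt x j (2 * pi)) = f x.

Definition cmeasurable f :=
  measurable_fun setT (fun x => complex.Re (f x) : R) /\
  measurable_fun setT (fun x => complex.Im (f x) : R).

(* (2 pi)^-d times the integral over the torus *)
Definition cmean f : R[i] :=
  (((2 * pi) ^- d)%:C *
   ((\int[lebesgue_pts d]_(x in torus) complex.Re (f x)) +i*
    (\int[lebesgue_pts d]_(x in torus) complex.Im (f x))))%R.

Definition lqnorm q f : \bar R :=
  ((((2 * pi) ^- d)%:E *
    \int[lebesgue_pts d]_(x in torus) (normc (f x) `^ q)%:E) `^ q^-1)%E.

(* Representatives of elements of L_q(T^d): every class modulo null sets
   contains a Borel measurable, everywhere periodic function. *)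
Definition Lq q : set (pts R d -> R[i]) :=
  [set f | [/\ periodic f, cmeasurable f & (lqnorm q f < +oo)%E]].

Definition cis (t : R) : R[i] := cos t +i* sin t.

Definition dotp (k : d.-tuple int) x : R :=
  \sum_(i < d) (tnth k i)%:~R * (tnth x i : R).

Definition fourier f (k : d.-tuple int) : R[i] :=
  cmean (fun x => f x * cis (- dotp k x)).

(* The series converges for x outside 2 pi Z (for every x when r >= 1); at the
   remaining points, a null set, limn may return an arbitrary value. *)
Definition F1 r (x : R) : R :=
  1 + 2 * limn (fun n : nat =>
    \sum_(1 <= k < n.+1) k%:R `^ (- r) * cos (k%:R * x - r * pi / 2)).

Definition Fd r x : R := \prod_(j < d) F1 r (tnth x j).

Definition conv phi (F : pts R d -> R) x : R[i] :=
  cmean (fun y => phi y * (F (sub_pt x y))%:C).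

(* The identity f = phi * F_r is between elements of L_q, hence a.e. *)
Definition Wclass r q : set (pts R d -> R[i]) :=
  [set f | [/\ periodic f, cmeasurable f &
    exists phi, [/\ Lq q phi, (lqnorm q phi <= 1)%E &
      {ae lebesgue_pts d, forall x, f x = conv phi (Fd r) x}]]].

Definition diff1 (j : 'I_d) (t : R) f : pts R d -> R[i] :=
  fun x => f (shift_pt x j t) - f x.

(* Delta^l_t(e): the composition over j in e of the l-th powers of diff1 j;
   these commute, so the order is immaterial. *)
Definition mdiff (l : nat) (t : 'I_d -> R) (e : {set 'I_d}) f :=
  (\big[comp/id]_(j in e) iter l (diff1 j (t j))) f.

Definition Hclass r q : set (pts R d -> R[i]) :=
  [set f | Lq q f /\ forall (e : {set 'I_d}) (t : 'I_d -> R),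
    (lqnorm q (mdiff (Num.truncn r).+1 t e f)
       <= (\prod_(j in e) `|t j| `^ r)%:E)%E].

(* (2 ^ n %/ 2)%N is the integer part of 2^(n-1), also when n = 0. *)
Definition rho (s : d.-tuple nat) : set (d.-tuple int) :=
  [set k | forall j,
     (2 ^ tnth s j %/ 2 <= `|tnth k j|%N < 2 ^ tnth s j)%N].

(* rho s is finite, as is the index set of fblock, so these \sum_(_ \in _)
   are genuine finite sums. *)
Definition delta (s : d.-tuple nat) f : pts R d -> R[i] :=
  fun x => \sum_(k \in rho s) fourier f k * cis (dotp k x).

Definition fblock (j : nat) f : pts R d -> R[i] :=
  fun x => \sum_(s \in [set s : d.-tuple nat | (\sum_(i < d) tnth s i)%N = j])
    delta s f x.

Definition normA f : \bar R :=
  (\esum_(k in [set: d.-tuple int]) (normc (fourier f k))%:E)%E.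

Definition WAclass a b : set (pts R d -> R[i]) :=
  [set f | Lq 1 f /\ forall j : nat, (0 < j)%N ->
    (normA (fblock j f) <=
      (2 `^ (- (a * j%:R)) * (maxn j 1)%:R `^ ((d%:R - 1) * b))%:E)%E].

Definition embeds (F G : set (pts R d -> R[i])) :=
  exists2 C : R, 0 < C & forall f, F f -> G (fun x => (C^-1)%:C * f x).

End classes.

Arguments Wclass {R} d r q.
Arguments Hclass {R} d r q.
Arguments WAclass {R} d a b.

(* Main.v *)
Require Import Defs.
From mathcomp Require Import all_boot all_order all_algebra.
From mathcomp Require Import all_classical all_reals all_analysis measurable_realfun.
From mathcomp Require finmap.
From mathcomp Require Import complex ring lra zify.

(** Fix f and a level j >= 1.  The j-th block f_j collects the frequencies k
    whose dyadic levels sum to j; there are at most (j+1)^(d-1) 2^j of them, and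
    membership in the target class says that the sum of the coefficient moduli
    over the block is O(2^(-(r-1/q)j) j^((d-1)b)).  The coefficients are
    controlled by the multivariate Hardy-Littlewood-Paley inequality
    (torus_paley): for 1 < q <= 2,

      sum_k prod_i (1+|k_i|)^(q-2) |g^(k)|^q <= C^d ||g||_q^q.

    On the block the weight is at least 2^(-j(2-q)), so Hoelder's inequality
    bounds the sum of |g^(k)| over a set of at most 2^j J frequencies of
    level j by a multiple of 2^(j/q) J^(1-1/q) ||g||_q (block_bound).

    For a convolution f = phi * F_r one has f^(k) = phi^(k) F_r^(k)
    (torus_coef_conv) with |F_r^(k)| = O(2^(-rj)) on the block
    (normc_torus_coef_Fd_le), and g = phi, J = (j+1)^(d-1) give the exponent
    b = 1 - 1/q.  The convergence and integrability of the one-dimensional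
    kernel have to be established as well: its series converges off the period
    lattice by Abel summation, and since r > 1/q >= 1/2 its partial sums are
    Cauchy in L_2 of the circle, so that integration term by term is legitimate.

    For f with bounded mixed differences the suitable steps depend on the level
    vector, so the block is first split into its rectangles rho(s), |s|_1 = j.
    With steps
    2^(-s_i) the multiplier prod_i (exp(i k_i 2^(-s_i)) - 1)^l of the mixed
    difference is bounded below on rho(s) (fourier_le_mdiff), while the
    difference has L_q norm at most 2^(-rj).  As rho(s) has at most 2^j
    elements, the case J = 1 (block_bound1) gives O(2^(-(r-1/q)j)) per rectangle, also
    for q = 1 where |g^(k)| <= ||g||_1 suffices; there are at most (j+1)^(d-1)
    rectangles, hence b = 1.

    The Paley inequality is proved on the circle from a weak-type estimate: at
    height t, the part of g where |g| <= t is handled by Bessel's inequality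
    and the rest by |g^(k)| <= ||g||_1; the estimates at dyadic heights are
    summed.  It passes to the torus one variable at a time. *)

Set Implicit Arguments.
Unset Strict Implicit.
Unset Printing Implicit Defensive.

Import Order.TTheory GRing.Theory Num.Theory numFieldNormedType.Exports.
Import ComplexField.Normc.

Local Open Scope classical_set_scope.
Local Open Scope complex_scope.
Local Open Scope ring_scope.

(** * Complex-valued integration *)

Section normc_facts.
Context {R : realType}.
Implicit Types z w : R[i].

Lemma normcE z : normc z = Num.sqrt (complex.Re z ^+ 2 + complex.Im z ^+ 2).
Proof. by case: z. Qed.

Lemma normc_ge0 z : 0 <= normc z.
Proof. by rewrite normcE sqrtr_ge0. Qed.

Lemma ler_normcD z w : normc (z + w) <= normc z + normc w.
Proof. by have := lec_normD z w; rewrite /lec /= => /andP[_]. Qed.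

Lemma normcR (x : R) : normc x%:C = `|x|.
Proof. by rewrite normcE /= expr0n /= addr0 sqrtr_sqr. Qed.

Lemma normc_sqr z : normc z ^+ 2 = complex.Re z ^+ 2 + complex.Im z ^+ 2.
Proof. by rewrite normcE sqr_sqrtr// addr_ge0// sqr_ge0. Qed.

Lemma ler_Re_normc z : `|complex.Re z| <= normc z.
Proof.
by rewrite normcE -sqrtr_sqr ler_wsqrtr// lerDl sqr_ge0.
Qed.

Lemma ler_Im_normc z : `|complex.Im z| <= normc z.
Proof.
by rewrite normcE -sqrtr_sqr ler_wsqrtr// lerDr sqr_ge0.
Qed.

Lemma normc_ler_ReIm z : normc z <= `|complex.Re z| + `|complex.Im z|.
Proof.
have h : 0 <= `|complex.Re z| + `|complex.Im z| by rewrite addr_ge0.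
rewrite -(@ler_pXn2r _ 2)// ?nnegrE ?normc_ge0// normc_sqr sqrrD.
rewrite !real_normK ?num_real// addrAC lerDl mulrn_wge0// mulr_ge0//.
Qed.

Lemma normc_conj z : normc z^*%C = normc z.
Proof. by case: z => a b /=; rewrite sqrrN. Qed.

Lemma mulc_conj z : z * z^*%C = (normc z ^+ 2)%:C.
Proof.
by case: z => a b; rewrite normc_sqr /= /real_complex_def; congr Complex => /=; ring.
Qed.

Lemma complex_ReM z w : complex.Re (z * w) =
  complex.Re z * complex.Re w - complex.Im z * complex.Im w.
Proof. by case: z w => a b [c e]. Qed.

Lemma complex_ImM z w : complex.Im (z * w) =
  complex.Re z * complex.Im w + complex.Im z * complex.Re w.
Proof. by case: z w => a b [c e]. Qed.

Lemma complex_ReD z w : complex.Re (z + w) = complex.Re z + complex.Re w.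
Proof. by case: z w => a b [c e]. Qed.

Lemma complex_ImD z w : complex.Im (z + w) = complex.Im z + complex.Im w.
Proof. by case: z w => a b [c e]. Qed.

Lemma cis0 : cis 0 = 1 :> R[i].
Proof. by rewrite /cis cos0 sin0. Qed.

Lemma cisD (x y : R) : cis (x + y) = cis x * cis y.
Proof. by rewrite /cis cosD sinD /= [RHS]/GRing.mul /=; congr Complex; ring. Qed.

Lemma cis_conj (x : R) : (cis x)^*%C = cis (- x).
Proof. by rewrite /cis cosN sinN. Qed.

Lemma normc_cis (x : R) : normc (cis x) = 1.
Proof. by rewrite normcE /= cos2Dsin2 sqrtr1. Qed.

End normc_facts.

Section cint_def.
Context {R : realType} {dT : measure_display} {T : measurableType dT}.
Implicit Types (f g : T -> R[i]) (D : set T).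

Definition cmfun f := measurable_fun setT (fun x => complex.Re (f x) : R) /\
  measurable_fun setT (fun x => complex.Im (f x) : R).

Definition cint (mu : {measure set T -> \bar R}) D f : R[i] :=
  (\int[mu]_(x in D) complex.Re (f x)) +i* (\int[mu]_(x in D) complex.Im (f x)).

Definition cintegrable (mu : {measure set T -> \bar R}) D f :=
  cmfun f /\ (\int[mu]_(x in D) (normc (f x))%:E < +oo)%E.

Lemma cmfun_cst (c : R[i]) : cmfun (fun=> c).
Proof. by split; apply: measurable_cst. Qed.

Lemma cmfunD f g : cmfun f -> cmfun g -> cmfun (fun x => f x + g x).
Proof.
move=> [f1 f2] [g1 g2]; split; under eq_fun do rewrite (complex_ReD, complex_ImD).
  exact: measurable_funD.
exact: measurable_funD.
Qed.

Lemma cmfunM f g : cmfun f -> cmfun g -> cmfun (fun x => f x * g x).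
Proof.
move=> [f1 f2] [g1 g2]; split; under eq_fun do rewrite (complex_ReM, complex_ImM).
  by apply: measurable_funB; apply: measurable_funM.
by apply: measurable_funD; apply: measurable_funM.
Qed.

Lemma cmfunR (h : T -> R) : measurable_fun setT h -> cmfun (fun x => (h x)%:C).
Proof. by move=> mh; split => //=; apply: measurable_cst. Qed.

Lemma cmfunN f : cmfun f -> cmfun (fun x => - f x).
Proof.
by move=> mf; under eq_fun do rewrite -mulN1r; apply: cmfunM => //; apply: cmfun_cst.
Qed.

Lemma cmfun_sum I (s : seq I) (P : pred I) (F : I -> T -> R[i]) :
  (forall i, cmfun (F i)) -> cmfun (fun x => \sum_(i <- s | P i) F i x).
Proof.
move=> mF; elim: s => [|i s IH].
  by under eq_fun do rewrite big_nil; apply: cmfun_cst.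
under eq_fun do rewrite big_cons; case: (P i) => //.
exact: cmfunD.
Qed.

Lemma measurable_normc f : cmfun f -> measurable_fun setT (fun x => normc (f x)).
Proof.
move=> [f1 f2]; under eq_fun do rewrite normcE.
apply: (measurableT_comp (f := @Num.sqrt R)).
  by apply: continuous_measurable_fun; exact: sqrt_continuous.
by apply: measurable_funD; apply: measurable_funX.
Qed.

End cint_def.

Lemma cmfun_comp {R : realType} d1 (T1 : measurableType d1) d2 (T2 : measurableType d2)
  (f : T2 -> R[i]) (h : T1 -> T2) :
  cmfun f -> measurable_fun setT h -> cmfun (f \o h).
Proof.
move=> [f1 f2] mh; split.
  exact: (measurableT_comp (f := fun x => complex.Re (f x))).
exact: (measurableT_comp (f := fun x => complex.Im (f x))).
Qed.

Section cint_theory.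
Context {R : realType} {dT : measure_display} {T : measurableType dT}.
Context (mu : {measure set T -> \bar R}) (D : set T) (mD : measurable D).
Implicit Types (f g : T -> R[i]).
Local Notation cintegrable := (cintegrable mu D).
Local Notation cint := (cint mu D).

Lemma eq_cint f g : (forall x, D x -> f x = g x) -> cint f = cint g.
Proof.
by move=> fg; congr Complex; apply: eq_Rintegral => x /set_mem Dx /=; rewrite fg.
Qed.

Lemma measurable_EFin_normc f : cmfun f -> measurable_fun D (fun x => (normc (f x))%:E : \bar R).
Proof.
by move=> mf; apply/measurable_EFinP; apply: measurable_funTS; apply: measurable_normc.
Qed.

Lemma cintegrable_le f g : cmfun f -> cintegrable g ->
  (forall x, D x -> normc (f x) <= normc (g x)) -> cintegrable f.
Proof.
move=> mf [mg gi] fg; split => //; apply: le_lt_trans gi.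
apply: ge0_le_integral => //; try exact: measurable_EFin_normc.
by move=> x _; rewrite lee_fin normc_ge0.
Qed.

Lemma cintegrable_Re f : cintegrable f -> mu.-integrable D (EFin \o (fun x => complex.Re (f x))).
Proof.
move=> [mf fi]; apply/integrableP; split.
  by apply/measurable_EFinP; apply: measurable_funTS; case: mf.
apply: le_lt_trans fi; apply: ge0_le_integral => //.
- by apply/measurable_EFinP; apply: measurableT_comp => //; apply: measurable_funTS; case: mf.
- exact: measurable_EFin_normc.
- by move=> x Dx /=; rewrite lee_fin ler_Re_normc.
Qed.

Lemma cintegrable_Im f : cintegrable f -> mu.-integrable D (EFin \o (fun x => complex.Im (f x))).
Proof.
move=> [mf fi]; apply/integrableP; split.
  by apply/measurable_EFinP; apply: measurable_funTS; case: mf.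
apply: le_lt_trans fi; apply: ge0_le_integral => //.
- by apply/measurable_EFinP; apply: measurableT_comp => //; apply: measurable_funTS; case: mf.
- exact: measurable_EFin_normc.
- by move=> x Dx /=; rewrite lee_fin ler_Im_normc.
Qed.

Lemma cintegrableD f g : cintegrable f -> cintegrable g ->
  cintegrable (fun x => f x + g x).
Proof.
move=> [mf fi] [mg gi]; split; first exact: cmfunD.
apply: (@le_lt_trans _ _ (\int[mu]_(x in D) ((normc (f x))%:E + (normc (g x))%:E))%E).
  apply: ge0_le_integral => //.
  - by move=> x _; rewrite lee_fin normc_ge0.
  - by apply: measurable_EFin_normc; apply: cmfunD.
  - by apply: emeasurable_funD; apply: measurable_EFin_normc.
  - by move=> x _; rewrite -EFinD lee_fin ler_normcD.
rewrite ge0_integralD//; try exact: measurable_EFin_normc.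
- by rewrite lte_add_pinfty.
- by move=> x _; rewrite lee_fin normc_ge0.
- by move=> x _; rewrite lee_fin normc_ge0.
Qed.

Lemma cintegrableM f g (M : R) : cintegrable f -> cmfun g ->
  (forall x, D x -> normc (g x) <= M) -> cintegrable (fun x => f x * g x).
Proof.
move=> [mf fi] mg gM; split; first exact: cmfunM.
have [M0|M0] := leP M 0; last first.
apply: (@le_lt_trans _ _ (\int[mu]_(x in D) (M%:E * (normc (f x))%:E))%E).
  apply: ge0_le_integral => //.
  - by move=> x _; rewrite lee_fin normc_ge0.
  - by apply: measurable_EFin_normc; apply: cmfunM.
  - by apply: emeasurable_funM => //; apply: measurable_EFin_normc.
  - by move=> x Dx; rewrite -EFinM lee_fin normcM mulrC ler_wpM2r ?normc_ge0 ?gM.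
rewrite ge0_integralZl_EFin//; try exact: measurable_EFin_normc.
- by rewrite lte_mul_pinfty// ?lee_fin ltW.
- by move=> x _; rewrite lee_fin normc_ge0.
- exact: ltW.
rewrite integral0_eq// => x Dx; congr EFin.
apply/eqP; rewrite eq_le normc_ge0 andbT normcM.
rewrite (_ : normc (g x) = 0) ?mulr0//; apply/eqP; rewrite eq_le normc_ge0 andbT.
by rewrite (le_trans _ M0)// gM.
Qed.

Lemma cintegrableZ f c : cintegrable f -> cintegrable (fun x => c * f x).
Proof.
move=> fi; under eq_fun do rewrite mulrC.
by apply: (cintegrableM (M := normc c)) => //; apply: cmfun_cst.
Qed.

Lemma cintegrable0 : cintegrable (fun=> 0).
Proof.
split; first exact: cmfun_cst.
by rewrite integral0_eq// => x _; rewrite normc0.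
Qed.

Lemma cintegrable_sum I (s : seq I) (P : pred I) (F : I -> T -> R[i]) :
  (forall i, cintegrable (F i)) -> cintegrable (fun x => \sum_(i <- s | P i) F i x).
Proof.
move=> mF; elim: s => [|i s IH].
  by under eq_fun do rewrite big_nil; apply: cintegrable0.
under eq_fun do rewrite big_cons; case: (P i) => //.
exact: cintegrableD.
Qed.

Lemma cintD f g : cintegrable f -> cintegrable g ->
  cint (fun x => f x + g x) = cint f + cint g.
Proof.
move=> fi gi; rewrite /cint [RHS]/GRing.add /=; congr Complex.
  under eq_Rintegral do rewrite complex_ReD.
  by rewrite RintegralD//; exact: cintegrable_Re.
under eq_Rintegral do rewrite complex_ImD.
by rewrite RintegralD//; exact: cintegrable_Im.
Qed.

Lemma cintZ f c : cintegrable f -> cint (fun x => c * f x) = c * cint f.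
Proof.
move=> fi; have fR := cintegrable_Re fi; have fI := cintegrable_Im fi.
case: c => a b; rewrite /cint [RHS]/GRing.mul /=; congr Complex.
  under eq_Rintegral do rewrite complex_ReM.
  rewrite RintegralB ?RintegralZl//; [exact: (integrableZl _ a fR)|exact: (integrableZl _ b fI)].
under eq_Rintegral do rewrite complex_ImM.
rewrite RintegralD ?RintegralZl//; [exact: (integrableZl _ a fI)|exact: (integrableZl _ b fR)].
Qed.

Lemma cint0 : cint (fun=> 0) = 0.
Proof. by rewrite /cint /= !Rintegral_cst// !mul0r. Qed.

Lemma cint_sum I (s : seq I) (P : pred I) (F : I -> T -> R[i]) :
  (forall i, cintegrable (F i)) ->
  cint (fun x => \sum_(i <- s | P i) F i x) = \sum_(i <- s | P i) cint (F i).
Proof.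
move=> iF; elim: s => [|i s IH].
  by under eq_fun do rewrite big_nil; rewrite big_nil cint0.
under eq_fun do rewrite big_cons; rewrite big_cons; case: (P i) => //.
by rewrite cintD ?IH//; exact: cintegrable_sum.
Qed.

Lemma cintB f g : cintegrable f -> cintegrable g ->
  cint (fun x => f x - g x) = cint f - cint g.
Proof.
move=> fi gi; under eq_fun do rewrite -mulN1r.
by rewrite cintD// ?cintZ// ?mulN1r//; exact: cintegrableZ.
Qed.

(** The factor 2 comes from estimating the real and imaginary parts separately; it
    spares the rotation argument and only affects constants. *)
Lemma cint_norm_le f : cmfun f ->
  ((normc (cint f))%:E <= 2%:E * \int[mu]_(x in D) (normc (f x))%:E)%E.
Proof.
move=> mf; have [/lt_eqF/negbT|] := boolP (\int[mu]_(x in D) (normc (f x))%:E < +oo)%E; last first.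
  by rewrite -leNgt leye_eq => /eqP ->; rewrite gt0_muley ?leey// lte_fin.
move=> fi; have {}fi : cintegrable f by split=> //; rewrite ltey.
apply: (@le_trans _ _ (`|\int[mu]_(x in D) complex.Re (f x)|%:E + `|\int[mu]_(x in D) complex.Im (f x)|%:E)%E).
  by rewrite -EFinD lee_fin normc_ler_ReIm.
have mn := measurable_EFin_normc mf.
have h (h : T -> R) : mu.-integrable D (EFin \o h) -> (forall x, `|h x| <= normc (f x)) ->
  (`|\int[mu]_(x in D) h x|%:E <= \int[mu]_(x in D) (normc (f x))%:E)%E.
  move=> hi hf; rewrite EFin_normr_Rintegral//; apply: le_trans (le_abse_integral _ _ _) _ => //.
    by case/integrableP : hi.
  apply: ge0_le_integral => //.
    by apply: measurableT_comp => //; case/integrableP: hi.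
  by move=> x _; rewrite lee_fin.
rewrite mule_natl mule2n leeD// h//.
- exact: cintegrable_Re.
- by move=> x; exact: ler_Re_normc.
- exact: cintegrable_Im.
- by move=> x; exact: ler_Im_normc.
Qed.

End cint_theory.

(** * Iterated integrals over product sets *)

Section iterated.
Context {R : realType} d1 d2 (T1 : measurableType d1) (T2 : measurableType d2).
Context (m1 : {sigma_finite_measure set T1 -> \bar R}).
Context (m2 : {sigma_finite_measure set T2 -> \bar R}).
Context (D1 : set T1) (D2 : set T2) (mD1 : measurable D1) (mD2 : measurable D2).

Let mD12 : measurable (D1 `*` D2). Proof. exact: measurableX. Qed.

Lemma measurable_restrict_setT d (T : measurableType d) (D : set T) (h : T -> \bar R) :
  measurable D -> measurable_fun setT h -> measurable_fun setT (h \_ D).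
Proof.
move=> mD mh; apply/(measurable_restrictT _ mD).
exact: measurable_funTS.
Qed.

(** The product measure lives on the whole product space, so restrictions to
    rectangles go through extension by zero. *)
Lemma measurable_section_integral (h : T1 * T2 -> \bar R) :
  measurable_fun setT h -> (forall z, 0 <= h z)%E ->
  measurable_fun setT (fun x => \int[m2]_(y in D2) h (x, y))%E.
Proof.
move=> mh h0.
pose k := h \_ (setT `*` D2).
have mk : measurable_fun setT k by apply: measurable_restrict_setT => //; exact: measurableX.
have k0 z : (0 <= k z)%E by rewrite /k patchE; case: ifP.
have := measurable_fun_fubini_tonelli_F (m2 := m2) k mk k0.
apply: eq_measurable_fun => x _; rewrite /fubini_F [RHS]integral_mkcond.
apply: eq_integral => y _; rewrite /k !patchE.
by congr (if _ then _ else _); apply/idP/idP => /set_mem => [[]|] H; apply/mem_set.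
Qed.

Lemma tonelli_setX1 (h : T1 * T2 -> \bar R) :
  measurable_fun setT h -> (forall z, 0 <= h z)%E ->
  (\int[m1 \x m2]_(z in D1 `*` D2) h z = \int[m1]_(x in D1) \int[m2]_(y in D2) h (x, y))%E.
Proof.
move=> mh h0; rewrite integral_mkcond fubini_tonelli1; last 2 first.
- exact: measurable_restrict_setT.
- by move=> z; rewrite patchE; case: ifP.
rewrite [RHS]integral_mkcond; apply: eq_integral => x _.
rewrite /fubini_F patchE; case: ifPn => xD.
  rewrite [RHS]integral_mkcond; apply: eq_integral => y _; rewrite !patchE.
  congr (if _ then _ else _); apply/idP/idP => /set_mem => [[]|] H; apply/mem_set => //.
  by split => //=; exact: set_mem.
rewrite integral0_eq// => y _; rewrite patchE ifF//; apply/negbTE.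
by apply: contra xD => /set_mem[] /= H _; apply/mem_set.
Qed.

Lemma tonelli_setX2 (h : T1 * T2 -> \bar R) :
  measurable_fun setT h -> (forall z, 0 <= h z)%E ->
  (\int[m1 \x m2]_(z in D1 `*` D2) h z = \int[m2]_(y in D2) \int[m1]_(x in D1) h (x, y))%E.
Proof.
move=> mh h0; rewrite integral_mkcond fubini_tonelli2; last 2 first.
- exact: measurable_restrict_setT.
- by move=> z; rewrite patchE; case: ifP.
rewrite [RHS]integral_mkcond; apply: eq_integral => x _.
rewrite /fubini_G patchE; case: ifPn => xD.
  rewrite [RHS]integral_mkcond; apply: eq_integral => y _; rewrite !patchE.
  congr (if _ then _ else _); apply/idP/idP => /set_mem => [[/= H _]|H]; apply/mem_set => //.
  by split => //=; exact: set_mem.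
rewrite integral0_eq// => y _; rewrite patchE ifF//; apply/negbTE.
by apply: contra xD => /set_mem[] /= _ H; apply/mem_set.
Qed.

Lemma Rintegral_fine d (T : measurableType d) (m : {measure set T -> \bar R})
    (D : set T) (F : T -> \bar R) : measurable D -> m.-integrable D F ->
  \int[m]_(x in D) fine (F x) = fine (\int[m]_(x in D) F x)%E.
Proof.
move=> mD iF; have [mF _] := integrableP _ _ _ iF.
congr fine; apply: ae_eq_integral => //.
  by apply/measurable_EFinP; exact: measurableT_comp.
have := integrable_ae mD iF; apply: filterS => x h Dx.
by rewrite fineK// h.
Qed.

Lemma integrable_fubini_G (h : T1 * T2 -> \bar R) :
  (m1 \x m2)%E.-integrable setT h -> m2.-integrable setT (fubini_G m1 h).
Proof.
move=> ih; have mh := measurable_int _ ih; apply/integrableP; split.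
  exact: (measurable_fubini_G ih).
apply: le_lt_trans ((integrable21ltyP m1 m2 mh).1 ih); apply: ge0_le_integral => //.
- by apply: measurableT_comp => //; exact: (measurable_fubini_G ih).
- have mah : measurable_fun setT (abse \o h) by exact: measurableT_comp.
  exact: (measurable_fun_fubini_tonelli_G _ mah (fun=> abse_ge0 _)).
- by move=> y _; apply: le_abse_integral => //; exact: measurableT_comp.
Qed.

(** The inner integrals of an integrable function may be infinite on a null set, where the real
    valued integral takes a default value; Rintegral_fine absorbs this. *)
Lemma Rfubini_setX (h : T1 * T2 -> R) :
  (m1 \x m2)%E.-integrable (D1 `*` D2) (EFin \o h) ->
  (\int[(m1 \x m2)%E]_(z in D1 `*` D2) h z = \int[m1]_(x in D1) \int[m2]_(y in D2) h (x, y)) *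
  (\int[(m1 \x m2)%E]_(z in D1 `*` D2) h z = \int[m2]_(y in D2) \int[m1]_(x in D1) h (x, y)).
Proof.
move=> ih; have {}ih : (m1 \x m2)%E.-integrable setT ((EFin \o h) \_ (D1 `*` D2)).
  exact/(integrable_mkcond _ mD12).
have inner1 x : D1 x -> (\int[m2]_y ((EFin \o h) \_ (D1 `*` D2)) (x, y) =
    \int[m2]_(y in D2) (h (x, y))%:E)%E.
  move=> Dx; rewrite [RHS]integral_mkcond; apply: eq_integral => y _; rewrite !patchE.
  congr (if _ then _ else _); apply/idP/idP => /set_mem => [[]|] H; exact/mem_set.
have inner2 y : D2 y -> (\int[m1]_x ((EFin \o h) \_ (D1 `*` D2)) (x, y) =
    \int[m1]_(x in D1) (h (x, y))%:E)%E.
  move=> Dy; rewrite [RHS]integral_mkcond; apply: eq_integral => x _; rewrite !patchE.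
  congr (if _ then _ else _); apply/idP/idP => /set_mem => [[H _]|H]; exact/mem_set.
split.
  rewrite [RHS](@Rintegral_fine _ _ m1 D1 (fun x => \int[m2]_(y in D2) (h (x, y))%:E)%E)//; last first.
    apply: eq_integrable (integrableS measurableT mD1 (@subsetT _ _) (integrable_fubini_F ih)) => //.
    by move=> x /set_mem Dx; rewrite -inner1.
  rewrite /Rintegral; congr fine; rewrite integral_mkcond -integral12_prod_meas1// [RHS]integral_mkcond.
  apply: eq_integral => x _; rewrite [RHS]patchE; case: ifPn => [/set_mem|] xD.
    by rewrite -inner1.
  rewrite /fubini_F integral0_eq// => y _; rewrite patchE ifF//; apply/negbTE.
  by apply: contra xD => /set_mem[] /= H _; apply/mem_set.
rewrite [RHS](@Rintegral_fine _ _ m2 D2 (fun y => \int[m1]_(x in D1) (h (x, y))%:E)%E)//; last first.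
  apply: eq_integrable (integrableS measurableT mD2 (@subsetT _ _) (integrable_fubini_G ih)) => //.
  by move=> x /set_mem Dx; rewrite -inner2.
rewrite /Rintegral; congr fine; rewrite integral_mkcond -integral21_prod_meas1// [RHS]integral_mkcond.
apply: eq_integral => x _; rewrite [RHS]patchE; case: ifPn => [/set_mem|] xD.
  by rewrite -inner2.
rewrite /fubini_G integral0_eq// => y _; rewrite patchE ifF//; apply/negbTE.
by apply: contra xD => /set_mem[] /= _ H; apply/mem_set.
Qed.

Lemma cint_fubini1 (h : T1 * T2 -> R[i]) :
  cintegrable (m1 \x m2)%E (D1 `*` D2) h ->
  cint (m1 \x m2)%E (D1 `*` D2) h = cint m1 D1 (fun x => cint m2 D2 (fun y => h (x, y))).
Proof.
move=> ih; rewrite /cint; congr Complex.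
  exact: (Rfubini_setX (cintegrable_Re mD12 ih)).1.
exact: (Rfubini_setX (cintegrable_Im mD12 ih)).1.
Qed.

Lemma cint_fubini2 (h : T1 * T2 -> R[i]) :
  cintegrable (m1 \x m2)%E (D1 `*` D2) h ->
  cint (m1 \x m2)%E (D1 `*` D2) h = cint m2 D2 (fun y => cint m1 D1 (fun x => h (x, y))).
Proof.
move=> ih; rewrite /cint; congr Complex.
  exact: (Rfubini_setX (cintegrable_Re mD12 ih)).2.
exact: (Rfubini_setX (cintegrable_Im mD12 ih)).2.
Qed.

Lemma measurable_section_Rintegral (h : T1 * T2 -> R) : measurable_fun setT h ->
  measurable_fun setT (fun x => \int[m2]_(y in D2) h (x, y)).
Proof.
move=> mh; have meh : measurable_fun setT (EFin \o h) by exact/measurable_EFinP.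
apply: (measurableT_comp (f := @fine R)) => //.
under eq_fun do rewrite integralE.
apply: emeasurable_funB.
  have /= := measurable_section_integral (measurable_funepos meh) (fun z => funepos_ge0 _ z).
  apply: eq_measurable_fun => x _; apply: eq_integral => y _; by rewrite ?funeposE ?funenegE.
have /= := measurable_section_integral (measurable_funeneg meh) (fun z => funeneg_ge0 _ z).
apply: eq_measurable_fun => x _; apply: eq_integral => y _; by rewrite ?funeposE ?funenegE.
Qed.

Lemma cmfun_section (h : T1 * T2 -> R[i]) : cmfun h ->
  cmfun (fun x => cint m2 D2 (fun y => h (x, y))).
Proof.
by move=> [h1 h2]; split; [exact: (measurable_section_Rintegral h1)|exact: (measurable_section_Rintegral h2)].
Qed.

End iterated.

(** * The torus as a product of circles *)

Section torus_product.
Context {R : realType}.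
Local Notation leb := (@lebesgue_measure R).
Local Notation mu := (@lebesgue_pts R).
Local Notation circle := (`[0, 2 * pi]%classic : set (measurableTypeR R)).

Lemma twopi_gt0 : 0 < 2 * pi :> R.
Proof. by rewrite mulr_gt0// pi_gt0. Qed.

Lemma measurable_circle : measurable (circle).
Proof. exact: measurable_itv. Qed.

Lemma tnth_consp0 n (p : measurableTypeR R * pts R n) : tnth (consp p) ord0 = p.1.
Proof. by rewrite (tnth_nth 0). Qed.

Lemma tnth_consp_lift n (p : measurableTypeR R * pts R n) i :
  tnth (consp p) (lift ord0 i) = tnth p.2 i.
Proof. by rewrite !(tnth_nth 0). Qed.

(** The measure on the torus is an iterated pushforward along consp, so every
    statement about the torus is proved by peeling off the first coordinate; this
    is what makes the peeling possible. *)
Lemma torus_consp n : (@consp R n) @^-1` (@torus R n.+1) = circle `*` @torus R n.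
Proof.
apply/seteqP; split=> [[a t] /= h|[a t] /= [ha ht] i].
  split=> /=.
    by have := h ord0; rewrite tnth_consp0/= in_itv.
  by move=> i; have := h (lift ord0 i); rewrite tnth_consp_lift.
have [->|[j ->]] : i = ord0 \/ exists j, i = lift ord0 j.
    by case: (unliftP ord0 i) => [j ->|->]; [right; exists j|left].
  by rewrite tnth_consp0/=; move: ha; rewrite in_itv.
by rewrite tnth_consp_lift.
Qed.

Lemma measurable_torus n : measurable (@torus R n).
Proof.
rewrite (_ : torus = \bigcap_(i in [set: 'I_n]) ((fun x : pts R n => tnth x i) @^-1` circle)).
  apply: fin_bigcap_measurable => // i _.
  by rewrite -[X in measurable X]setTI; apply: measurable_tnth.
apply/seteqP; split=> x /= h i.
  by move=> _ /=; rewrite in_itv/=; exact: h.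
by have := h i I; rewrite /= in_itv.
Qed.

Lemma ge0_integral_consp n (h : pts R n.+1 -> \bar R) :
  measurable_fun setT h -> (forall x, 0 <= h x)%E ->
  (\int[mu n.+1]_(x in torus) h x =
   \int[(leb \x mu n)%E]_(z in circle `*` torus) h (consp z))%E.
Proof.
move=> mh h0; rewrite -torus_consp.
have := @ge0_integral_pushforward _ _ _ _ R (@consp R n) (@measurable_consp R n) (leb \x mu n)%E
  (@torus R n.+1) h (@measurable_torus n.+1).
apply => //.
exact: measurable_funTS.
Qed.

Lemma tonelli_consp n (h : pts R n.+1 -> \bar R) :
  measurable_fun setT h -> (forall x, 0 <= h x)%E ->
  (\int[mu n.+1]_(x in torus) h x =
   \int[leb]_(a in circle) \int[mu n]_(x in torus) h (consp (a, x)))%E.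
Proof.
move=> mh h0; rewrite ge0_integral_consp// tonelli_setX1//.
- exact: measurable_torus.
- exact: (measurableT_comp mh (@measurable_consp R n)).
Qed.

Lemma tonelli_consp2 n (h : pts R n.+1 -> \bar R) :
  measurable_fun setT h -> (forall x, 0 <= h x)%E ->
  (\int[mu n.+1]_(x in torus) h x =
   \int[mu n]_(x in torus) \int[leb]_(a in circle) h (consp (a, x)))%E.
Proof.
move=> mh h0; rewrite ge0_integral_consp// tonelli_setX2//.
- exact: measurable_torus.
- exact: (measurableT_comp mh (@measurable_consp R n)).
Qed.

Lemma cintegrable_consp n (h : pts R n.+1 -> R[i]) :
  cintegrable (mu n.+1) torus h ->
  cintegrable (leb \x mu n)%E (circle `*` torus) (h \o @consp R n).
Proof.
move=> [mh ih]; split; first exact: cmfun_comp mh (@measurable_consp R n).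
move: ih; rewrite ge0_integral_consp//.
- by apply: measurableT_comp => //; exact: measurable_normc.
- by move=> x; rewrite lee_fin normc_ge0.
Qed.

Lemma Rintegral_consp n (h : pts R n.+1 -> R) : measurable_fun setT h ->
  (leb \x mu n)%E.-integrable (circle `*` torus) (EFin \o h \o @consp R n) ->
  (\int[mu n.+1]_(x in torus) h x =
   \int[(leb \x mu n)%E]_(z in circle `*` torus) h (consp z)).
Proof.
move=> mh; rewrite -torus_consp => ih; congr fine.
apply: (integral_pushforward (@measurable_consp R n)) ih (@measurable_torus n.+1).
exact/measurable_EFinP.
Qed.

Lemma cint_consp n (h : pts R n.+1 -> R[i]) :
  cintegrable (mu n.+1) torus h ->
  cint (mu n.+1) torus h = cint (leb \x mu n)%E (circle `*` torus) (h \o @consp R n).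
Proof.
move=> ih; have [[h1 h2] _] := ih; have ih' := cintegrable_consp ih.
have mD : measurable (circle `*` @torus R n).
  by apply: measurableX; [exact: measurable_circle|exact: measurable_torus].
rewrite /cint; congr Complex.
  exact: (Rintegral_consp h1 (cintegrable_Re mD ih')).
exact: (Rintegral_consp h2 (cintegrable_Im mD ih')).
Qed.

Lemma cint_consp1 n (h : pts R n.+1 -> R[i]) :
  cintegrable (mu n.+1) torus h ->
  cint (mu n.+1) torus h = cint leb circle (fun a => cint (mu n) torus (fun x => h (consp (a, x)))).
Proof.
move=> ih; rewrite cint_consp// cint_fubini1//; last exact: cintegrable_consp.
exact: measurable_torus.
Qed.

Lemma cint_consp2 n (h : pts R n.+1 -> R[i]) :
  cintegrable (mu n.+1) torus h ->
  cint (mu n.+1) torus h = cint (mu n) torus (fun x => cint leb circle (fun a => h (consp (a, x)))).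
Proof.
move=> ih; rewrite cint_consp// cint_fubini2//; last exact: cintegrable_consp.
exact: measurable_torus.
Qed.

Lemma lebesgue_circle : leb circle = (2 * pi)%:E.
Proof. by rewrite lebesgue_measure_itv/= lte_fin twopi_gt0 -EFinB subr0. Qed.

Lemma lebesgue_torus n : mu n torus = ((2 * pi) ^+ n)%:E.
Proof.
elim: n => [|n IH].
  rewrite expr0 /= diracE mem_set//= => -[].
  by [].
rewrite -[LHS]mul1e -(@integral_cst _ _ _ _ _ (@measurable_torus n.+1) 1%E) tonelli_consp//.
transitivity (\int[leb]_(a in circle) ((2 * pi) ^+ n)%:E)%E.
  apply: eq_integral => a _; rewrite integral_cst ?mul1e; last exact: measurable_torus.
  exact: IH.
rewrite integral_cst//; transitivity (((2 * pi) ^+ n : R)%:E * (2 * pi : R)%:E)%E.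
  by congr (_ * _)%E; exact: lebesgue_circle.
by rewrite -EFinM exprSr.
Qed.

End torus_product.

(** * Orthogonality of the characters of the circle *)

Section circle_characters.
Context {R : realType}.
Local Notation leb := (@lebesgue_measure R).
Local Notation circle := (`[0, 2 * pi]%classic : set (measurableTypeR R)).

Lemma cis_int2pi (m : int) : cis (m%:~R * (2 * pi)) = 1 :> R[i].
Proof.
have h n : cis (n%:R * (2 * pi)) = 1 :> R[i].
  elim: n => [|n IH]; first by rewrite mul0r cis0.
  by rewrite -natr1 mulrDl cisD IH mul1r mul1r /cis mulrC mulr_natr cos2pi sin2pi.
case: m => n; first exact: h.
by rewrite NegzE mulrNz mulNr -cis_conj h /= /real_complex_def oppr0.
Qed.

Lemma cis_periodic (m : int) (x : R) : cis (m%:~R * (x + 2 * pi)) = cis (m%:~R * x).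
Proof. by rewrite mulrDr cisD cis_int2pi mulr1. Qed.

Lemma continuous_cosM (m : R) : continuous (fun x : R => cos (m * x)).
Proof.
move=> x; apply: (@continuous_comp _ _ _ (fun x => m * x) cos).
  by apply: mulrl_continuous.
exact: continuous_cos.
Qed.

Lemma continuous_sinM (m : R) : continuous (fun x : R => sin (m * x)).
Proof.
move=> x; apply: (@continuous_comp _ _ _ (fun x => m * x) sin).
  by apply: mulrl_continuous.
exact: continuous_sin.
Qed.

Lemma cmfun_cisM (m : R) : cmfun (fun x : measurableTypeR R => cis (m * x)).
Proof.
split; apply: continuous_measurable_fun.
  exact: continuous_cosM.
exact: continuous_sinM.
Qed.

Lemma cintegrable_cst (c : R[i]) : cintegrable leb circle (fun=> c).
Proof.
split; first exact: cmfun_cst.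
rewrite integral_cst; last exact: measurable_circle.
rewrite [X in (_ * X)%E](_ : _ = (2 * pi)%:E); last exact: lebesgue_circle.
by rewrite -EFinM ltry.
Qed.

Lemma cintegrable_cisM (m : R) : cintegrable leb circle (fun x => cis (m * x)).
Proof.
apply: cintegrable_le (cintegrable_cst 1) _ => //.
- exact: cmfun_cisM.
- by move=> x _; rewrite normc_cis normc1.
Qed.

Lemma is_derive_sinM (m x : R) : is_derive x 1 (fun x => sin (m * x)) (m * cos (m * x)).
Proof.
have h : is_derive x (1:R) (fun x => m * x) m.
  have := @is_deriveZ _ _ _ (id : R -> R) m x 1 1 _.
  rewrite /GRing.scale /= mulr1; apply; exact: is_derive_id.
have := @is_derive1_comp _ sin (fun x => m * x) x _ _ (is_derive_sin (m * x)) h.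
by rewrite mulrC.
Qed.

Lemma is_derive_cosM (m x : R) : is_derive x 1 (fun x => cos (m * x)) (- (m * sin (m * x))).
Proof.
have h : is_derive x (1:R) (fun x => m * x) m.
  have := @is_deriveZ _ _ _ (id : R -> R) m x 1 1 _.
  rewrite /GRing.scale /= mulr1; apply; exact: is_derive_id.
have := @is_derive1_comp _ cos (fun x => m * x) x _ _ (is_derive_cos (m * x)) h.
by rewrite mulNr mulrC.
Qed.

Lemma Rintegral_FTC2 (f F : R -> R) : continuous f ->
  (forall x, is_derive x (1 : R) F (f x)) ->
  \int[leb]_(x in circle) f x = F (2 * pi) - F 0.
Proof.
move=> cf dF; rewrite /Rintegral (@continuous_FTC2 _ f F)//.
- exact: twopi_gt0.
- exact: continuous_subspaceT.
- have cF : continuous F.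
    move=> x; apply: differentiable_continuous; apply/derivable1_diffP.
    by have [] := dF x.
  split.
  + by move=> x _; have [] := dF x.
  + by apply: cvg_at_right_filter; exact: cF.
  + by apply: cvg_at_left_filter; exact: cF.
- by move=> x _; rewrite derive1E; have [] := dF x.
Qed.

Lemma cint_cis (m : int) :
  cint leb circle (fun x => cis (m%:~R * x)) = if m == 0 then (2 * pi)%:C else 0.
Proof.
have [->|m0] := eqVneq m 0.
  rewrite /cint; congr Complex.
    under eq_Rintegral do rewrite mul0r /= cos0.
    rewrite Rintegral_cst ?mul1r; last exact: measurable_circle.
    by rewrite [X in fine X](_ : _ = (2 * pi)%:E); last exact: lebesgue_circle.
  under eq_Rintegral do rewrite mul0r /= sin0.
  by rewrite Rintegral_cst ?mul0r//; exact: measurable_circle.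
have mr0 : m%:~R != 0 :> R by rewrite intr_eq0.
rewrite /cint; congr Complex => /=.
  transitivity ((fun x => m%:~R^-1 * sin (m%:~R * x)) (2 * pi) - m%:~R^-1 * sin (m%:~R * 0) : R).
    apply: (@Rintegral_FTC2 _ (fun x => m%:~R^-1 * sin (m%:~R * x))).
      exact: continuous_cosM.
    move=> x; have h := is_derive_sinM m%:~R x.
    have := is_deriveZ (m%:~R^-1 : R) h.
    by rewrite /GRing.scale /= mulKf.
  have := cis_int2pi m; rewrite /cis => -[_ ->].
  by rewrite !mulr0 sin0 mulr0 subrr.
transitivity ((fun x => - m%:~R^-1 * cos (m%:~R * x)) (2 * pi) - (- m%:~R^-1 * cos (m%:~R * 0)) : R).
  apply: (@Rintegral_FTC2 _ (fun x => - m%:~R^-1 * cos (m%:~R * x))).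
    exact: continuous_sinM.
  move=> x; have h := is_derive_cosM m%:~R x.
  have := is_deriveZ (- m%:~R^-1 : R) h.
  by rewrite /GRing.scale /= mulrNN mulKf.
have := cis_int2pi m; rewrite /cis => -[-> _].
by rewrite !mulr0 cos0 subrr.
Qed.

End circle_characters.

(** * Bessel's inequality on the circle *)

Section integrability.
Context {R : realType} d (T : measurableType d) (mu : {measure set T -> \bar R}).
Context (D : set T) (mD : measurable D) (muD : (mu D < +oo)%E).

Lemma ler_powR1 (a q : R) : 0 <= a -> 1 <= q -> a <= 1 + a `^ q.
Proof.
move=> a0 q1; have [a1|a1] := leP a 1; first by rewrite (le_trans a1)// lerDl powR_ge0.
rewrite -[leLHS]add0r lerD// -[leLHS](powRr1 a0).
by rewrite ler_powR// ltW.
Qed.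

Lemma measurable_normc_powR (f : T -> R[i]) (q : R) : cmfun f ->
  measurable_fun setT (fun x => normc (f x) `^ q).
Proof.
move=> mf; apply: (measurableT_comp (f := fun a : R => a `^ q)).
  exact: measurable_powR.
exact: measurable_normc.
Qed.

Lemma cintegrable_powR (f : T -> R[i]) (q : R) : 1 <= q -> cmfun f ->
  (\int[mu]_(x in D) (normc (f x) `^ q)%:E < +oo)%E -> cintegrable mu D f.
Proof.
move=> q1 mf fi; split=> //.
apply: (@le_lt_trans _ _ (\int[mu]_(x in D) (1%:E + (normc (f x) `^ q)%:E))%E).
  apply: ge0_le_integral => //.
  - by move=> x _; rewrite lee_fin normc_ge0.
  - exact: measurable_EFin_normc.
  - apply: emeasurable_funD => //; apply/measurable_EFinP; apply: measurable_funTS.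
    exact: measurable_normc_powR.
  - by move=> x _; rewrite -EFinD lee_fin ler_powR1// normc_ge0.
rewrite ge0_integralD//.
- by rewrite lte_add_pinfty// integral_cst// mul1e.
- by move=> x _; rewrite lee_fin powR_ge0.
- apply/measurable_EFinP; apply: measurable_funTS; exact: measurable_normc_powR.
Qed.

End integrability.

Lemma conjcM {R : realType} (z w : R[i]) : (z * w)^*%C = z^*%C * w^*%C.
Proof.
by case: z w => a b [c e]; rewrite ![in LHS]/GRing.mul ![in RHS]/GRing.mul /=; congr Complex; ring.
Qed.

Lemma realCM {R : realType} (x y : R) : (x * y)%:C = x%:C * y%:C :> R[i].
Proof. by rewrite [RHS]/GRing.mul /= !mul0r !mulr0 subr0 addr0. Qed.

Lemma realC_sum {R : realType} I (s : seq I) (P : pred I) (F : I -> R) :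
  (\sum_(i <- s | P i) F i)%:C = \sum_(i <- s | P i) (F i)%:C :> R[i].
Proof. exact: rmorph_sum. Qed.

Section bessel.
Context {R : realType}.
Local Notation leb := (@lebesgue_measure R).
Local Notation circle := (`[0, 2 * pi]%classic : set (measurableTypeR R)).
Local Notation N := (2 * pi : R).

Lemma circle_lty : (leb circle < +oo)%E.
Proof. by rewrite [X in (X < _)%E](_ : _ = N%:E) ?ltry//; exact: lebesgue_circle. Qed.

(** Parseval's identity for trigonometric polynomials: expand the square and
    integrate the products of characters. *)
Lemma cint_trig_sqr (I : finType) (e : I -> int) (c : I -> R[i]) : injective e ->
  (\int[leb]_(x in circle) (normc (\sum_i c i * cis ((e i)%:~R * x)) ^+ 2)%:E =
  (N * \sum_i normc (c i) ^+ 2)%:E)%E.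
Proof.
move=> einj; pose Q (x : measurableTypeR R) : R[i] := \sum_i c i * cis ((e i)%:~R * (x : R)).
have mc := @measurable_circle R.
have QE : (fun x => Q x * (Q x)^*%C) =
    (fun x => \sum_i \sum_l (c i * (c l)^*%C) * cis ((e i - e l)%:~R * x)).
  apply/funext => x; rewrite /Q rmorph_sum /= mulr_suml; apply: eq_bigr => i _.
  rewrite mulr_sumr; apply: eq_bigr => l _.
  by rewrite conjcM cis_conj mulrACA -cisD intrB mulrBl.
have iQ : cintegrable leb circle (fun x => Q x * (Q x)^*%C).
  rewrite QE.
  apply: cintegrable_sum => // i; apply: cintegrable_sum => // l.
  by apply: cintegrableZ => //; exact: cintegrable_cisM.
have : cint leb circle (fun x => Q x * (Q x)^*%C) = (N * \sum_i normc (c i) ^+ 2)%:C.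
  rewrite QE.
  rewrite cint_sum//; last first.
    move=> i; apply: cintegrable_sum => // l.
    by apply: cintegrableZ => //; exact: cintegrable_cisM.
  rewrite mulr_sumr realC_sum; apply: eq_bigr => i _.
  rewrite cint_sum//; last first.
    by move=> l; apply: cintegrableZ => //; exact: cintegrable_cisM.
  rewrite (bigD1 i)//= big1 ?addr0 => [|l li].
    rewrite cintZ//; last exact: cintegrable_cisM.
    by rewrite cint_cis subrr eqxx mulc_conj [RHS]realCM [RHS]mulrC.
  rewrite cintZ//; last exact: cintegrable_cisM.
  rewrite cint_cis subr_eq0 ifF ?mulr0//; apply/negbTE.
  by apply: contra li => /eqP/einj ->.
move=> /(congr1 (@complex.Re R)) /=.
rewrite /Rintegral => <-; rewrite fineK; last first.
  by apply: integrable_fin_num => //; exact: (cintegrable_Re mc iQ).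
by apply: eq_integral => x _; rewrite mulc_conj.
Qed.

(** Integrating g against Q, the trigonometric polynomial built from the conjugates of its own
    coefficients, yields their sum of squares S.  Then S is at most 2 ||g Q||_1, Young's
    inequality splits the product, and Parseval's identity for Q absorbs half
    of S on the left. *)
Lemma bessel (I : finType) (e : I -> int) (g : measurableTypeR R -> R[i]) :
  injective e -> cmfun g ->
  ((\sum_i normc (cint leb circle (fun x => g x * cis (- ((e i)%:~R * x)))) ^+ 2)%:E <=
   (4 * N)%:E * \int[leb]_(x in circle) (normc (g x) ^+ 2)%:E)%E.
Proof.
move=> einj mg; have mc := @measurable_circle R; have N0 := @twopi_gt0 R.
set c := fun i => cint leb circle (fun x => g x * cis (- ((e i)%:~R * x))).
set S := \sum_i normc (c i) ^+ 2; set A := (\int[leb]_(x in circle) _)%E.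
have [Aoo|] := boolP (A < +oo)%E; last first.
  by rewrite -leNgt leye_eq => /eqP ->; rewrite gt0_muley ?leey// lte_fin mulr_gt0.
have A0 : (0 <= A)%E by apply: integral_ge0 => x _; rewrite lee_fin sqr_ge0.
have ig : cintegrable leb circle g.
  apply: (cintegrable_powR mc circle_lty (q := 2)) => //; first by rewrite ler1n.
  move: Aoo; congr (_ < _)%E; apply: eq_integral => x _.
  by rewrite powR_mulrn// normc_ge0.
pose e' i := - e i.
have e'inj : injective e' by move=> i l /oppr_inj/einj.
pose Q x : R[i] := \sum_i (c i)^*%C * cis ((e' i)%:~R * x).
have chrE i x : cis (- ((e i)%:~R * x)) = cis ((e' i)%:~R * x) :> R[i].
  by rewrite /e' mulrNz mulNr.
have mQ : cmfun (Q : measurableTypeR R -> R[i]).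
  apply: cmfun_sum => i; apply: cmfunM; [exact: cmfun_cst|exact: cmfun_cisM].
have igc i : cintegrable leb circle (fun x => g x * cis ((e' i)%:~R * x)).
  apply: (cintegrableM mc (M := 1)) => //; first exact: cmfun_cisM.
  by move=> x _; rewrite normc_cis.
have SE : cint leb circle (fun x => g x * Q x) = S%:C.
  rewrite (_ : (fun x => _) = (fun x => \sum_i (c i)^*%C * (g x * cis ((e' i)%:~R * x)))); last first.
    by apply/funext => x; rewrite mulr_sumr; apply: eq_bigr => i _; rewrite mulrCA.
  rewrite cint_sum//; last by move=> i; exact: cintegrableZ.
  rewrite realC_sum; apply: eq_bigr => i _; rewrite cintZ//.
  rewrite -mulc_conj [RHS]mulrC; congr (_ * _); apply: eq_cint => x _.
  by rewrite chrE.
have S0 : 0 <= S by apply: sumr_ge0 => i _; rewrite sqr_ge0.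
have ISQ : (\int[leb]_(x in circle) (normc (Q x) ^+ 2)%:E = (N * S)%:E)%E.
  rewrite cint_trig_sqr//; congr (N * _)%:E; apply: eq_bigr => i _.
  by rewrite normc_conj.
have mn1 (f : measurableTypeR R -> R[i]) : cmfun f ->
    measurable_fun circle (fun x => (normc (f x) ^+ 2)%:E : \bar R).
  move=> mf; apply/measurable_EFinP; apply: measurable_funTS.
  by apply: measurable_funX; exact: measurable_normc.
have mn2 (f : measurableTypeR R -> R[i]) (k : R) : cmfun f ->
    measurable_fun circle (fun x => (k * normc (f x) ^+ 2)%:E : \bar R).
  move=> mf; apply/measurable_EFinP; apply: measurable_funTS.
  by apply: measurable_funM => //; apply: measurable_funX; exact: measurable_normc.
have : (S%:E <= (2 * N)%:E * A + (S / 2)%:E)%E.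
  rewrite -[S in X in (X <= _)%E](ger0_norm S0) -normcR -SE.
  apply: le_trans (cint_norm_le _ _ _) _ => //; first exact: cmfunM.
  have -> : ((2 * N)%:E * A = \int[leb]_(x in circle) ((2 * N) * normc (g x) ^+ 2)%:E)%E.
    rewrite -ge0_integralZl_EFin//.
    - by move=> x _; rewrite lee_fin sqr_ge0.
    - exact: mn1.
    - by rewrite mulr_ge0// ltW.
  have -> : ((S / 2)%:E = \int[leb]_(x in circle) ((2 * N)^-1 * normc (Q x) ^+ 2)%:E)%E.
    transitivity ((2 * N)^-1%:E * (N * S)%:E)%E.
      rewrite -EFinM; congr EFin; move: N0; move: (2 * pi : R) => p p0.
      by field; rewrite lt0r_neq0.
    rewrite -ISQ -ge0_integralZl_EFin//.
    - by move=> x _; rewrite lee_fin sqr_ge0.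
    - exact: mn1.
    - by rewrite invr_ge0 mulr_ge0// ltW.
  rewrite -ge0_integralD//; last 4 first.
  - by move=> x _; rewrite lee_fin mulr_ge0 ?sqr_ge0// mulr_ge0// ltW.
  - exact: mn2.
  - by move=> x _; rewrite lee_fin mulr_ge0 ?sqr_ge0// invr_ge0 mulr_ge0// ltW.
  - exact: mn2.
  rewrite -ge0_integralZl_EFin//; last 2 first.
  - by move=> x _; rewrite lee_fin normc_ge0.
  - by apply: measurable_EFin_normc => //; exact: cmfunM.
  apply: ge0_le_integral => //.
  - by move=> x _; rewrite -EFinM lee_fin mulr_ge0// normc_ge0.
  - apply: emeasurable_funM => //; apply: measurable_EFin_normc => //; exact: cmfunM.
  - by apply: emeasurable_funD; exact: mn2.
  move=> x _; rewrite -EFinM -EFinD lee_fin normcM.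
  have := sqr_ge0 ((2 * N) * normc (g x) - normc (Q x)).
  set a := normc _; set b := normc _ => h; rewrite -subr_ge0.
  have N20 : 0 < 2 * N by rewrite mulr_gt0.
  rewrite -(@pmulr_rge0 _ (2 * N))//.
  rewrite (_ : (2 * N) * (2 * N * a ^+ 2 + (2 * N)^-1 * b ^+ 2 - 2 * (a * b)) =
    (2 * N * a - b) ^+ 2)//.
  by move: N0; move: (2 * pi : R) => p p0; field; rewrite lt0r_neq0.
rewrite -(fineK (x := A)) ?ge0_fin_numE// -!EFinM -EFinD !lee_fin; lra.
Qed.

End bessel.

(** * The Hardy-Littlewood-Paley inequality on the circle *)

Section sums.
Context {R : realType}.

(** Telescoping comparison with 2/k; the subtracted term carries the induction. *)
Lemma sum_inv_sqr_tail (M k : nat) :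
  \sum_(m < M | (k <= m)%N) (m.+1%:R ^- 2 : R) <= 2 / k.+1%:R - 2 / (maxn M k).+1%:R.
Proof.
elim: M => [|M IH]; first by rewrite big_ord0 max0n subrr.
rewrite big_mkcond big_ord_recr -big_mkcond /=.
have [kM|Mk] := leqP k M; last first.
  rewrite addr0; apply: le_trans IH _.
  by rewrite (maxn_idPr Mk) (maxn_idPr (ltnW Mk)).
rewrite (maxn_idPl kM) in IH; rewrite (maxn_idPl (leqW kM)).
apply: (@le_trans _ _ (2 / k.+1%:R - 2 / M.+1%:R + M.+1%:R ^- 2)); first by rewrite lerD2r.
rewrite -subr_ge0.
set a : R := M.+1%:R; have a1 : 1 <= a by rewrite ler1n.
have -> : M.+2%:R = a + 1 :> R by rewrite -[M.+2]addn1 natrD.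
have -> : 2 / k.+1%:R - 2 / (a + 1) - (2 / k.+1%:R - 2 / a + a ^- 2) =
   (a - 1) / (a ^+ 2 * (a + 1)).
  by field; rewrite !lt0r_neq0//; lra.
by rewrite divr_ge0 ?subr_ge0// mulr_ge0 ?sqr_ge0//; lra.
Qed.

Lemma sum_inv_sqr_gt (M : nat) (y : R) : 0 < y ->
  \sum_(m < M | y < m.+1%:R) (m.+1%:R ^- 2 : R) <= 2 / y.
Proof.
move=> y0; have y0' := ltW y0.
pose k := Num.truncn y.
have /andP[ky yk] : k%:R <= y < k.+1%:R by apply: truncn_itv.
apply: (@le_trans _ _ (\sum_(m < M | (k <= m)%N) (m.+1%:R ^- 2 : R))).
  rewrite [leLHS]big_mkcond [leRHS]big_mkcond; apply: ler_sum => m _.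
  case: ifPn => ym; case: ifPn => // km; rewrite ?invr_ge0 ?sqr_ge0//.
  exfalso; move: km; rewrite -ltnNge => mk.
  have : m.+1%:R <= k%:R :> R by rewrite ler_nat.
  by rewrite leNgt (le_lt_trans ky ym).
apply: le_trans (sum_inv_sqr_tail _ _) _.
apply: (@le_trans _ _ (2 / k.+1%:R)).
  by rewrite lerBlDr lerDl divr_ge0.
rewrite ler_pM2l// lef_pV2 ?posrE ?ltr0n//; exact: ltW.
Qed.

(** The shift by one makes the weight positive at the frequency 0 and matches
    1 + |k| in Paley's inequality. *)
Definition freq (k : int) : R := (absz k).+1%:R.

Lemma freq_gt0 k : 0 < freq k. Proof. by rewrite ltr0n. Qed.

Lemma card_absz_eq (I : finType) (e : I -> int) (m : nat) : injective e ->
  (#|[pred i | absz (e i) == m]| <= 2)%N.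
Proof.
move=> einj; rewrite -(card_in_imset (f := fun i => (e i < 0)%R)) => [|i l].
  by rewrite (leq_trans (max_card _))// card_bool.
rewrite !inE => /eqP im /eqP lm h; apply: einj; lia.
Qed.

Lemma sum_inv_sqr_freq (I : finType) (e : I -> int) (y : R) : injective e -> 0 < y ->
  \sum_(i | y < freq (e i)) freq (e i) ^- 2 <= 4 / y.
Proof.
move=> einj y0; pose M := (\max_i absz (e i)).+1.
have eM i : (absz (e i) < M)%N by rewrite ltnS; exact: (leq_bigmax i).
rewrite (partition_big (fun i => Ordinal (eM i)) (fun m : 'I_M => y < m.+1%:R)) //=.
apply: (@le_trans _ _ (\sum_(m < M | y < m.+1%:R) (m.+1%:R ^- 2 *+ 2 : R))).
  apply: ler_sum => m ym.
  rewrite (eq_bigr (fun=> m.+1%:R ^- 2)); last by move=> i /andP[_ /eqP <-].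
  rewrite sumr_const ler_wpMn2l// ?invr_ge0 ?sqr_ge0//.
  apply: leq_trans (card_absz_eq m einj); apply: subset_leq_card.
  by apply/fintype.subsetP => i; rewrite !inE => /andP[_ /eqP <-].
rewrite sumrMnl (_ : 4 / y = 2 / y *+ 2); last by rewrite mulr2n -mulrDl; congr (_ / _); lra.
by rewrite lerMn2r/= sum_inv_sqr_gt.
Qed.

Lemma powR2N_lt1 (b : R) : 0 < b -> 2 `^ (- b) < 1.
Proof.
move=> b0; rewrite powRN invf_lt1 ?powR_gt0//.
have := gt0_ltr_powR b0 (x := 1 : R) (y := 2).
by rewrite powR1; apply; rewrite ?nnegrE// ltr1n.
Qed.

Definition geoC (b : R) := (1 - 2 `^ (- b))^-1.

Lemma geoC_gt0 b : 0 < b -> 0 < geoC b.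
Proof. by move=> b0; rewrite invr_gt0 subr_gt0 powR2N_lt1. Qed.

Lemma geoCE b : 0 < b -> 1 + geoC b * 2 `^ (- b) = geoC b.
Proof.
move=> b0; have h := powR2N_lt1 b0; rewrite /geoC; set z := 2 `^ _ in h *.
by field; rewrite lt0r_neq0// subr_gt0.
Qed.

(** Up to a constant, a geometric sum is its largest term. *)
Lemma sum_geo_lt (b t a : R) (n : nat) : 0 < b -> 0 < t ->
  \sum_(j < n | t * 2 ^+ j < a) (t * 2 ^+ j) `^ b <= geoC b * a `^ b.
Proof.
move=> b0 t0; have C0 := geoC_gt0 b0.
have h k : \sum_(j < k.+1) (t * 2 ^+ j) `^ b <= geoC b * (t * 2 ^+ k) `^ b.
  elim: k => [|k IH].
    rewrite big_ord_recl big_ord0 addr0 expr0 mulr1.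
    rewrite ler_peMl ?powR_ge0// -geoCE// lerDl mulr_ge0 ?powR_ge0//; exact: ltW.
  rewrite big_ord_recr /=; apply: (@le_trans _ _ (geoC b * (t * 2 ^+ k) `^ b + (t * 2 ^+ k.+1) `^ b)).
    by rewrite lerD2r.
  have -> : (t * 2 ^+ k) `^ b = 2 `^ (- b) * (t * 2 ^+ k.+1) `^ b.
    rewrite exprS (mulrCA t) (@powRM _ 2) ?mulr_ge0 ?exprn_ge0//; last exact: ltW.
    by rewrite mulrA powRN mulVf ?mul1r// lt0r_neq0// powR_gt0.
  by rewrite mulrA -[X in _ + X]mul1r -mulrDl addrC geoCE.
elim: n => [|n IH]; first by rewrite big_ord0 mulr_ge0 ?powR_ge0// ltW.
have [ta|ta] := ltP (t * 2 ^+ n) a; last first.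
  by rewrite big_mkcond big_ord_recr -big_mkcond /= ltNge ta addr0.
apply: (@le_trans _ _ (geoC b * (t * 2 ^+ n) `^ b)).
  apply: le_trans (h n); rewrite big_mkcond; apply: ler_sum => j _.
  by case: ifP => // _; rewrite powR_ge0.
have tn0 : 0 < t * 2 ^+ n by rewrite mulr_gt0// exprn_gt0.
rewrite ler_pM2l//; apply: ge0_ler_powR; rewrite ?nnegrE; try exact: ltW.
by rewrite ltW// (lt_trans tn0).
Qed.

(** The companion of sum_geo_lt, for negative exponents. *)
Lemma sum_geo_ge (b t a : R) (n : nat) : 0 < b -> 0 < t -> 0 < a ->
  \sum_(j < n | a <= t * 2 ^+ j) (t * 2 ^+ j) `^ (- b) <= geoC b * a `^ (- b).
Proof.
move=> b0 + a0; have C0 := geoC_gt0 b0.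
have shift s j : s * 2 ^+ (lift ord0 j : 'I_n.+1) = (2 * s) * 2 ^+ j :> R.
  by rewrite lift0 exprS mulrCA mulrA.
have h k s : 0 < s -> \sum_(j < k) (s * 2 ^+ j) `^ (- b) <= geoC b * s `^ (- b).
  elim: k s => [|k IH] s s0; first by rewrite big_ord0 mulr_ge0 ?powR_ge0// ltW.
  rewrite big_ord_recl expr0 mulr1.
  under eq_bigr => j _ do rewrite lift0 exprS mulrCA mulrA.
  apply: (@le_trans _ _ (s `^ (- b) + geoC b * (2 * s) `^ (- b))).
    by rewrite lerD2l IH// mulr_gt0.
  by rewrite powRM//; [rewrite mulrA -[X in X + _]mul1r -mulrDl geoCE|exact: ltW].
clear shift; elim: n t => [|n IH] t t0; first by rewrite big_ord0 mulr_ge0 ?powR_ge0// ltW.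
have [ta|ta] := leP a t.
  apply: (@le_trans _ _ (geoC b * t `^ (- b))).
    apply: le_trans (h n.+1 t t0); rewrite big_mkcond; apply: ler_sum => j _.
    by case: ifP => // _; rewrite powR_ge0.
  rewrite ler_pM2l// !powRN lef_pV2 ?posrE ?powR_gt0//.
  by apply: (ge0_ler_powR (ltW b0)) ta; rewrite nnegrE ltW.
rewrite big_mkcond big_ord_recl expr0 mulr1 [a <= t]leNgt ta /= add0r -big_mkcond.
under eq_bigl => j do rewrite /bump /= add1n exprS mulrCA mulrA.
under eq_bigr => j _ do rewrite /bump /= add1n exprS mulrCA mulrA.
by apply: IH; rewrite mulr_gt0.
Qed.

Lemma exists_lower_scale (s : seq R) : (forall x, x \in s -> 0 <= x) ->
  exists2 t, 0 < t & forall x, x \in s -> 0 < x -> t < x.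
Proof.
elim: s => [|x s IH] h; first by exists 1.
have [|t t0 ht] := IH; first by move=> y ys; apply: h; rewrite inE ys orbT.
have [x0|x0] := leP x 0.
  exists t => // y; rewrite inE => /orP[/eqP->|]; first by rewrite ltNge x0.
  exact: ht.
exists (Num.min t (x / 2)); first by rewrite lt_min t0 divr_gt0.
move=> y; rewrite inE => /orP[/eqP-> _|ys y0].
  by rewrite gt_min ltr_pdivrMr// ltr_pMr// ltr1n orbT.
by rewrite gt_min ht.
Qed.

Lemma exists_upper_scale (s : seq R) (t : R) : 0 < t ->
  exists n, forall x, x \in s -> x <= t * 2 ^+ n.
Proof.
move=> t0; elim: s => [|x s [n IH]]; first by exists 0%N.
have [m hm] : exists m, x <= t * 2 ^+ m.
  exists (Num.truncn (x / t)).+1; rewrite -ler_pdivrMl// mulrC.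
  apply: (@le_trans _ _ ((Num.truncn (x / t)).+1)%:R); first exact/ltW/truncnS_gt.
  by rewrite -natrX ler_nat ltnW// ltn_expl.
exists (maxn n m) => y; rewrite inE => /orP[/eqP ->|/IH h].
  by apply: (le_trans hm); rewrite ler_pM2l// ler_eXn2l ?ltr1n// leq_maxr.
by apply: (le_trans h); rewrite ler_pM2l// ler_eXn2l ?ltr1n// leq_maxl.
Qed.

Lemma dyadic_level (t x : R) (n : nat) : 0 < t -> t < x -> x <= t * 2 ^+ n ->
  exists2 j : 'I_n, t * 2 ^+ j < x & x <= t * 2 ^+ j.+1.
Proof.
move=> t0 tx xn; have ex : exists m, x <= t * 2 ^+ m by exists n.
case: (ex_minnP ex) => -[|m] xm hm; first by move: xm; rewrite expr0 mulr1 leNgt tx.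
have mn : (m < n)%N by exact: hm.
exists (Ordinal mn) => //=; rewrite ltNge; apply/negP => /hm; by rewrite ltnn.
Qed.

End sums.

Section paley.
Context {R : realType}.
Local Notation leb := (@lebesgue_measure R).
Local Notation circle := (`[0, 2 * pi]%classic : set (measurableTypeR R)).
Local Notation N := (2 * pi : R).
Local Notation chr k := (fun x : measurableTypeR R => cis (- (k%:~R * x)) : R[i]).

Definition circle_coef (g : measurableTypeR R -> R[i]) (k : int) : R[i] :=
  cint leb circle (fun x => g x * chr k x).

Lemma cmfun_chr (k : int) : cmfun (chr k).
Proof.
under eq_fun do rewrite -mulNr -mulrNz.
exact: cmfun_cisM.
Qed.

Definition low (g : measurableTypeR R -> R[i]) (t : R) : set (measurableTypeR R) :=
  [set x | normc (g x) <= t].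

Lemma measurable_low g t : cmfun g -> measurable (low g t).
Proof.
move=> mg; have := measurable_normc mg; move=> /(_ measurableT `]-oo, t]%classic).
rewrite setTI => /(_ (measurable_itv _)).
by congr (measurable _); apply/seteqP; split => x; rewrite /low /= in_itv.
Qed.

Definition cut (g : measurableTypeR R -> R[i]) (A : set (measurableTypeR R)) x : R[i] :=
  g x * (\1_A x)%:C.

Lemma cmfun_cut g A : cmfun g -> measurable A -> cmfun (cut g A).
Proof. by move=> mg mA; apply: cmfunM => //; apply: cmfunR; exact: measurable_indic. Qed.

Lemma normc_cut g A x : normc (cut g A x) = normc (g x) * \1_A x.
Proof. by rewrite /cut normcM normcR ger0_norm. Qed.

Lemma normc_cut_le g A x : normc (cut g A x) <= normc (g x).
Proof.
by rewrite normc_cut ler_piMr ?normc_ge0.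
Qed.

(** Chebyshev's inequality in the measure with weights freq^-2 and Bessel's inequality: a
    square-integrable function has square-summable coefficients. *)
Lemma circle_coef_low_le (I : finType) (e : I -> int) g (t : R) : injective e -> cmfun g ->
  0 < t ->
  ((\sum_(i | (2 * t < freq (e i) * normc (circle_coef (cut g (low g t)) (e i)))%R)
     freq (e i) ^- 2)%:E <=
   \int[leb]_(x in circle) ((N * t ^- 2) * (normc (g x) ^+ 2 * \1_(low g t) x))%:E)%E.
Proof.
move=> einj mg t0; set g1 := cut _ _.
have mg1 : cmfun g1 by apply: cmfun_cut => //; exact: measurable_low.
have mc := @measurable_circle R; have N0 := @twopi_gt0 R.
under eq_integral do rewrite EFinM.
have E x : (normc (g x) ^+ 2 * \1_(low g t) x) = normc (g1 x) ^+ 2.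
  by rewrite normc_cut exprMn indicE; case: (_ \in _); rewrite ?expr1n ?mulr1 ?expr0n ?mulr0.
under eq_integral do rewrite E.
rewrite ge0_integralZl_EFin//; last 3 first.
- by move=> x _; rewrite lee_fin sqr_ge0.
- apply/measurable_EFinP; apply: measurable_funTS.
  by apply: measurable_funX; exact: measurable_normc.
- by rewrite mulr_ge0 ?invr_ge0 ?sqr_ge0// ltW.
have := bessel einj mg1; rewrite -/(circle_coef _ _).
set A := (\int[leb]_(x in circle) _)%E => hB.
apply: (@le_trans _ _ ((4^-1 * t ^- 2)%:E * ((4 * N)%:E * A))%E); last first.
  rewrite muleA -EFinM; apply: lee_wpmul2r.
    by apply: integral_ge0 => x _; rewrite lee_fin sqr_ge0.
  by rewrite lee_fin; lra.
apply: le_trans (lee_wpmul2l _ hB); last first.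
  by rewrite lee_fin mulr_ge0// invr_ge0 ?sqr_ge0.
rewrite -EFinM lee_fin mulr_sumr big_mkcond; apply: ler_sum => i _.
case: ifPn => h; last by rewrite mulr_ge0 ?sqr_ge0// mulr_ge0// invr_ge0 sqr_ge0.
have f0 := freq_gt0 (R := R) (e i); have := normc_ge0 (circle_coef g1 (e i)).
rewrite -/(circle_coef g1 (e i)).
move: h f0; set a := normc _; set f := freq _ => h f0 a0.
have -> : f ^- 2 = f^-1 ^+ 2 by rewrite exprVn.
have -> : 4^-1 / t ^+ 2 * a ^+ 2 = (a / (2 * t)) ^+ 2 by field; rewrite lt0r_neq0.
rewrite ler_pXn2r// ?nnegrE ?invr_ge0 ?divr_ge0 ?(ltW f0) ?mulr_ge0 ?(ltW t0)//.
by rewrite -[f^-1]div1r ler_pdivrMr// mulrAC ler_pdivlMr ?mulr_gt0// mul1r (mulrC a) ltW.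
Qed.

(** Each coefficient is at most twice the L_1 norm, so only the frequencies above t over that
    norm can enter, and their inverse squares sum to the stated bound. *)
Lemma circle_coef_high_le (I : finType) (e : I -> int) g (t : R) : injective e ->
  cmfun g -> 0 < t ->
  ((\sum_(i | (2 * t < freq (e i) * normc (circle_coef (cut g (~` low g t)) (e i)))%R)
     freq (e i) ^- 2)%:E <=
   \int[leb]_(x in circle) ((4 * t^-1) * (normc (g x) * \1_(~` low g t) x))%:E)%E.
Proof.
move=> einj mg t0; set g2 := cut _ _.
have mg2 : cmfun g2 by apply: cmfun_cut => //; apply: measurableC; exact: measurable_low.
have mc := @measurable_circle R.
under eq_integral do rewrite EFinM -normc_cut.
rewrite ge0_integralZl_EFin//; last 3 first.
- by move=> x _; rewrite lee_fin normc_ge0.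
- exact: measurable_EFin_normc.
- by rewrite mulr_ge0 ?invr_ge0// ltW.
rewrite -/g2; set B := (\int[leb]_(x in circle) _)%E.
have B0 : (0 <= B)%E by apply: integral_ge0 => x _; rewrite lee_fin normc_ge0.
have [Boo|] := boolP (B < +oo)%E; last first.
  by rewrite -leNgt leye_eq => /eqP ->; rewrite gt0_muley ?leey// lte_fin mulr_gt0 ?invr_gt0.
have cB i : normc (circle_coef g2 (e i)) <= 2 * fine B.
  rewrite -lee_fin EFinM fineK ?ge0_fin_numE//.
  have h := cint_norm_le leb mc (cmfunM mg2 (cmfun_chr (e i))); apply: le_trans h _.
  apply: lee_wpmul2l => //; rewrite le_eqVlt; apply/orP; left; apply/eqP.
  by apply: eq_integral => x _; rewrite normcM normc_cis mulr1.
rewrite -(fineK (x := B)) ?ge0_fin_numE// -EFinM lee_fin.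
have : 0 <= fine B by exact: fine_ge0.
rewrite le_eqVlt => /predU1P[b0|b0].
  rewrite -b0 mulr0 big_pred0// => i; apply/negbTE; rewrite -leNgt.
  rewrite (_ : normc _ = 0) ?mulr0 ?mulr_ge0 ?ltW//.
  by apply/eqP; rewrite eq_le normc_ge0 andbT (le_trans (cB i))// -b0 mulr0.
apply: (@le_trans _ _ (\sum_(i | t / fine B < freq (e i)) freq (e i) ^- 2)); last first.
  apply: le_trans (sum_inv_sqr_freq einj _) _; first by rewrite divr_gt0.
  by rewrite invfM invrK mulrA.
rewrite [leLHS]big_mkcond [leRHS]big_mkcond; apply: ler_sum => i _.
have f0 := freq_gt0 (R := R) (e i).
case: ifPn => h; case: ifPn => // h'; rewrite ?invr_ge0 ?sqr_ge0//.
exfalso; move: h'; rewrite -leNgt ler_pdivlMr// leNgt => /negP; apply.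
rewrite -(ltr_pM2l (x := 2))// (lt_le_trans h)// mulrCA ler_pM2l//.
Qed.

Lemma circle_coef_split g (t : R) k : cintegrable leb circle g ->
  circle_coef g k = circle_coef (cut g (low g t)) k + circle_coef (cut g (~` low g t)) k.
Proof.
move=> ig; have mg := ig.1; have mc := @measurable_circle R.
have mA : measurable (low g t) by exact: measurable_low.
have h A : measurable A -> cintegrable leb circle (fun x => cut g A x * chr k x).
  move=> mA'; apply: cintegrable_le ig _ => //.
    by apply: cmfunM; [exact: cmfun_cut|exact: cmfun_chr].
  by move=> x _; rewrite normcM normc_cis mulr1 normc_cut_le.
rewrite /circle_coef -cintD//; try exact: h; last by apply: h; exact: measurableC.
apply: eq_cint => x _; rewrite -mulrDl -mulrDr -rmorphD /= indicC indicE.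
by case: (x \in low g t); rewrite ?addr0 ?add0r mulr1.
Qed.

(** The weak-type estimate behind Paley's inequality: if a coefficient of g is
    large, then one of its two truncations at height t has a large coefficient. *)
Lemma circle_coef_weak (I : finType) (e : I -> int) g (t : R) : injective e ->
  cintegrable leb circle g -> 0 < t ->
  ((\sum_(i | (4 * t < freq (e i) * normc (circle_coef g (e i)))%R) freq (e i) ^- 2)%:E <=
   \int[leb]_(x in circle) ((N * t ^- 2) * (normc (g x) ^+ 2 * \1_(low g t) x) +
      (4 * t^-1) * (normc (g x) * \1_(~` low g t) x))%:E)%E.
Proof.
move=> einj ig t0; have mg := ig.1; have mc := @measurable_circle R.
have N0 := ltW (@twopi_gt0 R).
have mA : measurable (low g t) by exact: measurable_low.
under eq_integral do rewrite EFinD.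
rewrite ge0_integralD//; last 4 first.
- move=> x _; rewrite lee_fin; apply: mulr_ge0; last by rewrite mulr_ge0 ?sqr_ge0.
  by apply: mulr_ge0 => //; rewrite invr_ge0 sqr_ge0.
- apply/measurable_EFinP; apply: measurable_funTS; apply: measurable_funM => //.
  by apply: measurable_funM; [apply: measurable_funX; exact: measurable_normc|exact: measurable_indic].
- move=> x _; rewrite lee_fin; apply: mulr_ge0; last by rewrite mulr_ge0 ?normc_ge0.
  by rewrite divr_ge0 ?ltW.
- apply/measurable_EFinP; apply: measurable_funTS; apply: measurable_funM => //.
  apply: measurable_funM; [exact: measurable_normc|apply: measurable_indic; exact: measurableC].
apply: le_trans (leeD (circle_coef_low_le einj mg t0) (circle_coef_high_le einj mg t0)).
rewrite -EFinD lee_fin !(big_mkcond (fun i => _ < _)) -big_split; apply: ler_sum => i _; cbv beta.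
set f := freq _; have f0 : 0 < f := freq_gt0 _.
rewrite (circle_coef_split t)//; set a := circle_coef _ _; set b := circle_coef _ _.
have fi : 0 <= f ^- 2 by rewrite invr_ge0 sqr_ge0.
case: ifPn => h; last by rewrite addr_ge0//; case: ifP.
case: ifPn => ha; first by rewrite lerDl; case: ifP.
case: ifPn => hb; first by rewrite lerDr.
exfalso; move: h; apply/negP; rewrite -leNgt.
move: ha hb; rewrite -!leNgt => ha hb.
apply: (@le_trans _ _ (f * normc a + f * normc b)); last by lra.
by rewrite -mulrDr ler_wpM2l ?(ltW f0)// ler_normcD.
Qed.

(** The three terms come from the low truncations, the high truncations and the
    endpoint q = 2; the first two degenerate as q tends to 2 and to 1. *)
Definition paleyC (q : R) : R :=
  8 `^ q * (N * geoC (2 - q) + 4 * geoC (q - 1)) + 4 * N.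

(** The pointwise form of Marcinkiewicz interpolation: the low parts are summed
    over the heights above a, the high parts over the heights below a, and both
    are geometric sums dominated by the height a itself. *)
Lemma low_high_sum (q t0 a : R) (n : nat) : 1 < q < 2 -> 0 < t0 -> 0 <= a ->
  \sum_(j < n) (8 * (t0 * 2 ^+ j)) `^ q *
    ((N * (t0 * 2 ^+ j) ^- 2) * (a ^+ 2 * ((a <= t0 * 2 ^+ j)%R : bool)%:R) +
     (4 * (t0 * 2 ^+ j)^-1) * (a * ((t0 * 2 ^+ j < a)%R : bool)%:R))
  <= paleyC q * a `^ q.
Proof.
move=> /andP[q1 q2] t0_gt0 a0; have q0 : 0 < q by rewrite (lt_trans ltr01).
have N0 := @twopi_gt0 R.
have G1 : 0 < geoC (2 - q) by rewrite geoC_gt0// subr_gt0.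
have G2 : 0 < geoC (q - 1) by rewrite geoC_gt0// subr_gt0.
have [->|a_neq0] := eqVneq a 0.
  rewrite big1; last by move=> j _; rewrite expr0n !mul0r !mulr0 addr0 mulr0.
  by rewrite powR0 ?mulr0// gt_eqF.
have {a_neq0}a0 : 0 < a by rewrite lt_neqAle eq_sym a_neq0.
have tj (j : nat) : 0 < t0 * 2 ^+ j by rewrite mulr_gt0// exprn_gt0.
apply: (@le_trans _ _ (8 `^ q * (N * (a ^+ 2 * \sum_(j < n | a <= t0 * 2 ^+ j) (t0 * 2 ^+ j) `^ (- (2 - q)))
    + 4 * (a * \sum_(j < n | t0 * 2 ^+ j < a) (t0 * 2 ^+ j) `^ (q - 1))))).
  rewrite !mulr_sumr (big_mkcond (fun j : 'I_n => a <= _)) (big_mkcond (fun j : 'I_n => _ < a)) -big_split mulr_sumr.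
  apply: ler_sum => j _ /=; set t := t0 * 2 ^+ j.
  have tt : 0 < t := tj j.
  rewrite powRM ?(ltW tt)// -mulrA ler_wpM2l ?powR_ge0//.
  have -> : t `^ (- (2 - q)) = t `^ q / t ^+ 2.
    by rewrite opprB powRB ?(gt_eqF tt)// ?powR_mulrn ?(ltW tt)// implybT.
  have -> : t `^ (q - 1) = t `^ q / t.
    by rewrite powRB ?(gt_eqF tt)// ?powRr1 ?(ltW tt)// implybT.
  rewrite le_eqVlt; apply/orP; left; apply/eqP.
  by case: ltP => h; rewrite ?mulr1 ?mulr0 ?addr0 ?add0r; field; rewrite gt_eqF.
rewrite /paleyC [leRHS]mulrDl -[leLHS]addr0 lerD//; last first.
  by rewrite !mulr_ge0 ?pi_ge0 ?powR_ge0.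
rewrite -[leRHS]mulrA ler_wpM2l ?powR_ge0// [leRHS]mulrDl lerD//.
  rewrite -[leRHS]mulrA ler_pM2l//.
  apply: le_trans (_ : a ^+ 2 * (geoC (2 - q) * a `^ (- (2 - q))) <= _).
    by rewrite ler_wpM2l ?sqr_ge0// sum_geo_ge// subr_gt0.
  rewrite mulrCA ler_wpM2l ?(ltW G1)// opprB powRB ?(gt_eqF a0) ?implybT//.
  rewrite powR_mulrn ?(ltW a0)// mulrCA mulfV ?mulr1// expf_neq0// gt_eqF//.
rewrite -[leRHS]mulrA ler_pM2l//.
apply: le_trans (_ : a * (geoC (q - 1) * a `^ (q - 1)) <= _).
  by rewrite ler_wpM2l ?(ltW a0)// sum_geo_lt// subr_gt0.
by rewrite mulrCA ler_wpM2l ?(ltW G2)// mulr_powRB1 ?(ltW a0).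
Qed.

Lemma geoC_ge0 (b : R) : 0 <= b -> 0 <= geoC b.
Proof.
rewrite le_eqVlt => /predU1P[<-|/geoC_gt0/ltW//].
by rewrite /geoC oppr0 powRr0 subrr invr0.
Qed.

Lemma paleyC_gt0 q : 1 <= q <= 2 -> 0 < paleyC q.
Proof.
move=> /andP[q1 q2]; rewrite /paleyC ltr_wpDl ?mulr_gt0 ?pi_gt0//.
by rewrite mulr_ge0 ?powR_ge0// addr_ge0// !mulr_ge0 ?pi_ge0// geoC_ge0// subr_ge0.
Qed.

(** In the measure with weights freq^-2, Paley's inequality is the strong-type
    (q, q) bound for the map sending g to freq * |coefficient|. *)
Lemma freq_weight_powR (q f a : R) : 0 < q -> 0 < f -> 0 <= a ->
  f `^ (q - 2) * a `^ q = f ^- 2 * (f * a) `^ q.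
Proof.
move=> q0 f0 a0; rewrite powRM ?(ltW f0)// powRB ?(gt_eqF f0) ?implybT//.
by rewrite powR_mulrn ?(ltW f0)// mulrA (mulrC (f ^- 2)).
Qed.

(** Layer cake over dyadic heights: the q-th power of X = freq * |coefficient| is at most the sum
    of (8 t)^q over the heights t with 4 t < X.  The weak-type estimate is applied
    at each height, and low_high_sum adds the results.  For q = 2 this is
    Bessel's inequality. *)
Lemma circle_paley (q : R) : 1 < q <= 2 ->
  forall (I : finType) (e : I -> int) (g : measurableTypeR R -> R[i]),
  injective e -> cmfun g ->
  ((\sum_i freq (e i) `^ (q - 2) * normc (circle_coef g (e i)) `^ q)%:E <=
   (paleyC q)%:E * \int[leb]_(x in circle) (normc (g x) `^ q)%:E)%E.
Proof.
move=> q12 I e g einj mg; move: (q12) => /andP[q1 q2].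
have C0 : 0 < paleyC q by apply: paleyC_gt0; rewrite (ltW q1).
have q0 : 0 < q by rewrite (lt_trans ltr01).
have mc := @measurable_circle R; have N0 := @twopi_gt0 R.
set A := (\int[leb]_(x in circle) _)%E.
have A0 : (0 <= A)%E by apply: integral_ge0 => x _; rewrite lee_fin powR_ge0.
have [Aoo|] := boolP (A < +oo)%E; last first.
  by rewrite -leNgt leye_eq => /eqP ->; rewrite gt0_muley ?leey.
have ig : cintegrable leb circle g.
  by apply: (cintegrable_powR mc circle_lty (q := q)) => //; exact: ltW.
have [qe|q2'] := eqVneq q 2.
  apply: (@le_trans _ _ ((4 * N)%:E * A)%E); last first.
    apply: lee_wpmul2r => //; rewrite lee_fin /paleyC lerDr.
    by rewrite mulr_ge0 ?powR_ge0// addr_ge0// !mulr_ge0 ?pi_ge0// geoC_ge0// subr_ge0// ltW.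
  have := bessel einj mg; congr (_ <= _)%E.
    congr EFin; apply: eq_bigr => i _.
    by rewrite qe subrr powRr0 mul1r powR_mulrn ?normc_ge0.
  by congr (_ * _)%E; apply: eq_integral => x _; rewrite qe powR_mulrn ?normc_ge0.
have {q2 q2'}q2 : q < 2 by rewrite lt_neqAle q2'.
pose X i := freq (e i) * normc (circle_coef g (e i)).
have X0 i : 0 <= X i by rewrite mulr_ge0 ?normc_ge0// ltW// freq_gt0.
have Xs i : X i \in [seq X i | i <- enum I] by apply: map_f; rewrite mem_enum.
have [|t1 t1_gt0 Xt1] := @exists_lower_scale R [seq X i | i <- enum I].
  by move=> x /mapP[i _ ->].
pose t0 := t1 / 4; have t0_gt0 : 0 < t0 by rewrite divr_gt0.
have [n Xn] := exists_upper_scale [seq X i | i <- enum I] t1_gt0.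
pose t (j : nat) := t0 * 2 ^+ j.
have t_gt0 j : 0 < t j by rewrite mulr_gt0// exprn_gt0.
have step1 : \sum_i freq (e i) `^ (q - 2) * normc (circle_coef g (e i)) `^ q <=
    \sum_(j < n) (8 * t j) `^ q * \sum_(i | 4 * t j < X i) freq (e i) ^- 2.
  under [leRHS]eq_bigr do rewrite mulr_sumr.
  rewrite (exchange_big_dep xpredT)//=; apply: ler_sum => i _.
  rewrite freq_weight_powR ?normc_ge0 ?freq_gt0// -/(X i).
  have f0 : 0 <= freq (e i) ^- 2 :> R by rewrite invr_ge0 sqr_ge0.
  rewrite -mulr_suml mulrC ler_wpM2r//.
  have := X0 i; rewrite le_eqVlt => /predU1P[<-|Xi].
    by rewrite powR0 ?gt_eqF//; apply: sumr_ge0 => j _; exact: powR_ge0.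
  have [j jX Xj] := dyadic_level t1_gt0 (Xt1 _ (Xs i) Xi) (Xn _ (Xs i)).
  rewrite (bigD1 j)/=; last by rewrite /t /t0 mulrA (mulrC 4) divfK.
  rewrite -[leLHS]addr0 lerD//; last by apply: sumr_ge0 => l _; exact: powR_ge0.
  have le8 : X i <= 8 * t j.
    apply: le_trans Xj _; rewrite /t /t0 exprS.
    by rewrite le_eqVlt; apply/orP; left; apply/eqP; field.
  apply: (ge0_ler_powR (ltW q0)) le8; rewrite nnegrE; first exact: X0.
  by apply: mulr_ge0 => //; exact: ltW.
apply: le_trans (_ : _ <= (\sum_(j < n) (8 * t j) `^ q * \sum_(i | 4 * t j < X i) freq (e i) ^- 2)%:E)%E _.
  by rewrite lee_fin.
pose F (j : nat) x := (N * t j ^- 2) * (normc (g x) ^+ 2 * \1_(low g (t j)) x) +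
      (4 * (t j)^-1) * (normc (g x) * \1_(~` low g (t j)) x).
have F0 j x : 0 <= F j x.
  apply: addr_ge0; apply: mulr_ge0.
  - by apply: mulr_ge0; [exact: ltW|rewrite invr_ge0 sqr_ge0].
  - by rewrite mulr_ge0 ?sqr_ge0.
  - by apply: mulr_ge0 => //; rewrite invr_ge0 ltW.
  - by rewrite mulr_ge0 ?normc_ge0.
have mF j : measurable_fun setT (F j).
  have mA : measurable (low g (t j)) by exact: measurable_low.
  apply: measurable_funD; apply: measurable_funM => //.
    by apply: measurable_funM; [apply: measurable_funX; exact: measurable_normc|exact: measurable_indic].
  apply: measurable_funM; [exact: measurable_normc|apply: measurable_indic; exact: measurableC].
apply: (@le_trans _ _ (\sum_(j < n) \int[leb]_(x in circle) ((8 * t j) `^ q * F j x)%:E)%E).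
  rewrite -sumEFin; apply: lee_sum => j _.
  under eq_integral do rewrite EFinM.
  rewrite ge0_integralZl_EFin ?powR_ge0//; last 2 first.
  - by move=> x _; rewrite lee_fin.
  - by apply/measurable_EFinP; apply: measurable_funTS.
  rewrite EFinM; apply: lee_wpmul2l; first by rewrite lee_fin powR_ge0.
  exact: circle_coef_weak.
rewrite -ge0_integral_sum//; last 2 first.
- move=> j; apply/measurable_EFinP; apply: measurable_funTS; exact: measurable_funM.
- by move=> j x _; rewrite lee_fin mulr_ge0// powR_ge0.
rewrite /A -ge0_integralZl_EFin//; last 3 first.
- by move=> x _; rewrite lee_fin powR_ge0.
- apply/measurable_EFinP; apply: measurable_funTS; exact: measurable_normc_powR.
- exact: ltW.
apply: ge0_le_integral => //.
- by move=> x _; apply: sume_ge0 => j _; rewrite lee_fin mulr_ge0// powR_ge0.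
- apply: emeasurable_sum => j; apply/measurable_EFinP; apply: measurable_funTS; exact: measurable_funM.
- apply: emeasurable_funM => //; apply/measurable_EFinP; apply: measurable_funTS; exact: measurable_normc_powR.
move=> x _; rewrite sumEFin -EFinM lee_fin.
have q12' : 1 < q < 2 by rewrite q1.
apply: le_trans (low_high_sum n q12' t0_gt0 (normc_ge0 (g x))).
rewrite le_eqVlt; apply/orP; left; apply/eqP; apply: eq_bigr => j _.
congr (_ * (_ * (_ * _) + _ * (_ * _))).
  rewrite indicE; congr (nat_of_bool _)%:R.
  by apply/idP/idP => [/set_mem//|h]; exact/mem_set.
rewrite indicE; congr (nat_of_bool _)%:R; rewrite ltNge.
apply/idP/idP => [/set_mem/negP//|h]; apply/mem_set; exact/negP.
Qed.

End paley.

(** * The Hardy-Littlewood-Paley inequality on the torus *)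

Section ae.
Context {R : realType} d (T : measurableType d) (mu : {measure set T -> \bar R}).
Context (D : set T) (mD : measurable D).

Lemma ae_eq_cint (f g : T -> R[i]) : cmfun f -> cmfun g ->
  {ae mu, forall x, D x -> f x = g x} -> cint mu D f = cint mu D g.
Proof.
move=> [f1 f2] [g1 g2] fg; rewrite /cint; congr Complex; congr fine.
  apply: ae_eq_integral => //; try by apply/measurable_EFinP; exact: measurable_funTS.
  by apply: filterS fg => x h Dx; rewrite h.
apply: ae_eq_integral => //; try by apply/measurable_EFinP; exact: measurable_funTS.
by apply: filterS fg => x h Dx; rewrite h.
Qed.

End ae.

Section torus_paley.
Context {R : realType}.
Local Notation leb := (@lebesgue_measure R).
Local Notation mu := (@lebesgue_pts R).
Local Notation circle := (`[0, 2 * pi]%classic : set (measurableTypeR R)).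

Definition torus_coef n (g : pts R n -> R[i]) (k : n.-tuple int) : R[i] :=
  cint (mu n) torus (fun x => g x * cis (- dotp k x)).

Lemma torus_lty n : (mu n torus < +oo)%E.
Proof. by rewrite lebesgue_torus ltry. Qed.

Lemma measurable_dotp n (k : n.-tuple int) : measurable_fun setT (@dotp R n k).
Proof.
apply: measurable_sum => i; apply: measurable_funM => //.
exact: measurable_tnth.
Qed.

Lemma cmfun_cis_comp d (T : measurableType d) (h : T -> R) :
  measurable_fun setT h -> cmfun (fun x => cis (h x)).
Proof.
move=> mh; split.
  apply: (measurableT_comp (f := @cos R)) mh; apply: continuous_measurable_fun.
  exact: continuous_cos.
apply: (measurableT_comp (f := @sin R)) mh; apply: continuous_measurable_fun.
exact: continuous_sin.
Qed.

Lemma cmfun_character n (k : n.-tuple int) : cmfun (fun x : pts R n => cis (- dotp k x)).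
Proof. by apply: cmfun_cis_comp; apply: measurable_funN; exact: measurable_dotp. Qed.

Lemma dotp_cons n (k : int) (K : n.-tuple int) (p : measurableTypeR R * pts R n) :
  dotp [tuple of k :: K] (consp p) = k%:~R * p.1 + dotp K p.2.
Proof.
rewrite /dotp big_ord_recl tnth0 tnth_consp0; congr (_ + _).
by apply: eq_bigr => i _; rewrite tnthS tnth_consp_lift.
Qed.

Lemma sum_tuple_cons (A : nmodType) (I : finType) n (F : n.+1.-tuple I -> A) :
  \sum_K F K = \sum_i \sum_(K : n.-tuple I) F [tuple of i :: K].
Proof.
rewrite pair_bigA (reindex (fun p : I * n.-tuple I => [tuple of p.1 :: p.2]))//=.
exists (fun K => (thead K, [tuple of behead K])) => [[i K] _|K _] /=.
  by rewrite theadE; congr pair; exact: val_inj.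
by rewrite -tuple_eta.
Qed.

Lemma measurable_consp1 n (x : pts R n) :
  measurable_fun setT (fun a : measurableTypeR R => consp (a, x)).
Proof.
apply: (measurableT_comp (@measurable_consp R n)).
exact: measurable_pair2.
Qed.

Lemma cmfun_section_circle n (h : pts R n.+1 -> R[i]) : cmfun h ->
  cmfun (fun x : pts R n => cint leb circle (fun a => h (consp (a, x)))).
Proof.
move=> mh.
have /= := @cmfun_section R _ _ (pts R n) (measurableTypeR R) leb circle measurable_circle
  (fun p => h (consp (p.2, p.1))).
apply.
have ms : measurable_fun setT (fun p : pts R n * measurableTypeR R => (p.2, p.1)).
  exact: measurable_fun_pair.
exact: (cmfun_comp mh (measurableT_comp (@measurable_consp R n) ms)).
Qed.

(** Only almost every section of an integrable function is integrable, so
    identities involving sections are proved almost everywhere. *)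
Lemma ae_cintegrable_section n (h : pts R n.+1 -> R[i]) :
  cintegrable (mu n.+1) torus h ->
  {ae mu n, forall x, torus x -> cintegrable leb circle (fun a => h (consp (a, x)))}.
Proof.
move=> [mh ih].
have mnh : measurable_fun setT (fun x => (normc (h x))%:E : \bar R).
  by apply/measurable_EFinP; exact: measurable_normc.
have nh0 (x : pts R n.+1) : (0 <= (normc (h x))%:E :> \bar R)%E by rewrite lee_fin normc_ge0.
pose H (x : pts R n) := (\int[leb]_(a in circle) (normc (h (consp (a, x))))%:E)%E.
have H0 x : (0 <= H x)%E by apply: integral_ge0 => a _.
have mH : measurable_fun setT H.
  have ms : measurable_fun setT (fun p : pts R n * measurableTypeR R => (p.2, p.1)).
    exact: measurable_fun_pair.
  exact: (@measurable_section_integral R _ _ (pts R n) (measurableTypeR R) leb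
    circle measurable_circle _ (measurableT_comp mnh (measurableT_comp (@measurable_consp R n) ms)) (fun=> nh0 _)).
have iH : (mu n).-integrable torus H.
  apply/integrableP; split; first exact: measurable_funTS.
  under eq_integral do rewrite gee0_abs//.
  by move: ih; rewrite tonelli_consp2.
have := integrable_ae (@measurable_torus R n) iH; apply: filterS => x hx Tx.
split; first exact: (cmfun_comp mh (@measurable_consp1 n x)).
by have := hx Tx; rewrite ge0_fin_numE.
Qed.

Lemma cmfun_circle_coef n (g : pts R n.+1 -> R[i]) (k : int) : cmfun g ->
  cmfun (fun x => circle_coef (fun a => g (consp (a, x))) k).
Proof.
move=> mg.
have mh : cmfun (fun y : pts R n.+1 => g y * cis (- (k%:~R * tnth y ord0))).
  apply: cmfunM => //; apply: cmfun_cis_comp; apply: measurable_funN.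
  by apply: measurable_funM => //; exact: measurable_tnth.
by have := cmfun_section_circle mh; congr cmfun.
Qed.

Lemma torus_coef_cons n (g : pts R n.+1 -> R[i]) (k : int) (K : n.-tuple int) :
  cintegrable (mu n.+1) torus g ->
  torus_coef g [tuple of k :: K] =
  torus_coef (fun x => circle_coef (fun a => g (consp (a, x))) k) K.
Proof.
move=> ig; have mT := @measurable_torus R n.+1; have mc := @measurable_circle R.
have mchr := cmfun_character [tuple of k :: K].
have igc : cintegrable (mu n.+1) torus (fun x => g x * cis (- dotp [tuple of k :: K] x)).
  by apply: (cintegrableM mT (M := 1)) => // x _; rewrite normc_cis.
rewrite /torus_coef cint_consp2//.
apply: ae_eq_cint.
- exact: measurable_torus.
- exact: (@cmfun_section_circle n (fun x => g x * cis (- dotp [tuple of k :: K] x)) igc.1).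
- apply: cmfunM; [exact: cmfun_circle_coef ig.1|exact: cmfun_character].
apply: filterS (ae_cintegrable_section ig) => x hx Tx.
rewrite [RHS]mulrC /circle_coef -cintZ//; last first.
  apply: (cintegrableM mc (M := 1)) => //; [exact: hx|exact: cmfun_chr|].
  by move=> a _; rewrite normc_cis.
apply: eq_cint => a _; rewrite dotp_cons/= opprD cisD mulrA mulrC.
by [].
Qed.

(** Induction on the dimension: for a fixed first frequency the inequality in the
    other variables applies to the partial Fourier coefficient; the sum over the
    first frequency then goes under the integral, where the inequality
    on the circle applies to each section. *)
Lemma torus_paley (q : R) : 1 < q <= 2 ->
  forall (I : finType) (e : I -> int), injective e ->
  forall n (g : pts R n -> R[i]), cmfun g ->
  ((\sum_(K : n.-tuple I) (\prod_(i < n) freq (e (tnth K i)) `^ (q - 2)) *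
      normc (torus_coef g (map_tuple e K)) `^ q)%:E <=
   (paleyC q ^+ n)%:E * \int[mu n]_(x in torus) (normc (g x) `^ q)%:E)%E.
Proof.
move=> q12 I e einj; have /andP[q1 q2] := q12.
have C0 : 0 < paleyC q by apply: paleyC_gt0; rewrite (ltW q1).
have q0 : 0 < q by rewrite (lt_trans ltr01).
elim=> [|n IH] g mg.
  rewrite expr0 mul1e.
  rewrite (big_pred1 [tuple]) => [|K]; last by apply/esym/eqP; apply: val_inj; case: K => -[].
  rewrite big_ord0 mul1r /torus_coef.
  rewrite (_ : @torus R 0 = setT); last by apply/seteqP; split => // x _ [].
  have mgq : measurable_fun setT (fun x : pts R 0 => (normc (g x) `^ q)%:E : \bar R).
    by apply/measurable_EFinP; exact: measurable_normc_powR.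
  rewrite integral_dirac// diracT mul1e lee_fin.
  rewrite (_ : cint _ _ _ = g [tuple])//.
  rewrite /cint /Rintegral.
  have [g1 g2] := mg.
  have d0 : dotp (map_tuple e [tuple]) [tuple] = 0 :> R by rewrite /dotp big_ord0.
  have mgc := cmfunM mg (cmfun_character (map_tuple e [tuple])).
  rewrite !integral_dirac//; last 2 first.
  - by apply/measurable_EFinP; exact: mgc.2.
  - by apply/measurable_EFinP; exact: mgc.1.
  rewrite diracT !mul1e /= d0 oppr0 cis0 mulr1.
  by case: (g _).
have mT := @measurable_torus R n.+1; have mTn := @measurable_torus R n.
have mc := @measurable_circle R.
set A := (\int[mu n.+1]_(x in torus) _)%E.
have A0 : (0 <= A)%E by apply: integral_ge0 => x _; rewrite lee_fin powR_ge0.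
have [Aoo|] := boolP (A < +oo)%E; last first.
  by rewrite -leNgt leye_eq => /eqP ->; rewrite gt0_muley ?leey// lte_fin exprn_gt0.
have ig : cintegrable (mu n.+1) torus g.
  apply: (cintegrable_powR mT (torus_lty n.+1) (q := q)) => //; exact: ltW.
pose G i := fun x => circle_coef (fun a => g (consp (a, x))) (e i).
have mG i : cmfun (G i) by exact: cmfun_circle_coef.
have mGq i : measurable_fun setT (fun x => (normc (G i x) `^ q)%:E : \bar R).
  by apply/measurable_EFinP; exact: measurable_normc_powR.
rewrite sum_tuple_cons.
apply: (@le_trans _ _ (\sum_i (freq (e i) `^ (q - 2))%:E * ((paleyC q ^+ n)%:E *
   \int[mu n]_(x in torus) (normc (G i x) `^ q)%:E))%E).
  rewrite -sumEFin; apply: lee_sum => i _.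
  apply: le_trans (lee_wpmul2l _ (IH (G i) (mG i))); last by rewrite lee_fin powR_ge0.
  rewrite -EFinM lee_fin mulr_sumr; apply: ler_sum => K _.
  rewrite big_ord_recl tnth0 -mulrA ler_wpM2l ?powR_ge0//.
  under eq_bigr => j _ do rewrite tnthS.
  rewrite ler_wpM2l//; first by apply: prodr_ge0 => j _; exact: powR_ge0.
  rewrite (_ : map_tuple e [tuple of i :: K] = [tuple of e i :: map_tuple e K]); last exact: val_inj.
  by rewrite torus_coef_cons.
have CC : (0 <= (paleyC q ^+ n)%:E :> \bar R)%E by rewrite lee_fin exprn_ge0// ltW.
under eq_bigr => i _ do rewrite muleCA.
rewrite -ge0_sume_distrr; last by move=> i _; apply: mule_ge0; [rewrite lee_fin powR_ge0|apply: integral_ge0 => x _; rewrite lee_fin powR_ge0].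
rewrite exprSr EFinM -muleA; apply: lee_wpmul2l => //.
have mw i : measurable_fun torus (fun x => ((freq (e i) `^ (q - 2))%:E * (normc (G i x) `^ q)%:E)%E : \bar R).
  by apply: emeasurable_funM => //; exact: measurable_funTS.
under eq_bigr => i _.
  rewrite -ge0_integralZl_EFin ?powR_ge0//; last 2 first.
  - by move=> x _; rewrite lee_fin powR_ge0.
  - exact: measurable_funTS.
  over.
rewrite -ge0_integral_sum//; last first.
  by move=> i x _; rewrite -EFinM lee_fin mulr_ge0 ?powR_ge0.
have mgq : measurable_fun setT (fun x => (normc (g x) `^ q)%:E : \bar R).
  by apply/measurable_EFinP; exact: measurable_normc_powR.
have gq0 x : (0 <= (normc (g x) `^ q)%:E :> \bar R)%E by rewrite lee_fin powR_ge0.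
rewrite /A tonelli_consp2//.
have mS : measurable_fun torus (fun x => \int[leb]_(a in circle) (normc (g (consp (a, x))) `^ q)%:E)%E.
  have ms : measurable_fun setT (fun p : pts R n * measurableTypeR R => (p.2, p.1)).
    exact: measurable_fun_pair.
  apply: measurable_funTS.
  exact: (@measurable_section_integral R _ _ (pts R n) (measurableTypeR R) leb
    circle measurable_circle _ (measurableT_comp mgq (measurableT_comp (@measurable_consp R n) ms)) (fun=> gq0 _)).
rewrite -ge0_integralZl_EFin//; last 2 first.
- by move=> x _; apply: integral_ge0 => a _.
- exact: ltW.
apply: ge0_le_integral => //.
- by move=> x _; apply: sume_ge0 => i _; rewrite -EFinM lee_fin mulr_ge0 ?powR_ge0.
- exact: emeasurable_sum.
- exact: emeasurable_funM.
move=> x _; have := circle_paley q12 einj (cmfun_comp mg (@measurable_consp1 n x)).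
by rewrite -sumEFin; apply: le_trans; rewrite le_eqVlt; apply/orP; left; apply/eqP; apply: eq_bigr => i _; rewrite EFinM.
Qed.

End torus_paley.

(** * Sums of Fourier coefficients over dyadic blocks *)

Section levels.

(** The index s of the dyadic annulus 2^(s-1) <= |k| < 2^s containing k; the
    annulus 0 is {0}. *)
Definition level (k : int) : nat :=
  if absz k == 0%N then 0%N else (trunc_log 2 (absz k)).+1.

Lemma levelP (s : nat) (k : int) :
  (2 ^ s %/ 2 <= absz k < 2 ^ s)%N = (s == level k).
Proof.
rewrite /level; case: s => [|s].
  rewrite expn0 /= ltnS leqn0; case: eqVneq => //.
rewrite expnS mulKn//; case: (eqVneq (absz k) 0%N) => [->|k0].
  by rewrite leqNgt expn_gt0.
rewrite eqSS -expnS; apply/idP/eqP => [h|->].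
  by rewrite (@trunc_log_eq 2 s (absz k)).
by apply: trunc_log_bounds; rewrite // lt0n.
Qed.

Lemma absz_lt_level (k : int) : (absz k < 2 ^ level k)%N.
Proof. by have := levelP (level k) k; rewrite eqxx => /andP[]. Qed.

Definition tlevel n (k : n.-tuple int) : nat := (\sum_(i < n) level (tnth k i))%N.

Lemma absz_lt_tlevel n (k : n.-tuple int) i : (absz (tnth k i) < 2 ^ tlevel k)%N.
Proof.
apply: leq_trans (absz_lt_level _) _; rewrite leq_exp2l// /tlevel.
by rewrite (bigD1 i)//= leq_addr.
Qed.

(** The product of the frequencies, hence Paley's weight, is controlled by the total level alone. *)
Lemma prod_freq_le (R : realType) n (k : n.-tuple int) :
  \prod_(i < n) freq (tnth k i) <= 2 ^+ tlevel k :> R.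
Proof.
rewrite /tlevel -prodrXr; apply: ler_prod => i _; rewrite ltW ?freq_gt0//=.
by rewrite /freq -natrX ler_nat absz_lt_level.
Qed.

End levels.

Section windows.
Variable J : nat.

(** Paley's inequality is stated for finite index types; this enumerates the
    integers of modulus at most 2^J. *)
Definition window_int (i : 'I_(2 ^ J).*2.+1) : int := i%:Z - (2 ^ J)%:Z.

Lemma window_int_inj : injective window_int.
Proof. by move=> i l; rewrite /window_int => h; apply: val_inj => /=; lia. Qed.

Definition int_window (k : int) : 'I_(2 ^ J).*2.+1 := inord (absz (k + (2 ^ J)%:Z)).

Lemma int_windowK k : (absz k < 2 ^ J)%N -> window_int (int_window k) = k.
Proof.
move=> h; rewrite /window_int /int_window inordK; first by lia.
by rewrite -addnn; lia.
Qed.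

End windows.

Lemma ler_sum_sub {R : numDomainType} (T : eqType) (X Z : seq T) (F : T -> R) :
  uniq X -> {subset X <= Z} -> (forall x, 0 <= F x) ->
  \sum_(x <- X) F x <= \sum_(x <- Z) F x.
Proof.
move=> uX XZ F0.
have h : \sum_(x <- X) F x = \sum_(x <- undup Z | x \in X) F x.
  rewrite -[RHS]big_filter; apply: perm_big; apply: uniq_perm => //.
    by rewrite filter_uniq// undup_uniq.
  by move=> x; rewrite mem_filter mem_undup; case: (boolP (x \in X)) => // /XZ.
rewrite h; apply: (@le_trans _ _ (\sum_(x <- undup Z) F x)).
  by rewrite [leRHS](bigID (mem X))/= lerDl sumr_ge0.
clear -F0; elim: Z => //= x Z IH; case: ifP => _; rewrite !big_cons.
  by rewrite (le_trans IH)// lerDr.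
by rewrite lerD2l.
Qed.

Section block_bound.
Context {R : realType}.
Local Notation mu := (@lebesgue_pts R).

Lemma torus_paley_seq (q : R) n (g : pts R n -> R[i]) (B : R) (X : seq (n.-tuple int)) :
  1 < q <= 2 -> cmfun g -> 
  (\int[mu n]_(x in torus) (normc (g x) `^ q)%:E <= (B `^ q)%:E)%E ->
  uniq X ->
  \sum_(k <- X) (\prod_(i < n) freq (tnth k i) `^ (q - 2)) * normc (torus_coef g k) `^ q
   <= paleyC q ^+ n * B `^ q.
Proof.
move=> q12 mg gB uX; rewrite -lee_fin EFinM.
have C0 : 0 < paleyC q by case/andP: (q12) => qa qb; apply: paleyC_gt0; rewrite (ltW qa).
apply: le_trans (lee_wpmul2l _ gB); last by rewrite lee_fin exprn_ge0// ltW.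
pose J := (\max_(k <- X) tlevel k)%N.
apply: le_trans (torus_paley q12 (@window_int_inj J) mg); rewrite lee_fin.
set F := (X in \sum_(k <- _) X k).
apply: (@le_trans _ _ (\sum_(k <- [seq map_tuple (@window_int J) K | K <- enum {: n.-tuple 'I_(2 ^ J).*2.+1}]) F k)).
  apply: ler_sum_sub => //.
    move=> k kX; apply/mapP; exists (map_tuple (@int_window J) k); first by rewrite mem_enum.
    apply: val_inj => /=; rewrite -map_comp map_id_in// => z /tnthP[i ->] /=.
    apply: int_windowK; apply: leq_trans (absz_lt_tlevel _ _) _.
    by rewrite leq_exp2l// /J (big_rem k)//= leq_maxl.
  move=> k; rewrite /F mulr_ge0 ?powR_ge0//; apply: prodr_ge0 => i _; exact: powR_ge0.
rewrite big_map big_enum/= le_eqVlt; apply/orP; left; apply/eqP; apply: eq_bigr => K _.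
rewrite /F; congr (_ * _); apply: eq_bigr => i _; by rewrite tnth_map.
Qed.

Lemma powR_inv (x p : R) : 0 <= x -> x^-1 `^ p = (x `^ p)^-1.
Proof. by move=> x0; rewrite -[x^-1]powR_inv1// -powRrM mulN1r powRN. Qed.

Lemma powR_prod (I : finType) (f : I -> R) (p : R) : (forall i, 0 <= f i) ->
  \prod_i f i `^ p = (\prod_i f i) `^ p.
Proof.
move=> f0.
have [] // : \prod_i f i `^ p = (\prod_i f i) `^ p /\ 0 <= \prod_i f i.
apply: (big_ind2 (fun x y => x = y `^ p /\ 0 <= y)) => //.
- by rewrite powR1 ler01.
- by move=> x1 x2 y1 y2 [-> h1] [-> h2]; rewrite powRM// mulr_ge0.
Qed.

(** Hoelder's inequality in the form a <= T (1 + (a/T)^q), with T chosen so that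
    the two resulting sums balance: on the block the weight in Paley's
    inequality is at least 2^(-j(2-q)), which bounds the sum of a^q. *)
Lemma block_bound (q : R) n (g : pts R n -> R[i]) (B J : R) (j : nat) (X : seq (n.-tuple int)) :
  1 < q <= 2 -> cmfun g -> 0 < B ->
  (\int[mu n]_(x in torus) (normc (g x) `^ q)%:E <= (B `^ q)%:E)%E ->
  uniq X -> (forall k, k \in X -> tlevel k = j) ->
  0 < J -> (size X)%:R <= 2 ^+ j * J ->
  \sum_(k <- X) normc (torus_coef g k) <=
   (paleyC q ^+ n + 1) * ((2 ^+ j) `^ q^-1 * J `^ (1 - q^-1) * B).
Proof.
move=> q12 mg B0 gB uX Xj J0 sX; have /andP[q1 q2] := q12.
have q0 : 0 < q by rewrite (lt_trans ltr01).
pose P : R := 2 ^+ j; have P0 : 0 < P by rewrite exprn_gt0.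
pose u := P `^ q^-1; pose v := J `^ q^-1.
have u0 : 0 < u by rewrite powR_gt0.
have v0 : 0 < v by rewrite powR_gt0.
have uq : u `^ q = P by rewrite -powRrM mulVf ?gt_eqF// powRr1// ltW.
have vq : v `^ q = J by rewrite -powRrM mulVf ?gt_eqF// powRr1// ltW.
have -> : J `^ (1 - q^-1) = J / v.
  by rewrite powRB ?(gt_eqF J0) ?implybT// powRr1// ltW.
(* T equates T * P * J with T^(1-q) * P^(2-q) * B^q. *)
pose T := B * u / (P * v); have T0 : 0 < T by rewrite divr_gt0// mulr_gt0.
set a := fun k => normc (torus_coef g k); have a0 k : 0 <= a k by exact: normc_ge0.
have S1 : \sum_(k <- X) a k <= T * (size X)%:R + T * (T `^ (- q) * \sum_(k <- X) a k `^ q).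
  rewrite -sum1_size natr_sum !mulr_sumr -big_split/=; apply: ler_sum => k _.
  rewrite -mulrDr mulrC -ler_pdivrMr// powRN mulrC.
  have := ler_powR1 (divr_ge0 (a0 k) (ltW T0)) (ltW q1).
  by rewrite powRM ?invr_ge0 ?(ltW T0)// powR_inv ?(ltW T0)// !(mulrC _^-1).
have S2 : \sum_(k <- X) a k `^ q <= P `^ (2 - q) * (paleyC q ^+ n * B `^ q).
  have := torus_paley_seq q12 mg gB uX.
  rewrite -(ler_pM2l (powR_gt0 (2 - q) P0)); apply: le_trans.
  rewrite mulr_sumr big_seq [leRHS]big_seq; apply: ler_sum => k kX.
  rewrite mulrA ler_peMl ?powR_ge0//.
  rewrite powR_prod => [|i]; last by rewrite ltW ?freq_gt0.
  have F0 : 0 < \prod_(i < n) freq (tnth k i) :> R.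
    by apply: prodr_gt0 => i _; exact: freq_gt0.
  have FP : \prod_(i < n) freq (tnth k i) <= P by rewrite /P -(Xj k kX) prod_freq_le.
  rewrite -[q - 2]opprB powRN ler_pdivlMr ?powR_gt0// mul1r.
  have q2' : 0 <= 2 - q by rewrite subr_ge0.
  by apply: (ge0_ler_powR q2') FP; rewrite nnegrE ltW.
have TE : T * P * J = u * (J / v) * B by rewrite /T; field; rewrite !gt_eqF.
have TqE : T `^ (- q) * (P `^ (2 - q) * B `^ q) = P * J.
  rewrite powRN /T !powRM ?invr_ge0 ?mulr_ge0 ?(ltW B0) ?(ltW u0) ?(ltW P0) ?(ltW v0)//.
  rewrite powR_inv ?mulr_ge0 ?(ltW P0) ?(ltW v0)//.
  rewrite powRM ?(ltW P0) ?(ltW v0)// uq vq.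
  rewrite powRB ?(gt_eqF P0) ?implybT// powR_mulrn ?(ltW P0)//.
  have B' : B `^ q != 0 by rewrite gt_eqF// powR_gt0.
  have P' : P `^ q != 0 by rewrite gt_eqF// powR_gt0.
  by field; rewrite B' P' !gt_eqF.
apply: le_trans S1 _; rewrite -TE mulrDl mul1r addrC lerD//; last first.
  by rewrite -mulrA ler_pM2l.
rewrite (_ : _ * (T * P * J) = T * (T `^ (- q) * (P `^ (2 - q) * (paleyC q ^+ n * B `^ q)))).
  by rewrite ler_pM2l// ler_wpM2l ?powR_ge0.
rewrite (mulrCA (P `^ _)) (mulrCA (T `^ _)) TqE; ring.
Qed.

(** Paley's inequality fails for q = 1, but there each coefficient is bounded by
    the L_1 norm, and 2^j of them cost exactly the factor 2^(j/q). *)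
Lemma block_bound1 (q : R) n (g : pts R n -> R[i]) (B : R) (j : nat) (X : seq (n.-tuple int)) :
  1 <= q <= 2 -> cmfun g -> 0 < B ->
  (\int[mu n]_(x in torus) (normc (g x) `^ q)%:E <= (B `^ q)%:E)%E ->
  uniq X -> (forall k, k \in X -> tlevel k = j) -> (size X <= 2 ^ j)%N ->
  \sum_(k <- X) normc (torus_coef g k) <=
   (paleyC q ^+ n + 2) * ((2 ^+ j) `^ q^-1 * B).
Proof.
move=> /andP[q1 q2] mg B0 gB uX Xj sX.
have sX' : (size X)%:R <= 2 ^+ j :> R by rewrite -natrX ler_nat.
have [q1'|q1'] := ltP 1 q.
  have q12 : 1 < q <= 2 by rewrite q1'.
  have C0 : 0 < paleyC q by case/andP: (q12) => qa qb; apply: paleyC_gt0; rewrite (ltW qa).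
  apply: le_trans (block_bound q12 mg B0 gB uX Xj ltr01 _) _; first by rewrite mulr1.
  rewrite powR1 mulr1 ler_wpM2r ?mulr_ge0 ?powR_ge0 ?(ltW B0)// lerD2l ler1n//.
have {q1 q1'}q1 : q = 1 by apply/eqP; rewrite eq_le q1 q1'.
rewrite q1 invr1 powRr1 ?exprn_ge0//.
have h k : normc (torus_coef g k) <= 2 * B.
  rewrite -lee_fin EFinM.
  have := cint_norm_le (mu n) (@measurable_torus R n) (cmfunM mg (cmfun_character k)).
  move=> /le_trans; apply; apply: lee_wpmul2l => //.
  move: gB; rewrite q1 powRr1 ?(ltW B0)//; apply: le_trans.
  rewrite le_eqVlt; apply/orP; left; apply/eqP; apply: eq_integral => x _.
  by rewrite normcM normc_cis mulr1 powRr1 ?normc_ge0.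
apply: (@le_trans _ _ (\sum_(k <- X) 2 * B)); first by apply: ler_sum.
rewrite big_const_seq count_predT iter_addr_0 -[leLHS]mulr_natl.
apply: (@le_trans _ _ (2 ^+ j * (2 * B))).
  by rewrite ler_wpM2r ?mulr_ge0 ?(ltW B0).
rewrite mulrCA ler_wpM2r ?mulr_ge0 ?exprn_ge0 ?(ltW B0)// lerDr exprn_ge0//.
by apply/ltW/paleyC_gt0; rewrite lexx ler1n.
Qed.

End block_bound.

(** * Translation invariance on the torus *)

Section translation_line.
Context {R : realType}.
Local Notation leb := (@lebesgue_measure R).
Local Notation circle := (`[0, 2 * pi]%classic : set (measurableTypeR R)).
Implicit Types F : measurableTypeR R -> \bar R.

Lemma measurable_addr (t : R) :
  measurable_fun setT ((fun x => x + t) : measurableTypeR R -> measurableTypeR R).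
Proof. by apply: measurable_funD => //; exact: measurable_id. Qed.

Lemma lebesgue_measure_shift (t : R) (A : set R) : measurable A ->
  pushforward leb ((fun x => x + t) : _ -> measurableTypeR R) A = leb A.
Proof.
move=> mA; apply/esym/lebesgue_measure_unique => //=; first exact: measurable_addr.
move=> mt _ [[a b]] _ <-; rewrite /pushforward.
have -> : (fun x : R => x + t) @^-1` `]a, b] = `]a - t, b - t]%classic.
  by apply/seteqP; split => x /=; rewrite !in_itv/= ltrBlDr lerBrDr.
by rewrite !lebesgue_measure_itv/= !lte_fin ltrD2r; case: ifP => // _; congr EFin; ring.
Qed.

Lemma ge0_integral_shift (t : R) (E : set (measurableTypeR R)) F : measurable E ->
  measurable_fun setT F -> (forall x, 0 <= F x)%E ->
  (\int[leb]_(x in ((fun x => (x + t)%R) @^-1` E)) F (x + t)%R = \int[leb]_(x in E) F x)%E.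
Proof.
move=> mE mF F0.
rewrite -(@ge0_integral_pushforward _ _ _ _ R _ (measurable_addr t) leb E F)//.
  apply: eq_measure_integral; first exact: measurable_addr.
  move=> mt A mA _; exact: lebesgue_measure_shift.
exact: measurable_funTS.
Qed.

Lemma periodic_int F (m : int) x : (forall x, F (x + 2 * pi) = F x) ->
  F (x + m%:~R * (2 * pi)) = F x.
Proof.
move=> pF; have h n y : F (y + n%:R * (2 * pi)) = F y.
  elim: n y => [|n IH] y; first by rewrite mul0r addr0.
  by rewrite -natr1 mulrDl mul1r addrA pF IH.
case: m => n; first exact: h.
by rewrite NegzE mulrNz mulNr -[LHS](h n.+1) subrK.
Qed.

(** The shifted period is cut at the end of the circle, and the part beyond it
    is moved back by one period. *)
Lemma ge0_integral_circle_shift (t : R) F : measurable_fun setT F ->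
  (forall x, 0 <= F x)%E -> (forall x, F (x + 2 * pi) = F x) ->
  (\int[leb]_(x in circle) F (x + t)%R = \int[leb]_(x in circle) F x)%E.
Proof.
move=> mF F0 pF; have N0 := @twopi_gt0 R.
wlog /andP[t0 t1] : t / 0 <= t < 2 * pi.
  move=> h; pose m := Num.floor (t / (2 * pi)).
  have tm : 0 <= t - m%:~R * (2 * pi) < 2 * pi.
    have /andP[h1 h2] := mem_rg1_floor (t / (2 * pi)).
    rewrite subr_ge0 ltrBlDr -ler_pdivlMr// h1/=.
    have : t < (m%:~R + 1) * (2 * pi) by rewrite -ltr_pdivrMr.
    by rewrite mulrDl mul1r addrC.
  rewrite -(h _ tm); apply: eq_integral => x _.
  by rewrite -[in LHS](subrK (m%:~R * (2 * pi)) t) addrA periodic_int.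
have mFt : measurable_fun setT (fun x : measurableTypeR R => F (x + t)).
  exact: (measurableT_comp mF (measurable_addr t)).
have toI (H : measurableTypeR R -> \bar R) : measurable_fun setT H ->
    (\int[leb]_(x in circle) H x = \int[leb]_(x in `]0%R, (2 * pi)%R]) H x)%E.
  by move=> mH; rewrite integral_itv_obnd_cbnd//; exact: measurable_funTS.
rewrite !toI//.
have E1 : `]0, 2 * pi]%classic = (fun x => x + t) @^-1` (`]t, t + 2 * pi]%classic : set R).
  by apply/seteqP; split => x /=; rewrite !in_itv/= ltrDr [x + t]addrC lerD2l.
rewrite [in LHS]E1 ge0_integral_shift//.
have -> : `]t, t + 2 * pi]%classic = `]t, 2 * pi] `|` `]2 * pi, t + 2 * pi] :> set R.
  rewrite -itv_bndbnd_setU// bnd_simp ?(ltW t1)// lerDr//.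
rewrite ge0_integral_setU//=; last 2 first.
- exact: measurable_funTS.
- apply/disj_setPS => x [] /=; rewrite !in_itv/= => /andP[_ h1] /andP[h2 _].
  by have := lt_le_trans h2 h1; rewrite ltxx.
have -> : (\int[leb]_(x in `](2 * pi)%R, (t + 2 * pi)%R]) F x = \int[leb]_(x in `]0%R, t]) F x)%E.
  rewrite -(ge0_integral_shift (2 * pi))//.
  have -> : (fun x => x + 2 * pi) @^-1` (`]2 * pi, t + 2 * pi]%classic : set R) = `]0, t]%classic.
    by apply/seteqP; split => x /=; rewrite !in_itv/= ltrDr lerD2r.
  by apply: eq_integral => x _.
rewrite addeC -ge0_integral_setU//=; last 2 first.
- exact: measurable_funTS.
- apply/disj_setPS => x [] /=; rewrite !in_itv/= => /andP[_ h1] /andP[h2 _].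
  by have := lt_le_trans h2 h1; rewrite ltxx.
by rewrite -itv_bndbnd_setU// bnd_simp// ltW.
Qed.

End translation_line.

Section translation_torus.
Context {R : realType}.
Local Notation leb := (@lebesgue_measure R).
Local Notation mu := (@lebesgue_pts R).
Local Notation circle := (`[0, 2 * pi]%classic : set (measurableTypeR R)).

Definition add_pt n (x t : pts R n) : pts R n :=
  [tuple ((tnth x i : R) + (tnth t i : R) : R) | i < n].

(** Periodicity for an arbitrary codomain, so that it also covers real and extended real valued
    functions. *)
Definition tperiodic n (A : Type) (f : pts R n -> A) :=
  forall x j, f (shift_pt x j (2 * pi)) = f x.

Lemma add_pt_consp n (p q : measurableTypeR R * pts R n) :
  add_pt (consp p) (consp q) = consp (p.1 + q.1, add_pt p.2 q.2).
Proof.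
apply: eq_from_tnth => i; rewrite tnth_mktuple; case: (unliftP ord0 i) => [j|] ->.
  by rewrite !tnth_consp_lift tnth_mktuple.
by rewrite !tnth_consp0.
Qed.

Lemma shift_pt_consp0 n (p : measurableTypeR R * pts R n) s :
  shift_pt (consp p) ord0 s = consp (p.1 + s, p.2).
Proof.
apply: eq_from_tnth => i; rewrite tnth_mktuple; case: (unliftP ord0 i) => [j|] ->.
  by rewrite !tnth_consp_lift addr0.
by rewrite !tnth_consp0 eqxx.
Qed.

Lemma shift_pt_consp_lift n (p : measurableTypeR R * pts R n) j s :
  shift_pt (consp p) (lift ord0 j) s = consp (p.1, shift_pt p.2 j s).
Proof.
apply: eq_from_tnth => i; rewrite tnth_mktuple; case: (unliftP ord0 i) => [l|] ->.
  by rewrite !tnth_consp_lift tnth_mktuple (inj_eq lift_inj).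
by rewrite !tnth_consp0 addr0.
Qed.

Lemma consp_eta n (x : pts R n.+1) : exists p, x = consp p.
Proof. by exists (thead x, [tuple of behead x]); rewrite [LHS]tuple_eta. Qed.

Lemma measurable_add_pt n (t : pts R n) : measurable_fun setT (fun x => add_pt x t).
Proof.
apply/measurable_fun_tnthP => i.
rewrite (_ : _ \o _ = fun x : pts R n => (tnth x i : R) + (tnth t i : R)); last first.
  by apply/funext => x /=; rewrite tnth_mktuple.
by apply: measurable_funD => //; exact: measurable_tnth.
Qed.

Lemma ge0_integral_torus_shift n (t : pts R n) (G : pts R n -> \bar R) :
  measurable_fun setT G -> (forall x, 0 <= G x)%E -> tperiodic G ->
  (\int[mu n]_(x in torus) G (add_pt x t) = \int[mu n]_(x in torus) G x)%E.
Proof.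
elim: n t G => [|n IH] t G mG G0 pG.
  by apply: eq_integral => x _; rewrite [add_pt _ _]tuple0 [x]tuple0.
have [[s t'] ->] := consp_eta t.
pose z : pts R n := [tuple 0 | i < n].
have z0 (x : pts R n) : add_pt x z = x.
  by apply: eq_from_tnth => i; rewrite !tnth_mktuple addr0.
have mGt u : measurable_fun setT (fun x => G (add_pt x u)).
  exact: (measurableT_comp mG (@measurable_add_pt n.+1 u)).
rewrite tonelli_consp//.
transitivity (\int[leb]_(a in circle) \int[mu n]_(x in torus) G (add_pt (consp (a, x)) (consp (s, z))))%E.
  apply: eq_integral => a _.
  have mH : measurable_fun setT (fun x => G (consp (a + s, x))).
    apply: (measurableT_comp mG); apply: (measurableT_comp (@measurable_consp R n)).
    exact: measurable_pair1.
  under eq_integral do rewrite add_pt_consp/=.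
  rewrite (IH t' (fun x => G (consp (a + s, x))))//.
    by apply: eq_integral => x _; rewrite add_pt_consp/= z0.
  by move=> x j; rewrite -[LHS]/(G (consp ((a + s, x).1, shift_pt (a + s, x).2 j (2 * pi)))) -shift_pt_consp_lift pG.
rewrite -(tonelli_consp (h := fun x => G (add_pt x (consp (s, z)))))//.
rewrite tonelli_consp2// [RHS]tonelli_consp2//.
apply: eq_integral => x _.
under eq_integral do rewrite add_pt_consp/= z0.
apply: (@ge0_integral_circle_shift R s (fun a => G (consp (a, x)))) => //.
  exact: (measurableT_comp mG (@measurable_consp1 R n x)).
by move=> a; rewrite -[LHS]/(G (consp ((a, x).1 + 2 * pi, (a, x).2))) -shift_pt_consp0 pG.
Qed.

Lemma cint_torus_shift n (t : pts R n) (f : pts R n -> R[i]) :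
  cmfun f -> tperiodic f ->
  cint (mu n) torus (fun x => f (add_pt x t)) = cint (mu n) torus f.
Proof.
move=> [f1 f2] pf.
have h (u : pts R n -> R) : measurable_fun setT u -> tperiodic u ->
    \int[mu n]_(x in torus) u (add_pt x t) = \int[mu n]_(x in torus) u x.
  move=> mu pu; have meu : measurable_fun setT (EFin \o u) by exact/measurable_EFinP.
  congr fine; rewrite [LHS]integralE [RHS]integralE; congr (_ - _)%E.
    rewrite -(ge0_integral_torus_shift t (measurable_funepos meu) (fun=> funepos_ge0 _ _)).
      by apply: eq_integral => x _; rewrite !funeposE.
    by move=> x j; rewrite !funeposE /= pu.
  rewrite -(ge0_integral_torus_shift t (measurable_funeneg meu) (fun=> funeneg_ge0 _ _)).
    by apply: eq_integral => x _; rewrite !funenegE.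
  by move=> x j; rewrite !funenegE /= pu.
rewrite /cint; congr Complex.
  by apply: (h (fun x => complex.Re (f x))) => // x j; rewrite pf.
by apply: (h (fun x => complex.Im (f x))) => // x j; rewrite pf.
Qed.

End translation_torus.

(** * Counting frequencies in dyadic blocks *)

Lemma sum_bool_card (I : finType) (P : pred I) :
  (\sum_i (P i : nat) = #|[pred i | P i]|)%N.
Proof. by rewrite -sum1_card [RHS]big_mkcond; apply: eq_bigr => i _; rewrite inE; case: (P i). Qed.

(** Level m >= 1 has the moduli from 2^(m-1) to 2^m - 1, with two signs each, and
    level 0 the frequency 0 only. *)
Lemma card_level_window (J m : nat) :
  (\sum_(i : 'I_(2 ^ J).*2.+1) (level (window_int i) == m) <= 2 ^ m)%N.
Proof.
rewrite sum_bool_card.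
case: m => [|m].
  rewrite expn0; apply/card_le1_eqP => i l; rewrite !inE => hi hl.
  apply: (@window_int_inj J); move: hi hl.
  by rewrite !(eq_sym _ 0%N) -!levelP /= => hi hl; lia.
pose c (i : 'I_(2 ^ J).*2.+1) : bool * 'I_(2 ^ m).-1.+1 :=
  (0 <= window_int i, inord (absz (window_int i) - 2 ^ m)).
have m0 : (0 < 2 ^ m)%N by rewrite expn_gt0.
have b i : level (window_int i) == m.+1 ->
    (absz (window_int i) - 2 ^ m < (2 ^ m).-1.+1)%N /\ (2 ^ m <= absz (window_int i))%N.
  rewrite eq_sym -levelP expnS mulKn// => /andP[h1 h2].
  by rewrite prednK//; split => //; lia.
rewrite -(card_in_imset (f := c)) => [|i l].
  rewrite (leq_trans (max_card _))// card_prod card_bool card_ord prednK//.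
  by rewrite expnS.
rewrite !inE => /b[hi hi'] /b[hl hl'] [h1 h2].
apply: (@window_int_inj J).
have : (absz (window_int i) - 2 ^ m = absz (window_int l) - 2 ^ m)%N.
  by rewrite -[LHS](inordK hi) -[RHS](inordK hl) h2.
lia.
Qed.

Definition levels n (k : n.-tuple int) : n.-tuple nat := map_tuple level k.

Lemma tlevelE n (k : n.-tuple int) : tlevel k = (\sum_(i < n) tnth (levels k) i)%N.
Proof. by apply: eq_bigr => i _; rewrite tnth_map. Qed.

Lemma sum_levels_le (J n : nat) (s : n.-tuple nat) :
  (\sum_(K : n.-tuple 'I_(2 ^ J).*2.+1)
     (levels (map_tuple (@window_int J) K) == s) <= 2 ^ (\sum_(i < n) tnth s i))%N.
Proof.
elim: n s => [|n IH] s.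
  by rewrite big_ord0 sum_bool_card (leq_trans (max_card _))// card_tuple expn0.
have -> : s = [tuple of thead s :: [tuple of behead s]] by rewrite [LHS]tuple_eta; exact: val_inj.
move: (thead s) [tuple of behead s] => a s'.
rewrite sum_tuple_cons big_ord_recl tnth0 expnD.
apply: (@leq_trans (\sum_(i : 'I_(2 ^ J).*2.+1) (level (window_int i) == a) * 2 ^ (\sum_(i < n) tnth s' i))%N).
  apply: leq_sum => i _.
  apply: (@leq_trans (\sum_(K : n.-tuple 'I_(2 ^ J).*2.+1) (level (window_int i) == a) *
     (levels (map_tuple (@window_int J) K) == s'))%N).
    apply: leq_sum => K _; rewrite mulnb -!val_eqE /= eqseq_cons.
    by [].
  by rewrite -big_distrr /= leq_mul2l IH orbT.
rewrite -big_distrl /=; apply: leq_mul; first exact: card_level_window.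
rewrite leq_exp2l// leq_sum// => i _.
by rewrite tnthS.
Qed.

Lemma size_levels_le n (X : seq (n.-tuple int)) (s : n.-tuple nat) : uniq X ->
  (forall k, k \in X -> levels k = s) -> (size X <= 2 ^ (\sum_(i < n) tnth s i))%N.
Proof.
move=> uX Xs; pose J := (\max_(k <- X) tlevel k)%N.
apply: leq_trans (sum_levels_le J s).
rewrite sum_bool_card cardE -(size_map (map_tuple (@window_int J))).
apply: uniq_leq_size => // k kX; apply/mapP.
have kE : map_tuple (@window_int J) (map_tuple (@int_window J) k) = k.
  apply: val_inj => /=; rewrite -map_comp map_id_in// => z /tnthP[i ->] /=.
  apply: int_windowK; apply: leq_trans (absz_lt_tlevel _ _) _.
  by rewrite leq_exp2l// /J (big_rem k)//= leq_maxl.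
by exists (map_tuple (@int_window J) k); rewrite ?kE// mem_enum inE kE (Xs k kX).
Qed.

(** A level vector with total j is determined by all but its first entry, so the
    block splits into at most (j+1)^n rectangles. *)
Lemma block_fiber_le (R : realType) n (X : seq (n.+1.-tuple int)) (j : nat) (M : R)
    (F : n.+1.-tuple int -> R) : uniq X ->
  (forall k, k \in X -> tlevel k = j) ->
  0 <= M ->
  (forall (s : n.+1.-tuple nat) (Y : seq (n.+1.-tuple int)), uniq Y ->
     (\sum_(i < n.+1) tnth s i = j)%N -> (forall k, k \in Y -> levels k = s) ->
     \sum_(k <- Y) F k <= M) ->
  \sum_(k <- X) F k <= j.+1%:R ^+ n * M.
Proof.
move=> uX Xj M0 hM.
pose p (k : n.+1.-tuple int) : n.-tuple 'I_j.+1 :=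
  [tuple inord (level (tnth k (lift ord0 i))) | i < n].
rewrite (partition_big p xpredT)//=.
apply: (@le_trans _ _ (\sum_(t : n.-tuple 'I_j.+1) M)); last first.
  by rewrite sumr_const card_tuple card_ord -[leLHS]mulr_natl natrX.
apply: ler_sum => t _; rewrite -big_filter.
set Y := [seq k <- X | p k == t].
have [Y0|[k0 k0Y]] : Y = [::] \/ exists k0, k0 \in Y.
  by case: Y => [|k Y']; [left|right; exists k; rewrite inE eqxx].
  by rewrite Y0 big_nil.
have YX k : k \in Y -> k \in X by rewrite mem_filter => /andP[].
apply: (hM (levels k0)); first exact: filter_uniq.
  by rewrite -tlevelE Xj// YX.
have lb k i : k \in Y -> (level (tnth k i) < j.+1)%N.
  by move=> /YX/Xj <-; rewrite ltnS /tlevel (bigD1 i)//= leq_addr.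
have tail k i : k \in Y -> level (tnth k (lift ord0 i)) = tnth t i.
  move=> kY; have := kY; rewrite mem_filter => /andP[/eqP/(congr1 (fun t => tnth t i)) + _].
  rewrite tnth_mktuple => /(congr1 val) /=; rewrite inordK//; exact: lb.
move=> k kY; apply: eq_from_tnth => i; rewrite !tnth_map.
case: (unliftP ord0 i) => [l|] ->; first by rewrite !tail.
have : tlevel k = tlevel k0 by rewrite !Xj ?YX.
rewrite /tlevel !big_ord_recl.
under eq_bigr => l _ do rewrite (tail k l kY).
under [X in _ = (_ + X)%N -> _]eq_bigr => l _ do rewrite (tail k0 l k0Y).
by move/addIn.
Qed.

Lemma size_block_le (R : realType) n (X : seq (n.+1.-tuple int)) (j : nat) : uniq X ->
  (forall k, k \in X -> tlevel k = j) -> (size X)%:R <= j.+1%:R ^+ n * 2 ^+ j :> R.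
Proof.
move=> uX Xj; have := @block_fiber_le R n X j (2 ^+ j) (fun=> 1) uX Xj.
rewrite big_const_seq count_predT iter_addr_0; apply; first exact: exprn_ge0.
move=> s Y uY sj Ys; rewrite big_const_seq count_predT iter_addr_0.
by rewrite -natrX ler_nat -sj size_levels_le.
Qed.

(** * Fourier coefficients of trigonometric polynomials *)

Section product_integral.
Context {R : realType}.
Local Notation leb := (@lebesgue_measure R).
Local Notation mu := (@lebesgue_pts R).
Local Notation circle := (`[0, 2 * pi]%classic : set (measurableTypeR R)).

Lemma normc_prod (I : finType) (z : I -> R[i]) : normc (\prod_i z i) = \prod_i normc (z i).
Proof. by elim/big_rec2: _ => [|i x y _ <-]; rewrite ?normc1// normcM. Qed.

Lemma cmfun_prod d (T : measurableType d) (I : finType) (F : I -> T -> R[i]) :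
  (forall i, cmfun (F i)) -> cmfun (fun x => \prod_i F i x).
Proof.
move=> mF; elim: (index_enum I) => [|i s IH].
  by under eq_fun do rewrite big_nil; exact: cmfun_cst.
by under eq_fun do rewrite big_cons; exact: cmfunM.
Qed.

(** A product of functions of separate variables: the origin both of the
    orthogonality of the characters and of the coefficients of the product
    kernel. *)
Lemma cint_torus_prod n (F : 'I_n -> measurableTypeR R -> R[i]) :
  (forall i, cintegrable leb circle (F i)) ->
  cintegrable (mu n) torus (fun x => \prod_i F i (tnth x i)) /\
  cint (mu n) torus (fun x => \prod_i F i (tnth x i)) = \prod_i cint leb circle (F i).
Proof.
elim: n F => [|n IH] F iF.
  have E : (fun x : pts R 0 => \prod_(i < 0) F i (tnth x i)) = fun=> 1.
    by apply/funext => x; rewrite big_ord0.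
  rewrite E big_ord0; split.
    split; first exact: cmfun_cst.
    rewrite integral_cst; last exact: measurable_torus.
    by rewrite normc1 mul1e; exact: torus_lty.
  rewrite /cint /=; congr Complex; rewrite Rintegral_cst; try exact: measurable_torus.
    rewrite mul1r [X in fine X](_ : _ = 1%E)//.
    by have := @lebesgue_torus R 0; rewrite expr0.
  by rewrite mul0r.
have [iP cP] := IH (fun i => F (lift ord0 i)) (fun i => iF _).
have consE p : \prod_i F i (tnth (consp p) i) =
    F ord0 p.1 * \prod_i F (lift ord0 i) (tnth p.2 i).
  rewrite big_ord_recl tnth_consp0; congr (_ * _).
  by apply: eq_bigr => i _; rewrite tnth_consp_lift.
have mP : cmfun (fun x : pts R n.+1 => \prod_i F i (tnth x i)).
  apply: cmfun_prod => i.
  by apply: (cmfun_comp (iF i).1); exact: measurable_tnth.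
have mc := @measurable_circle R; have mT := @measurable_torus R n.
have iPn : cintegrable (mu n.+1) torus (fun x : pts R n.+1 => \prod_i F i (tnth x i)).
  split => //; rewrite tonelli_consp//; last 2 first.
  - by apply/measurable_EFinP; exact: measurable_normc.
  - by move=> x; rewrite lee_fin normc_ge0.
  pose P : pts R n -> R[i] := fun x => \prod_(i < n) F (lift ord0 i) (tnth x i).
  have {}iP : cintegrable (mu n) torus P := iP.
  set A := (\int[mu n]_(x in torus) (normc (P x))%:E)%E.
  have A0 : (0 <= A)%E by apply: integral_ge0 => x _; rewrite lee_fin normc_ge0.
  have Afin : A \is a fin_num by rewrite ge0_fin_numE//; exact: iP.2.
  rewrite (_ : (\int[leb]_(a in circle) _ = \int[leb]_(a in circle) ((normc (F ord0 a))%:E * A))%E); last first.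
    apply: eq_integral => a _; rewrite -ge0_integralZl_EFin ?normc_ge0//; last 2 first.
    - by move=> x _; rewrite lee_fin normc_ge0.
    - by apply: measurable_EFin_normc; exact: iP.1.
    by apply: eq_integral => x _; rewrite consE normcM EFinM.
  rewrite -(fineK Afin) ge0_integralZr//; last 3 first.
  - by apply: measurable_EFin_normc; exact: (iF ord0).1.
  - by move=> a _; rewrite lee_fin normc_ge0.
  - by rewrite lee_fin fine_ge0.
  by rewrite muleC lte_mul_pinfty ?lee_fin ?fine_ge0//; exact: (iF ord0).2.
split=> //; rewrite cint_consp1// big_ord_recl -cP.
transitivity (cint leb circle (fun a => cint (mu n) torus (fun x => \prod_(i < n) F (lift ord0 i) (tnth x i)) * F ord0 a)).
  apply: eq_cint => a _; rewrite mulrC -cintZ//.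
  by apply: eq_cint => x _; rewrite consE.
by rewrite cintZ// mulrC.
Qed.

Lemma cis_sum (I : finType) (f : I -> R) : cis (\sum_i f i) = \prod_i cis (f i).
Proof. by elim/big_rec2: _ => [|i x y _ <-]; rewrite ?cis0// cisD. Qed.

Lemma cint_torus_cis n (m : n.-tuple int) :
  cint (mu n) torus (fun x => cis (dotp m x)) = if all (fun z => z == 0) m then ((2 * pi) ^+ n)%:C else 0.
Proof.
have [_] := @cint_torus_prod n (fun i a => cis ((tnth m i)%:~R * a)) (fun i => cintegrable_cisM _).
under eq_fun do rewrite -cis_sum.
move=> ->; under eq_bigr => i _ do rewrite cint_cis.
case: ifPn => [/allP m0|/allPn[z /tnthP[i ->] mi0]].
  rewrite (eq_bigr (fun=> (2 * pi)%:C)); last by move=> i _; rewrite m0// mem_tnth.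
  by rewrite prodr_const card_ord rmorphXn.
by rewrite (bigD1 i)//= (negbTE mi0) mul0r.
Qed.

Lemma torus_coef_cis n (m k : n.-tuple int) :
  torus_coef (fun x => cis (dotp m x)) k = if m == k then ((2 * pi) ^+ n)%:C else 0 :> R[i].
Proof.
pose mk : n.-tuple int := [tuple tnth m i - tnth k i | i < n].
have := cint_torus_cis mk; rewrite (_ : all _ mk = (m == k)).
  move=> <-; apply: eq_cint => x _; rewrite -cisD; congr cis.
  rewrite /dotp -sumrN -big_split; apply: eq_bigr => i _ /=.
  by rewrite tnth_mktuple intrB mulrBl.
apply/allP/eqP => [h|mE z /tnthP[i ->]]; last by rewrite tnth_mktuple mE subrr.
apply: eq_from_tnth => i; apply/eqP; rewrite -subr_eq0.
have := h (tnth mk i) (mem_tnth _ _); by rewrite tnth_mktuple.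
Qed.

End product_integral.

Section trigonometric_polynomials.
Context {R : realType}.
Local Notation mu := (@lebesgue_pts R).

Lemma fourierE n (f : pts R n -> R[i]) k :
  fourier f k = ((2 * pi) ^- n)%:C * torus_coef f k.
Proof. by []. Qed.

Lemma cintegrable_torus_cst n (c : R[i]) : cintegrable (mu n) torus (fun=> c).
Proof.
split; first exact: cmfun_cst.
rewrite integral_cst; last exact: measurable_torus.
by apply: lte_mul_pinfty; rewrite ?lee_fin ?normc_ge0//; exact: torus_lty.
Qed.

Lemma cintegrable_character n (m : n.-tuple int) :
  cintegrable (mu n) torus (fun x => cis (dotp m x)).
Proof.
apply: (cintegrable_le (@measurable_torus R n) _ (cintegrable_torus_cst n 1)).
  apply: cmfun_cis_comp; exact: measurable_dotp.
by move=> x _; rewrite normc_cis normc1.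
Qed.

Lemma cintegrable_mul_character n (f : pts R n -> R[i]) k :
  cintegrable (mu n) torus f -> cintegrable (mu n) torus (fun x => f x * cis (- dotp k x)).
Proof.
move=> fi; apply: (cintegrableM (@measurable_torus R n) (M := 1) fi).
  exact: cmfun_character.
by move=> x _; rewrite normc_cis.
Qed.

Lemma fourier_sum n I (s : seq I) (F : I -> pts R n -> R[i]) k :
  (forall i, cintegrable (mu n) torus (F i)) ->
  fourier (fun x => \sum_(i <- s) F i x) k = \sum_(i <- s) fourier (F i) k.
Proof.
move=> iF; rewrite fourierE /torus_coef.
under eq_fun do rewrite mulr_suml.
rewrite cint_sum ?mulr_sumr//; first exact: measurable_torus.
by move=> i; exact: cintegrable_mul_character.
Qed.

Lemma fourierZ n (f : pts R n -> R[i]) c k : cintegrable (mu n) torus f ->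
  fourier (fun x => c * f x) k = c * fourier f k.
Proof.
move=> fi; rewrite !fourierE /torus_coef.
under eq_fun do rewrite -mulrA.
rewrite cintZ 1?mulrCA//; first exact: measurable_torus.
exact: cintegrable_mul_character.
Qed.

Lemma fourier_cis n (m k : n.-tuple int) :
  fourier (fun x : pts R n => cis (dotp m x)) k = (m == k)%:R.
Proof.
rewrite fourierE torus_coef_cis; case: eqP => _; last by rewrite mulr0.
by rewrite -realCM mulVf// expf_neq0// gt_eqF// twopi_gt0.
Qed.

Lemma finite_rho n (s : n.-tuple nat) : finite_set (rho s).
Proof.
pose J := (\sum_(i < n) tnth s i)%N.
apply: (@sub_finite_set _ _ (range (map_tuple (@window_int J) : n.-tuple _ -> n.-tuple int))); last exact: finite_image.
move=> k kr; exists (map_tuple (@int_window J) k) => //.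
apply: val_inj => /=; rewrite -map_comp map_id_in// => z /tnthP[i ->] /=.
apply: int_windowK; have /andP[_ h] := kr i; apply: leq_trans h _.
by rewrite leq_exp2l// /J (bigD1 i)//= leq_addr.
Qed.

Lemma rhoP n (s : n.-tuple nat) (k : n.-tuple int) : rho s k <-> levels k = s.
Proof.
split=> [h|<- i]; last by rewrite levelP tnth_map.
by apply: eq_from_tnth => i; rewrite tnth_map; apply/esym/eqP; rewrite -levelP h.
Qed.

Lemma finite_levels n (j : nat) :
  finite_set [set s : n.-tuple nat | (\sum_(i < n) tnth s i)%N = j].
Proof.
apply: (@sub_finite_set _ _ (range (map_tuple val : n.-tuple 'I_j.+1 -> n.-tuple nat))); last exact: finite_image.
move=> s /= sj; exists (map_tuple inord s) => //.
apply: val_inj => /=; rewrite -map_comp map_id_in// => z /tnthP[i ->] /=.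
by rewrite inordK// ltnS -sj (bigD1 i)//= leq_addr.
Qed.

Lemma fourier_fsum n (T : choiceType) (A : set T)
    (F : T -> pts R n -> R[i]) k : finite_set A ->
  (forall i, cintegrable (mu n) torus (F i)) ->
  fourier (fun x => \sum_(i \in A) F i x) k = \sum_(i \in A) fourier (F i) k.
Proof.
move=> fA iF; rewrite (fsbig_finite _ _ fA) -(fourier_sum (finmap.enum_fset (fset_set A)) k iF).
have -> // : (fun x => \sum_(i \in A) F i x) = (fun x => \sum_(i <- finmap.enum_fset (fset_set A)) F i x).
by apply/funext => x; rewrite (fsbig_finite _ _ fA).
Qed.

Lemma mem_fset_seq (T : choiceType) (A : set T) x : finite_set A ->
  (x \in finmap.enum_fset (fset_set A)) = (x \in A).
Proof. by move=> fA; exact: (in_fset_set fA x). Qed.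

Lemma fourier_delta n (s : n.-tuple nat) (f : pts R n -> R[i]) k :
  fourier (delta s f) k = if levels k == s then fourier f k else 0.
Proof.
have iF m : cintegrable (mu n) torus (fun x => fourier f m * cis (dotp m x)).
  by apply: cintegrableZ; [exact: measurable_torus|exact: cintegrable_character].
rewrite /delta fourier_fsum//; last exact: finite_rho.
rewrite fsbig_finite/=; last exact: finite_rho.
have E m : fourier (fun x => fourier f m * cis (dotp m x)) k = fourier f m * (m == k)%:R.
  by rewrite fourierZ ?fourier_cis//; exact: cintegrable_character.
under eq_bigr do rewrite E.
case: ifPn => ks.
  rewrite (bigD1_seq k)/=; [|idtac|exact: finmap.fset_uniq]; last first.
    by rewrite mem_fset_seq ?mem_set//; [apply/rhoP/eqP|exact: finite_rho].
  rewrite eqxx mulr1 big1 ?addr0// => m mk.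
  by rewrite (negbTE mk) mulr0.
rewrite big_seq big1// => m; rewrite mem_fset_seq; last exact: finite_rho.
move=> /set_mem/rhoP ms; case: eqP => [mk|]; last by rewrite mulr0.
by move: ks; rewrite -ms mk eqxx.
Qed.

Lemma cintegrable_delta n (s : n.-tuple nat) (f : pts R n -> R[i]) :
  cintegrable (mu n) torus (delta s f).
Proof.
rewrite (_ : delta s f = fun x => \sum_(k <- finmap.enum_fset (fset_set (rho s))) fourier f k * cis (dotp k x)).
  apply: cintegrable_sum => [|k]; first exact: measurable_torus.
  by apply: cintegrableZ; [exact: measurable_torus|exact: cintegrable_character].
by apply/funext => x; rewrite /delta fsbig_finite//; exact: finite_rho.
Qed.

(** A block is a trigonometric polynomial, so its coefficients are those of f on the block and 0
    elsewhere. *)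
Lemma fourier_fblock n (j : nat) (f : pts R n -> R[i]) k :
  fourier (fblock j f) k = if tlevel k == j then fourier f k else 0.
Proof.
rewrite /fblock fourier_fsum; last 2 first.
- exact: finite_levels.
- by move=> s; exact: cintegrable_delta.
rewrite fsbig_finite/=; last exact: finite_levels.
under eq_bigr do rewrite fourier_delta.
case: ifPn => kj.
  rewrite (bigD1_seq (levels k))/=; [|idtac|exact: finmap.fset_uniq]; last first.
    rewrite mem_fset_seq; last exact: finite_levels.
    by apply/mem_set; rewrite /= -tlevelE; exact/eqP.
  rewrite eqxx big1 ?addr0// => s sk.
  by rewrite eq_sym (negbTE sk).
rewrite big_seq big1// => s; rewrite mem_fset_seq; last exact: finite_levels.
move=> /set_mem /= sj; case: eqP => // ks.
by move: kj; rewrite tlevelE ks sj eqxx.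
Qed.

Lemma normA_fblock_le n (j : nat) (f : pts R n -> R[i]) (M : R) :
  (forall X : seq (n.-tuple int), uniq X -> (forall k, k \in X -> tlevel k = j) ->
     \sum_(k <- X) normc (fourier f k) <= M) ->
  (normA (fblock j f) <= M%:E)%E.
Proof.
move=> hM; rewrite /normA /esum; apply: ge_ereal_sup => _ [A [fA _] <-].
rewrite fsbig_finite// sumEFin lee_fin.
under eq_bigr do rewrite fourier_fblock.
rewrite (eq_bigr (fun k => if tlevel k == j then normc (fourier f k) else 0)); last first.
  by move=> k _; case: ifP => // _; rewrite normc0.
rewrite -big_mkcond -big_filter; apply: hM; first exact/filter_uniq/finmap.fset_uniq.
by move=> k; rewrite mem_filter => /andP[/eqP].
Qed.

End trigonometric_polynomials.

(** * From block sums of coefficients to the absolute convergence class *)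

Section classes_facts.
Context {R : realType}.
Local Notation mu := (@lebesgue_pts R).

Lemma normc_powR_integral_ge0 n (f : pts R n -> R[i]) (q : R) :
  (0 <= \int[mu n]_(x in torus) (normc (f x) `^ q)%:E)%E.
Proof. by apply: integral_ge0 => x _; rewrite lee_fin powR_ge0. Qed.

(** The constant has the shape B'^q, as the Paley-type bounds require. *)
Lemma lqnorm_le_integral n (f : pts R n -> R[i]) (q B : R) : 0 < q -> 0 <= B ->
  (lqnorm q f <= B%:E)%E ->
  (\int[mu n]_(x in torus) (normc (f x) `^ q)%:E <=
    ((((2 * pi) ^+ n) `^ q^-1 * B) `^ q)%:E)%E.
Proof.
move=> q0 B0; rewrite /lqnorm.
have A0 := normc_powR_integral_ge0 f q.
set A := (\int[mu n]_(x in torus) _)%E in A0 *.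
have P0 : 0 < (2 * pi) ^+ n :> R by rewrite exprn_gt0// twopi_gt0.
have PV : (0 <= ((2 * pi) ^- n)%:E :> \bar R)%E by rewrite lee_fin invr_ge0 ltW.
have X0 : (0 <= ((2 * pi) ^- n)%:E * A)%E by exact: mule_ge0.
move=> /(@gt0_ler_poweR R q (ltW q0)).
rewrite !in_itv/= !leey !andbT poweR_ge0 lee_fin B0 => /(_ isT isT).
rewrite -poweRrM mulVf ?gt_eqF// poweRe1// => h.
rewrite powRM ?powR_ge0// -powRrM mulVf ?gt_eqF// powRr1 ?(ltW P0)//.
have -> : A = (((2 * pi) ^+ n)%:E * (((2 * pi) ^- n)%:E * A))%E.
  by rewrite muleA -EFinM mulfV ?mul1e// gt_eqF.
by rewrite EFinM; apply: lee_wpmul2l => //; rewrite lee_fin ltW.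
Qed.

Lemma Lq_cintegrable n (f : pts R n -> R[i]) (q : R) : 1 <= q -> Lq q f ->
  cintegrable (mu n) torus f.
Proof.
move=> q1 [_ mf fq].
have q0 : 0 < q by rewrite (lt_le_trans ltr01).
apply: (cintegrable_powR (@measurable_torus R n) (torus_lty n) q1 mf).
move: fq; rewrite /lqnorm => /lty_poweRy; rewrite invr_eq0 gt_eqF// => /(_ isT).
have A0 := normc_powR_integral_ge0 f q.
set A := (\int[mu n]_(x in torus) _)%E in A0 *.
move=> h; rewrite ltNge leye_eq; apply/negP => /eqP Aoo; move: h.
by rewrite Aoo gt0_muley ?ltxx// lte_fin invr_gt0 exprn_gt0// twopi_gt0.
Qed.

Lemma cintegrable_Lq1 n (f : pts R n -> R[i]) : tperiodic f ->
  cintegrable (mu n) torus f -> Lq 1 f.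
Proof.
move=> pf [mf fi]; split=> //; rewrite /lqnorm; apply: poweR_lty.
apply: lte_mul_pinfty => //; first by rewrite lee_fin invr_ge0 exprn_ge0// ltW ?twopi_gt0.
by under eq_integral do rewrite powRr1 ?normc_ge0//.
Qed.

(** The A-norm is a supremum over finite sets of frequencies, so estimates over
    finite subsets of a block suffice. *)
Lemma WAclass_of_block_sums d (f : pts R d.+1 -> R[i]) (a b C : R) :
  0 < C -> tperiodic f -> cintegrable (mu d.+1) torus f ->
  (forall (j : nat) (X : seq (d.+1.-tuple int)), (0 < j)%N -> uniq X ->
    (forall k, k \in X -> tlevel k = j) ->
    \sum_(k <- X) normc (fourier f k) <= C * (2 `^ (- (a * j%:R)) * (j%:R ^+ d) `^ b)) ->
  WAclass d.+1 a b (fun x => (C^-1)%:C * f x).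
Proof.
move=> C0 pf fi hX; have mT := @measurable_torus R d.+1.
have fCi : cintegrable (mu d.+1) torus (fun x => (C^-1)%:C * f x) by exact: cintegrableZ.
split; first by apply: cintegrable_Lq1 => // x j; rewrite pf.
move=> j j0; apply: normA_fblock_le => X uX Xj.
under eq_bigr do rewrite (fourierZ _ _ fi) normcM normcR gtr0_norm ?invr_gt0//.
rewrite -mulr_sumr ler_pdivrMl//; apply: le_trans (hX j X j0 uX Xj) _.
rewrite ler_pM2l// ler_pM2l ?powR_gt0//.
by rewrite (maxn_idPl j0) -addn1 natrD addrK powRrM powR_mulrn.
Qed.

End classes_facts.

(** * Fourier coefficients of mixed differences *)

Section differences.
Context {R : realType} {d : nat}.
Local Notation mu := (@lebesgue_pts R).
Implicit Types f : pts R d -> R[i].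

(** The class of functions on which mixed differences act, as Fourier multipliers. *)
Definition periodic_L1 f := tperiodic f /\ cintegrable (mu d) torus f.

Definition axis_pt (j : 'I_d) (t : R) : pts R d := [tuple (if i == j then t else 0) | i < d].

Lemma shift_ptE (x : pts R d) j t : shift_pt x j t = add_pt x (axis_pt j t).
Proof. by apply: eq_from_tnth => i; rewrite !tnth_mktuple. Qed.

Lemma dotp_shift k (x : pts R d) j t :
  dotp k (shift_pt x j t) = dotp k x + (tnth k j)%:~R * t.
Proof.
rewrite /dotp (bigD1 j)//= [X in _ = X + _](bigD1 j)//= tnth_mktuple eqxx mulrDr.
rewrite -!addrA; congr (_ + _); rewrite addrC; congr (_ + _).
by apply: eq_bigr => i ij; rewrite tnth_mktuple (negbTE ij) addr0.
Qed.

Lemma shift_ptC (x : pts R d) i j s t :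
  shift_pt (shift_pt x i s) j t = shift_pt (shift_pt x j t) i s.
Proof. by apply: eq_from_tnth => l; rewrite !tnth_mktuple addrAC. Qed.

Lemma measurable_shift_pt j t : measurable_fun setT (fun x : pts R d => shift_pt x j t).
Proof. by under eq_fun do rewrite shift_ptE; exact: measurable_add_pt. Qed.

Lemma periodic_L1_shift f j t : periodic_L1 f -> periodic_L1 (fun x => f (shift_pt x j t)).
Proof.
move=> [pf [mf fi]]; split; first by move=> x i; rewrite shift_ptC pf.
split; first exact: (cmfun_comp mf (measurable_shift_pt j t)).
under eq_integral do rewrite shift_ptE.
rewrite (@ge0_integral_torus_shift R d (axis_pt j t) (fun x => (normc (f x))%:E))//.
- by apply/measurable_EFinP; exact: measurable_normc.
- by move=> x; rewrite lee_fin normc_ge0.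
- by move=> x i; rewrite pf.
Qed.

Lemma periodic_L1_diff1 f j t : periodic_L1 f -> periodic_L1 (diff1 j t f).
Proof.
move=> gf; have [pg gi] := periodic_L1_shift j t gf; have [pf fi] := gf.
split; first by move=> x i; have := pg x i; rewrite /diff1 pf /= => ->.
have mT := @measurable_torus R d.
rewrite (_ : diff1 j t f = fun x => f (shift_pt x j t) + (-1) * f x); last first.
  by apply/funext => x; rewrite /diff1 mulN1r.
by apply: cintegrableD => //; exact: cintegrableZ.
Qed.

(** Translation invariance of the integral over a period. *)
Lemma fourier_shift f j t k : periodic_L1 f ->
  fourier (fun x => f (shift_pt x j t)) k = cis ((tnth k j)%:~R * t) * fourier f k.
Proof.
move=> gf; have [pf fi] := gf; have mT := @measurable_torus R d.
rewrite !fourierE mulrCA; congr (_ * _); rewrite /torus_coef.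
pose h x := f x * cis (- dotp k x).
have hi : cintegrable (mu d) torus h by exact: cintegrable_mul_character.
have ph : tperiodic h.
  move=> x i; rewrite /h pf dotp_shift opprD cisD -mulNr -mulrNz cis_int2pi mulr1.
  by [].
rewrite -(cint_torus_shift (axis_pt j t) hi.1 ph) -cintZ//; last first.
  have := periodic_L1_shift j t (conj ph hi); case=> _.
  by under eq_fun do rewrite shift_ptE.
apply: eq_cint => x _; rewrite /h -shift_ptE dotp_shift opprD cisD.
rewrite mulrCA; congr (_ * _); rewrite mulrCA -cisD addrN cis0 mulr1.
by [].
Qed.

Lemma fourier_diff1 f j t k : periodic_L1 f ->
  fourier (diff1 j t f) k = (cis ((tnth k j)%:~R * t) - 1) * fourier f k.
Proof.
move=> gf; have [_ gi] := periodic_L1_shift j t gf; have [pf fi] := gf.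
rewrite mulrBl mul1r -fourier_shift// !fourierE -mulrBr; congr (_ * _).
rewrite /torus_coef -cintB; try exact: cintegrable_mul_character; last exact: measurable_torus.
by apply: eq_cint => x _; rewrite /diff1 mulrBl.
Qed.

(** T is a Fourier multiplier with symbol m at the frequency k; bundling the
    preservation of the class makes compositions immediate. *)
Definition acts_as k (T : (pts R d -> R[i]) -> (pts R d -> R[i])) (m : R[i]) :=
  forall f, periodic_L1 f -> periodic_L1 (T f) /\ fourier (T f) k = m * fourier f k.

Lemma acts_as_comp k T1 T2 m1 m2 : acts_as k T1 m1 -> acts_as k T2 m2 ->
  acts_as k (T1 \o T2) (m1 * m2).
Proof.
move=> h1 h2 f gf; have [g2 e2] := h2 f gf; have [g1 e1] := h1 _ g2.
by split => //=; rewrite e1 e2 mulrA.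
Qed.

Lemma acts_as_id k : acts_as k id 1.
Proof. by move=> f gf; rewrite mul1r. Qed.

Lemma acts_as_iter k T m l : acts_as k T m -> acts_as k (iter l T) (m ^+ l).
Proof.
move=> h; elim: l => [|l IH]; first by rewrite expr0; exact: acts_as_id.
by rewrite exprS; exact: (acts_as_comp h IH).
Qed.

Lemma acts_as_mdiff k l (t : 'I_d -> R) (e : {set 'I_d}) :
  acts_as k (mdiff l t e) (\prod_(j in e) (cis ((tnth k j)%:~R * t j) - 1) ^+ l).
Proof.
apply: (big_ind2 (acts_as k)) => [|T1 T2 m1 m2|j _].
- exact: acts_as_id.
- exact: acts_as_comp.
- apply: acts_as_iter => f gf; split; [exact: periodic_L1_diff1|exact: fourier_diff1].
Qed.

End differences.

(** * The class of functions with bounded mixed differences *)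

Section H_embedding.
Context {R : realType}.
Local Notation mu := (@lebesgue_pts R).

(** A lower bound of |exp(ix) - 1| for 1/2 <= |x| <= 1; the cap at 1 makes the
    variables left out of a mixed difference harmless. *)
Definition gap : R := Num.min 1 (normc (cis (2^-1 : R) - 1)).

Lemma normc_cisB1 (x : R) : normc (cis x - 1) ^+ 2 = 2 - 2 * cos x.
Proof.
rewrite normc_sqr /= subr0 sqrrB1.
have := cos2Dsin2 x; set c := cos x; set s := sin x => h.
rewrite -mulr_natl; lra.
Qed.

Lemma half_in_0pi : (2^-1 : R) \in `[0, pi].
Proof. by rewrite in_itv/=; have := @pi_ge2 R => ?; lra. Qed.

Lemma gap_gt0 : 0 < gap.
Proof.
rewrite lt_min ltr01 andTb lt_neqAle normc_ge0 andbT eq_sym.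
rewrite -[_ == 0](@expf_eq0 _ _ 2) normc_cisB1.
have : cos (2^-1 : R) < cos 0.
  rewrite ltr_cos ?half_in_0pi// ?in_itv/= ?lexx ?pi_ge0//.
by rewrite cos0 => h; rewrite gt_eqF//; lra.
Qed.

Lemma gap_le1 : gap <= 1. Proof. by rewrite ge_min lexx. Qed.

Lemma gap_le (x : R) : 2^-1 <= `|x| <= 1 -> gap <= normc (cis x - 1).
Proof.
move=> /andP[x1 x2]; rewrite ge_min; apply/orP; right.
rewrite -(@ler_pXn2r _ 2)// ?nnegrE ?normc_ge0// !normc_cisB1.
have -> : cos x = cos `|x| by rewrite -[x in LHS]/x; case: (ger0P x) => // _; rewrite cosN.
have : cos `|x| <= cos (2^-1).
  have [->//|xh] := eqVneq `|x| 2^-1.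
  rewrite ltW// ltr_cos ?half_in_0pi//; first by rewrite lt_neqAle eq_sym xh.
  by rewrite in_itv/= normr_ge0/=; have := @pi_ge2 R => ?; lra.
lra.
Qed.

(** At level s >= 1 the step 2^-s turns the frequency k by an angle between 1/2
    and 1, away from the zeros of exp(ix) - 1. *)
Lemma level_angle (k : int) : (0 < level k)%N ->
  2^-1 <= `|k%:~R * 2 ^- level k : R| <= 1.
Proof.
move=> k0; have := levelP (level k) k; rewrite eqxx => /andP[].
have [m mE] : exists m, level k = m.+1 by exists (level k).-1; rewrite prednK.
rewrite mE expnS mulKn// => h1 h2.
rewrite normrM [`|2 ^- _|]ger0_norm ?invr_ge0 ?exprn_ge0// -intr_norm.
have -> : (`|k|%R)%:~R = (absz k)%:R :> R by rewrite -abszE pmulrn.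
apply/andP; split.
  rewrite ler_pdivlMr ?exprn_gt0// exprS mulKf// -natrX ler_nat//.
by rewrite ler_pdivrMr ?exprn_gt0// mul1r exprS -natrX -natrM ler_nat -expnS ltnW// expnS.
Qed.

Definition step_of d (s : d.-tuple nat) (j : 'I_d) : R := 2 ^- tnth s j.

(** At level 0 the only frequency is 0, which every difference annihilates; such
    variables are left out of the mixed difference. *)
Definition support_of d (s : d.-tuple nat) : {set 'I_d} := [set j | (0 < tnth s j)%N].

Lemma fourier_le_mdiff d l (s : d.-tuple nat) (f : pts R d -> R[i]) k :
  periodic_L1 f -> levels k = s ->
  gap ^+ (l * d) * normc (fourier f k) <=
    normc (fourier (mdiff l (step_of s) (support_of s) f) k).
Proof.
move=> gf ks; have [_ ->] := acts_as_mdiff k l (step_of s) (support_of s) gf.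
rewrite [leRHS]normcM ler_wpM2r ?normc_ge0//.
have g0 := ltW gap_gt0.
have -> : gap ^+ (l * d) = \prod_(j < d) gap ^+ l by rewrite prodr_const card_ord exprM.
rewrite (bigID (mem (support_of s)))/=.
have -> : normc (\prod_(j in support_of s) (cis ((tnth k j)%:~R * step_of s j) - 1) ^+ l) =
   \prod_(j in support_of s) normc (cis ((tnth k j)%:~R * step_of s j) - 1) ^+ l.
  have normcX (z : R[i]) m : normc (z ^+ m) = normc z ^+ m.
    by elim: m => [|m IH]; rewrite ?expr0 ?normc1// !exprS normcM IH.
  by elim/big_rec2: _ => [|j x y _ <-]; rewrite ?normc1// normcM normcX.
rewrite -[leRHS]mulr1; apply: ler_pM.
- by apply: prodr_ge0 => j _; rewrite exprn_ge0.
- by apply: prodr_ge0 => j _; rewrite exprn_ge0.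
- apply: ler_prod => j; rewrite inE => sj; rewrite exprn_ge0//=.
  rewrite lerXn2r ?nnegrE ?normc_ge0// gap_le// /step_of -ks tnth_map level_angle//.
  by move: sj; rewrite -ks tnth_map.
- by apply: prodr_ile1 => j _; rewrite exprn_ge0//= exprn_ile1// gap_le1.
Qed.

(** With these steps the bound on the mixed difference is a power of the total level. *)
Lemma prod_step d (s : d.-tuple nat) (r : R) :
  \prod_(j in support_of s) `|step_of s j| `^ r = (2 ^+ (\sum_(i < d) tnth s i)%N) `^ (- r).
Proof.
rewrite powRN -powR_inv ?exprn_ge0// -exprVn -prodrXr -powR_prod => [|i]; last first.
  by rewrite exprn_ge0// invr_ge0.
rewrite [RHS](bigID (mem (support_of s)))/= [X in _ = _ * X]big1 ?mulr1 => [|j]; last first.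
  by rewrite inE -eqn0Ngt => /eqP ->; rewrite expr0 powR1.
by apply: eq_bigr => j _; rewrite /step_of ger0_norm ?invr_ge0 ?exprn_ge0// exprVn.
Qed.

(** The inverse of the multiplier bound, times the constant of block_bound1 and the
    normalization of the norm. *)
Definition constH d (q r : R) : R := gap ^- ((Num.truncn r).+1 * d) *
  ((2 * pi) ^- d * ((paleyC q ^+ d + 2) * ((2 * pi) ^+ d) `^ q^-1)).

(** The frequencies of one rectangle rho(s): the multiplier bound replaces f by its mixed
    difference, whose norm the class controls. *)
Lemma H_block_sum d (q r : R) (f : pts R d -> R[i]) (s : d.-tuple nat) (j : nat)
    (Y : seq (d.-tuple int)) : 1 <= q <= 2 -> Hclass d r q f -> uniq Y ->
  (\sum_(i < d) tnth s i = j)%N -> (forall k, k \in Y -> levels k = s) ->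
  \sum_(k <- Y) normc (fourier f k) <= constH d q r * ((2 ^+ j) `^ q^-1 * (2 ^+ j) `^ (- r)).
Proof.
move=> q12 [Lf Hf] uY sj Ys; have /andP[q1 q2] := q12.
have q0 : 0 < q by rewrite (lt_le_trans ltr01).
have gf : periodic_L1 f by split; [case: Lf|exact: Lq_cintegrable Lf].
set l := (Num.truncn r).+1 in Hf *.
pose g := mdiff l (step_of s) (support_of s) f.
have [gg _] : periodic_L1 g /\ _ := acts_as_mdiff [tuple 0 | i < d] l (step_of s) (support_of s) gf.
have P0 : 0 < (2 * pi) ^+ d :> R by rewrite exprn_gt0// twopi_gt0.
pose B : R := (2 ^+ j) `^ (- r); have B0 : 0 < B by rewrite powR_gt0// exprn_gt0.
have gB := Hf (support_of s) (step_of s); rewrite prod_step sj -/B -/g in gB.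
have := lqnorm_le_integral q0 (ltW B0) gB.
set B' := _ * B => gB'; have B'0 : 0 < B' by rewrite mulr_gt0// powR_gt0.
have Yj k : k \in Y -> tlevel k = j by move=> /Ys kY; rewrite tlevelE kY.
have sY : (size Y <= 2 ^ j)%N by rewrite -sj; exact: size_levels_le.
have hb := block_bound1 q12 gg.2.1 B'0 gB' uY Yj sY.
have G0 : 0 < gap ^+ (l * d) by rewrite exprn_gt0// gap_gt0.
apply: (@le_trans _ _ (gap ^- (l * d) * ((2 * pi) ^- d * \sum_(k <- Y) normc (torus_coef g k)))).
  rewrite mulrA mulr_sumr big_seq [leRHS]big_seq; apply: ler_sum => k kY.
  rewrite -mulrA ler_pdivlMl//.
  apply: le_trans (fourier_le_mdiff l gf (Ys k kY)) _.
  by rewrite -/g fourierE normcM normcR ger0_norm// invr_ge0 ltW.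
rewrite /constH -/l -mulrA ler_pM2l ?invr_gt0// -mulrA ler_pM2l ?invr_gt0//.
apply: le_trans hb _; rewrite le_eqVlt; apply/orP; left; apply/eqP.
by rewrite /B' /B -!mulrA; congr (_ * _); rewrite mulrCA.
Qed.

Lemma constH_gt0 d q r : 1 <= q <= 2 -> 0 < constH d q r.
Proof.
move=> /andP[q1 q2].
have P0 : 0 < (2 * pi) ^+ d :> R by rewrite exprn_gt0// twopi_gt0.
rewrite /constH mulr_gt0 ?invr_gt0 ?exprn_gt0 ?gap_gt0// mulr_gt0 ?invr_gt0//.
by rewrite mulr_gt0 ?powR_gt0// ltr_wpDl// exprn_ge0// ltW// paleyC_gt0// q1.
Qed.

Lemma pow2_combine (q r : R) (j : nat) :
  (2 ^+ j) `^ q^-1 * (2 ^+ j) `^ (- r) = 2 `^ (- ((r - q^-1) * j%:R)).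
Proof.
rewrite -powRD ?expf_neq0 ?implybT// -powR_mulrn// -powRrM; congr (_ `^ _); ring.
Qed.

Lemma succ_pow_le (d j : nat) : (0 < j)%N -> j.+1%:R ^+ d <= 2 ^+ d * j%:R ^+ d :> R.
Proof.
move=> j0; rewrite -exprMn lerXn2r ?nnegrE ?mulr_ge0//.
by rewrite -natrM ler_nat; lia.
Qed.

(** The (j+1)^d rectangles of the block contribute equally, which is the source of
    the exponent b = 1. *)
Lemma H_embeds d (q r : R) : 1 <= q <= 2 ->
  embeds (Hclass d.+1 r q) (WAclass d.+1 (r - q^-1) 1).
Proof.
move=> q12; have C0 := constH_gt0 d.+1 r q12; have /andP[q1 q2] := q12.
exists (2 ^+ d * constH d.+1 q r); first by rewrite mulr_gt0// exprn_gt0.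
move=> f Hf; have [Lf _] := Hf.
apply: WAclass_of_block_sums.
- by rewrite mulr_gt0// exprn_gt0.
- by case: Lf.
- exact: Lq_cintegrable Lf.
move=> j X j0 uX Xj; rewrite powRr1 ?exprn_ge0//.
apply: le_trans (block_fiber_le (M := constH d.+1 q r * 2 `^ (- ((r - q^-1) * j%:R))) uX Xj _ _) _.
- by rewrite mulr_ge0 ?powR_ge0// ltW.
- move=> s Y uY sj Ys; rewrite -pow2_combine.
  exact: H_block_sum q12 Hf uY sj Ys.
apply: (@le_trans _ _ (2 ^+ d * j%:R ^+ d * (constH d.+1 q r * 2 `^ (- ((r - q^-1) * j%:R))))).
  by rewrite ler_wpM2r ?succ_pow_le// mulr_ge0 ?powR_ge0// ltW.
rewrite le_eqVlt; apply/orP; left; apply/eqP; ring.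
Qed.

End H_embedding.

(** * The one-dimensional Bernoulli kernel *)

Section kernel.
Context {R : realType} (r : R) (r0 : 0 < r).
Local Notation leb := (@lebesgue_measure R).
Local Notation circle := (`[0, 2 * pi]%classic : set (measurableTypeR R)).
Local Notation theta := (r * pi / 2).

Definition kterm (k : nat) (x : R) : R := k%:R `^ (- r) * cos (k%:R * x - theta).
Definition ksum (n : nat) (x : R) : R := \sum_(1 <= k < n.+1) kterm k x.

Lemma F1E x : F1 r x = 1 + 2 * limn (ksum^~ x).
Proof. by []. Qed.

Lemma ksum0 x : ksum 0 x = 0.
Proof. by rewrite /ksum big_geq. Qed.

Lemma ksumS n x : ksum n.+1 x = ksum n x + kterm n.+1 x.
Proof. by rewrite /ksum big_nat_recr. Qed.

Definition decay (k : nat) : R := k.+1%:R `^ (- r).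

Lemma decay_ge0 k : 0 <= decay k. Proof. exact: powR_ge0. Qed.

Lemma decayS k : decay k.+1 <= decay k.
Proof.
rewrite /decay !powRN lef_pV2 ?posrE ?powR_gt0//.
by apply: (ge0_ler_powR (ltW r0)); rewrite ?nnegrE// ler_nat.
Qed.

Lemma cvg_decay : decay n @[n --> \oo] --> 0.
Proof.
have r_inv : 0 < r^-1 by rewrite invr_gt0.
apply/cvgr0Pnorm_le => e e0; near=> n.
rewrite ger0_norm ?decay_ge0// /decay powRN.
rewrite -[leRHS]invrK lef_pV2 ?posrE ?powR_gt0 ?invr_gt0//.
have -> : e^-1 = (e^-1 `^ r^-1) `^ r.
  by rewrite -powRrM mulVf ?gt_eqF// powRr1// invr_ge0 ltW.
apply: (ge0_ler_powR (ltW r0)); rewrite ?nnegrE ?powR_ge0//.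
apply: (@le_trans _ _ n%:R); last by rewrite ler_nat.
by near: n; exact: nbhs_infty_ger.
Unshelve. all: by end_near. Qed.

Let wave (k : nat) (x : R) : R := sin ((k%:R + 2^-1) * x - theta).

(** Multiplying by 2 sin(x/2) turns each cosine into a difference of sines. *)
Lemma abel_summation n x : 2 * sin (x / 2) * ksum n x =
  decay n * wave n x - decay 0 * wave 0 x +
  \sum_(0 <= k < n) (decay k - decay k.+1) * wave k.+1 x.
Proof.
elim: n => [|n IH]; first by rewrite ksum0 mulr0 big_geq// addr0 subrr.
rewrite ksumS mulrDr IH big_nat_recr//= /kterm -/(decay n).
have -> : 2 * sin (x / 2) * (decay n * cos (n.+1%:R * x - theta)) =
   decay n * (wave n.+1 x - wave n x).
  have -> : wave n.+1 x = sin ((n.+1%:R * x - theta) + x / 2).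
    by congr sin; rewrite mulrDl; ring.
  have -> : wave n x = sin ((n.+1%:R * x - theta) - x / 2).
    by congr sin; rewrite -natr1; field.
  by rewrite sinB sinD; ring.
ring.
Qed.

(** Abel summation leaves a series dominated by the telescoping differences of k^-r. *)
Lemma cvg_ksum x : sin (x / 2) != 0 -> cvgn (ksum^~ x).
Proof.
move=> sx.
pose u n := (decay n - decay n.+1) * wave n.+1 x.
have wave1 k : `|wave k x| <= 1 by rewrite ler_norml sin_geN1 sin_le1.
have cu : cvgn (series u).
  apply: normed_cvg; apply: nondecreasing_is_cvgn.
    by apply: nondecreasing_series => n _ _ /=; exact: normr_ge0.
  exists (decay 0) => _ [n _ <-]; rewrite /series /=.
  apply: (@le_trans _ _ (\sum_(0 <= k < n) (decay k - decay k.+1))).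
    apply: ler_sum => k _; rewrite /u normrM -[leRHS]mulr1.
    by rewrite ger0_norm ?subr_ge0 ?decayS// ler_wpM2l// subr_ge0 decayS.
  rewrite (eq_bigr (fun k => (- decay k.+1) - (- decay k))); last first.
    by move=> k _; rewrite opprK addrC.
  by rewrite (telescope_sumr (fun k => - decay k))// opprK addrC gerDl oppr_le0 decay_ge0.
have cw : (fun n => decay n * wave n x) @ \oo --> 0.
  apply: norm_cvg0.
  apply: (@squeeze_cvgr _ _ _ _ (fun=> 0) decay).
  - near=> n; rewrite normr_ge0 normrM ger0_norm ?decay_ge0//=.
    by rewrite ler_piMr ?decay_ge0.
  - exact: cvg_cst.
  - exact: cvg_decay.
have E : (ksum^~ x) = (fun n => (2 * sin (x / 2))^-1 *
   (decay n * wave n x - decay 0 * wave 0 x + series u n)).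
  apply/funext => n; rewrite /series /= -abel_summation mulKf//.
  by rewrite mulf_neq0.
rewrite E; apply: is_cvgMr; apply: is_cvgD => //; apply: is_cvgB.
  by apply/cvg_ex; exists 0.
exact: is_cvg_cst.
Unshelve. all: by end_near. Qed.

Lemma kterm_periodic k x : kterm k (x + 2 * pi) = kterm k x.
Proof.
rewrite /kterm; congr (_ * _); have := cis_periodic (k%:Z) x.
rewrite !pmulrn; move=> [h1 h2]; by rewrite !cosB h1 h2.
Qed.

Lemma F1_periodic x : F1 r (x + 2 * pi) = F1 r x.
Proof.
rewrite !F1E; suff -> : ksum^~ (x + 2 * pi) = ksum^~ x by [].
by apply/funext => n; apply: eq_bigr => k _; exact: kterm_periodic.
Qed.

Lemma measurable_kterm k : measurable_fun setT (kterm k : measurableTypeR R -> R).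
Proof.
apply: measurable_funM => //; apply: measurableT_comp.
  by apply: continuous_measurable_fun; exact: continuous_cos.
by apply: measurable_funB => //; exact: measurable_funM.
Qed.

Lemma measurable_ksum n : measurable_fun setT (ksum n : measurableTypeR R -> R).
Proof.
by apply: measurable_sum => k; exact: measurable_kterm.
Qed.

(** On the exceptional null set the series need not converge, but by
    periodicity the kernel is constant there, so that it is measurable everywhere. *)
Lemma F1_const_zero x : sin (x / 2) = 0 -> F1 r x = F1 r 0.
Proof.
move=> sx; rewrite !F1E; suff -> : ksum^~ x = ksum^~ 0 by [].
apply/funext => n.
have cx : cos x = 1.
  have := cos2Dsin2 (x / 2); rewrite sx expr0n addr0 => c2.
  by rewrite [x]splitr cosD sx mulr0 subr0 -expr2.
have sx' : sin x = 0 by rewrite [x]splitr sinD sx mulr0 mul0r addr0.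
have h k : cos (k%:R * x) = 1 /\ sin (k%:R * x) = 0.
  elim: k => [|k [IHc IHs]]; first by rewrite mul0r cos0 sin0.
  rewrite -natr1 mulrDl mul1r cosD sinD IHc IHs cx sx'.
  by split; ring.
apply: eq_bigr => k _; rewrite /kterm !cosB mulr0 cos0 sin0.
by have [-> ->] := h k.
Qed.

Lemma measurable_F1 : measurable_fun setT (F1 r : measurableTypeR R -> R).
Proof.
pose D : set (measurableTypeR R) := [set x : R | sin (x / 2) = 0].
have ms : measurable_fun setT (fun x : measurableTypeR R => sin (x / 2)).
  apply: (@measurableT_comp _ _ _ _ _ _ (sin : measurableTypeR R -> R)).
    by apply: continuous_measurable_fun; exact: continuous_sin.
  exact: measurable_funM.
have mD : measurable D.
  have := ms measurableT [set 0 : R]; rewrite setTI; apply; exact: measurable_set1.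
rewrite -(setUv D); apply/measurable_funU => //; first exact: measurableC.
split.
  apply: (@eq_measurable_fun _ _ _ _ D (fun=> F1 r 0)) => //.
  by move=> x /set_mem Dx; rewrite (F1_const_zero Dx).
apply: measurable_funD => //; apply: measurable_funM => //.
apply: (@measurable_fun_cvg _ _ _ _ ksum).
  by move=> m; apply: measurable_funTS; exact: measurable_ksum.
by move=> x /eqP Dx; exact: cvg_ksum.
Qed.

Lemma ksum_diff n m x : ksum (n + m) x - ksum n x = \sum_(i < m) kterm (n + i).+1 x.
Proof.
elim: m => [|m IH]; first by rewrite addn0 big_ord0 subrr.
by rewrite addnS ksumS big_ord_recr /= -IH addrAC.
Qed.

Lemma kterm_Re k x : kterm k x =
  complex.Re ((k%:R `^ (- r))%:C * cis (- theta) * cis ((k%:Z)%:~R * x)).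
Proof.
rewrite -mulrA -cisD complex_ReM /= mul0r subr0 /kterm; congr (_ * cos _).
by rewrite addrC.
Qed.

(** The difference is the real part of a trigonometric polynomial with
    coefficients of modulus k^-r, to which Parseval's identity applies. *)
Lemma integral_ksum_diff_sqr n m :
  (\int[leb]_(x in circle) ((ksum (n + m) x - ksum n x) ^+ 2)%:E <=
   (2 * pi * \sum_(i < m) ((n + i).+1%:R `^ (- r)) ^+ 2)%:E)%E.
Proof.
have einj : injective (fun i : 'I_m => (n + i).+1%:Z).
  by move=> i j [] /addnI ij; exact: ord_inj.
pose c (i : 'I_m) : R[i] := ((n + i).+1%:R `^ (- r))%:C * cis (- theta).
rewrite (_ : \sum_(i < m) _ = \sum_i normc (c i) ^+ 2); last first.
  apply: eq_bigr => i _.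
  by rewrite normcM normc_cis mulr1 normcR ger0_norm ?powR_ge0.
rewrite -(cint_trig_sqr c einj).
apply: ge0_le_integral => //.
- by move=> x _; rewrite lee_fin sqr_ge0.
- apply: measurable_funTS; apply/measurable_EFinP; apply: measurable_funX.
  by apply: measurable_funB; exact: measurable_ksum.
- apply: measurable_funTS; apply/measurable_EFinP; apply: measurable_funX.
  apply: measurable_normc; apply: cmfun_sum => i.
  by apply: cmfunM; [exact: cmfun_cst|exact: cmfun_cisM].
move=> x _; rewrite lee_fin ksum_diff -[leLHS]real_normK ?num_real// lerXn2r ?nnegrE ?normc_ge0//.
apply: le_trans (ler_Re_normc _).
rewrite (_ : complex.Re _ = \sum_(i < m) kterm (n + i).+1 x)//.
rewrite (big_morph _ (id1 := 0) (@complex_ReD R))//; apply: eq_bigr => i _.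
by rewrite kterm_Re.
Qed.

End kernel.

Section power_tail.
Context {R : realType} (r : R) (r2 : 2^-1 < r).

Let a (k : nat) : R := (k.+1%:R `^ (- r)) ^+ 2.

Let b := 2 * r - 1.
Let b0 : 0 < b. Proof. by rewrite subr_gt0 mulrC -ltr_pdivrMr// div1r. Qed.

(** Dyadic condensation: the 2^q terms from 2^q on are at most 2^(-2qr) each, and
    2^q 2^(-2qr) = (2^q)^(-(2r-1)) with 2r - 1 > 0. *)
Lemma sum_sqr_decay_pow2 q : \sum_(0 <= k < (2 ^ q).-1) a k <= geoC b.
Proof.
apply: (@le_trans _ _ (\sum_(j < q) (1 * 2 ^+ j) `^ (- b))); last first.
  have := @sum_geo_ge _ b 1 1 q b0 ltr01 ltr01; rewrite powR1 mulr1.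
  apply: le_trans; rewrite [leRHS]big_mkcond; apply: ler_sum => j _.
  by rewrite mul1r exprn_ege1 ?ler1n.
elim: q => [|q IH]; first by rewrite big_geq// big_ord0.
have q0 : (0 < 2 ^ q)%N by rewrite expn_gt0.
rewrite (@big_cat_nat _ _ _ (2 ^ q).-1)//=; last by rewrite expnS; lia.
rewrite big_ord_recr /= lerD// mul1r.
apply: (@le_trans _ _ (\sum_((2 ^ q).-1 <= k < (2 ^ q.+1).-1) ((2 ^+ q) `^ (- r)) ^+ 2)).
  rewrite big_nat_cond [leRHS]big_nat_cond.
  apply: ler_sum => k /andP[/andP[qk _] _].
  rewrite lerXn2r ?nnegrE ?powR_ge0// !powRN lef_pV2 ?posrE ?powR_gt0 ?exprn_gt0//.
  apply: ge0_ler_powR; rewrite ?nnegrE ?exprn_ge0//.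
    by apply: ltW; apply: lt_trans r2; rewrite invr_gt0.
  by rewrite -natrX ler_nat; lia.
rewrite sumr_const_nat.
have -> : ((2 ^ q.+1).-1 - (2 ^ q).-1)%N = (2 ^ q)%N by rewrite expnS; lia.
rewrite -[leLHS]mulr_natl natrX.
have : 0 < 2 ^+ q :> R by rewrite exprn_gt0.
move: (2 ^+ q : R) => p p0.
rewrite -[X in X * _](powRr1 (ltW p0)) -powR_mulrn ?powR_ge0// -powRrM.
rewrite -powRD; last by apply/implyP; rewrite (gt_eqF p0).
by rewrite le_eqVlt; apply/orP; left; apply/eqP; congr (_ `^ _); rewrite /b; ring.
Qed.

Lemma sqr_decay_tail e : 0 < e ->
  exists n, forall m, \sum_(i < m) ((n + i).+1%:R `^ (- r)) ^+ 2 <= e.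
Proof.
move=> e0; pose S := [set x | exists n, x = \sum_(0 <= k < n) a k].
have a0 k : 0 <= a k by rewrite sqr_ge0.
have hS : has_sup S.
  split; first by exists 0; exists 0%N; rewrite big_geq.
  exists (geoC b) => _ [n ->]; apply: le_trans (sum_sqr_decay_pow2 n).
  have nn : (n <= (2 ^ n).-1)%N by rewrite -ltnS prednK ?expn_gt0// ltn_expl.
  by rewrite [leRHS](@big_cat_nat _ _ _ n)//= lerDl sumr_ge0.
have [_ [n ->] hn] := sup_adherent e0 hS; exists n => m.
have : \sum_(0 <= k < n + m) a k <= sup S by apply: ub_le_sup; [case: hS|exists (n + m)%N].
rewrite (@big_cat_nat _ _ _ n)//= ?leq_addr// -{2}[n]add0n big_addn addKn.
rewrite [X in _ + X <= _]big_mkord -lerBrDl => h.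
apply: (@le_trans _ _ (sup S - \sum_(0 <= k < n) a k)).
  by under eq_bigr do rewrite addnC; exact: h.
by rewrite lerBlDr addrC -lerBlDr ltW.
Qed.

End power_tail.


Section kernel_mean.
Context {R : realType} (r : R) (r2 : 2^-1 < r).
Local Notation leb := (@lebesgue_measure R).
Local Notation circle := (`[0, 2 * pi]%classic : set (measurableTypeR R)).
Local Notation theta := (r * pi / 2).

Let r0 : 0 < r. Proof. by apply: lt_trans r2; rewrite invr_gt0. Qed.

Definition klim (x : R) : R := limn (ksum r ^~ x).

(** Fatou's lemma, on the open period where the series converges. *)
Lemma integral_ksum_lim_sqr n e :
  (forall m, \sum_(i < m) ((n + i).+1%:R `^ (- r)) ^+ 2 <= e) ->
  (\int[leb]_(x in circle) ((klim x - ksum r n x) ^+ 2)%:E <= (2 * pi * e)%:E)%E.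
Proof.
move=> he; pose f m (x : measurableTypeR R) := ((ksum r (n + m) x - ksum r n x) ^+ 2)%:E.
have mf m D : measurable_fun D (f m).
  apply: measurable_funTS; apply/measurable_EFinP; apply: measurable_funX.
  by apply: measurable_funB; exact: measurable_ksum.
have mlim : measurable_fun setT (klim : measurableTypeR R -> R).
  rewrite (_ : klim = fun x => 2^-1 * (F1 r x - 1)).
    apply: measurable_funM => //; apply: measurable_funB => //; exact: measurable_F1.
  by apply/funext => x; rewrite F1E /klim addrAC subrr add0r mulKf.
have mlim2 D : measurable_fun D (fun x : measurableTypeR R => ((klim x - ksum r n x) ^+ 2)%:E).
  apply: measurable_funTS; apply/measurable_EFinP; apply: measurable_funX.
  by apply: measurable_funB => //; exact: measurable_ksum.
rewrite (integral_itv_bndoo true false); last exact: mlim2.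
apply: (@le_trans _ _ (\int[leb]_(x in `]0%R, (2 * pi)%R[) limn_einf (f ^~ x))%E).
  rewrite le_eqVlt; apply/orP; left; apply/eqP; apply: eq_integral => x /set_mem /=; rewrite in_itv /= => /andP[x0 xpi].
  have cf : f ^~ x @ \oo --> ((klim x - ksum r n x) ^+ 2)%:E.
    have ck : cvgn (ksum r ^~ x).
      apply: cvg_ksum => //; apply: lt0r_neq0; apply: sin_gt0_pi.
      by rewrite divr_gt0//= ltr_pdivrMr// mulrC.
    apply: cvg_EFin; first by near=> m.
    have cs : ksum r (n + m) x @[m --> \oo] --> klim x.
      have -> : (fun m => ksum r (n + m) x) = [sequence ksum r (m + n)%N x]_m.
        by apply/funext => m; rewrite /= addnC.
      by rewrite (cvg_shiftn n (ksum r ^~ x)).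
    have cd : ksum r (n + m) x - ksum r n x @[m --> \oo] --> klim x - ksum r n x.
      by apply: cvgB => //; exact: cvg_cst.
    rewrite expr2 (_ : fine \o _ = fun m =>
      (ksum r (n + m) x - ksum r n x) * (ksum r (n + m) x - ksum r n x)).
      exact: cvgM.
    by apply/funext => m; rewrite /= expr2.
  rewrite is_cvg_limn_einfE; last by apply/cvg_ex; eexists; exact: cf.
  by apply/esym/cvg_lim.
apply: (le_trans (fatou _ _ _ _)) => //.
  by move=> m x _; rewrite lee_fin sqr_ge0.
rewrite limn_einf_lim; apply: lime_le; first exact: is_cvg_einfs.
near=> m; apply: (@le_trans _ _ (\int[leb]_(x in `]0%R, (2 * pi)%R[) f m x)%E).
  by apply: ereal_inf_lbound; exists m => /=.
rewrite -(@integral_itv_bndoo _ _ _ _ true false); last exact: mf.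
have := integral_ksum_diff_sqr r n m; rewrite -/(f m) => h; apply: (le_trans h); rewrite lee_fin.
by rewrite ler_wpM2l// ltW// twopi_gt0.
Unshelve. all: by end_near. Qed.

(** From L_2 to L_1 by 2|u| <= h + u^2/h. *)
Lemma kernel_mean_approx e : 0 < e -> exists n,
  (\int[leb]_(x in circle) (`|F1 r x - (1 + 2 * ksum r n x)|)%:E <= e%:E)%E.
Proof.
(* The two terms of h + u^2/h integrate to 2 pi h each. *)
move=> e0; pose h := e / (2 * (2 * pi)) : R.
have p0 : 0 < 2 * pi :> R by exact: twopi_gt0.
have h0 : 0 < h by rewrite divr_gt0// mulr_gt0.
have [n hn] := sqr_decay_tail r2 (exprn_gt0 2 h0); exists n.
have := integral_ksum_lim_sqr hn; set I := (\int[_]_(_ in _) _)%E => hI.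
have mk : measurable_fun setT (fun x : measurableTypeR R => klim x - ksum r n x).
  apply: measurable_funB; last exact: measurable_ksum.
  rewrite (_ : klim = fun x => 2^-1 * (F1 r x - 1)).
    apply: measurable_funM => //; apply: measurable_funB => //; exact: measurable_F1.
  by apply/funext => x; rewrite F1E /klim addrAC subrr add0r mulKf.
have mk2 : measurable_fun circle (fun x : measurableTypeR R => ((klim x - ksum r n x) ^+ 2)%:E).
  by apply: measurable_funTS; apply/measurable_EFinP; exact: measurable_funX.
have mc := @measurable_circle R.
apply: (@le_trans _ _ (\int[leb]_(x in circle) (h%:E + h^-1%:E * ((klim x - ksum r n x) ^+ 2)%:E))%E).
  apply: ge0_le_integral => //.
  - apply: measurable_funTS; apply/measurable_EFinP; apply: measurableT_comp => //.
    rewrite (_ : (fun x => _) = fun x => 2 * (klim x - ksum r n x)).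
      exact: measurable_funM.
    by apply/funext => x; rewrite F1E /klim; ring.
  - by apply: emeasurable_funD => //; exact: measurable_funeM.
  move=> x _; rewrite -EFinM -EFinD lee_fin.
  have -> : F1 r x - (1 + 2 * ksum r n x) = 2 * (klim x - ksum r n x).
    by rewrite F1E /klim; ring.
  move: (klim x - _) => u; rewrite normrM (ger0_norm (ler0n _ 2)).
  rewrite -(real_normK (num_real u)); move: (`|u|) => v.
  rewrite -subr_ge0 (_ : _ - _ = h^-1 * (h - v) ^+ 2).
    by rewrite mulr_ge0 ?sqr_ge0// invr_ge0 ltW.
  by field; rewrite gt_eqF.
rewrite ge0_integralD//; last 3 first.
- by move=> x _; rewrite lee_fin ltW.
- by move=> x _; rewrite -EFinM lee_fin mulr_ge0 ?sqr_ge0// invr_ge0 ltW.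
- exact: measurable_funeM.
rewrite ge0_integralZl//; last 2 first.
- by move=> x _; rewrite lee_fin sqr_ge0.
- by rewrite lee_fin invr_ge0 ltW.
rewrite integral_cst//.
rewrite [X in (_ * X + _)%E](_ : _ = (2 * pi)%:E); last exact: lebesgue_circle.
apply: (@le_trans _ _ (h%:E * (2 * pi)%:E + h^-1%:E * (2 * pi * h ^+ 2)%:E)%E).
  by rewrite leeD2l// lee_pmul2l// lte_fin invr_gt0.
rewrite -!EFinM -EFinD lee_fin le_eqVlt; apply/orP; left; apply/eqP.
rewrite /h; move: p0; move: (2 * pi : R) => p p0.
by field; rewrite !gt_eqF.
Qed.

Lemma kernel_partial_sum n x : (1 + 2 * ksum r n x)%:C =
  cis (0%:~R * x) + \sum_(1 <= k < n.+1)
    ((k%:R `^ (- r))%:C * cis (- theta) * cis (k%:Z%:~R * x) +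
     (k%:R `^ (- r))%:C * cis theta * cis ((- k%:Z)%:~R * x)) :> R[i].
Proof.
rewrite mul0r cis0 rmorphD /= rmorph1; congr (_ + _).
rewrite /ksum mulr_sumr realC_sum; apply: eq_bigr => k _.
rewrite /kterm -!mulrA -!cisD -mulrDr mulrCA realCM; congr (_ * _).
rewrite mulrNz mulNr addrC /cis -pmulrn.
move: (k%:R * x) (r * (pi / 2)) => y z.
have -> : z - y = - (- z + y) by rewrite opprD opprK.
rewrite cosN sinN; move: (cos _) (sin _) => c s.
by congr Complex => /=; ring.
Qed.

Lemma cintegrable_kernel_partial_sum n :
  cintegrable leb circle (fun x => (1 + 2 * ksum r n x)%:C : R[i]).
Proof.
rewrite (_ : (fun x => _) = (fun x => cis (0%:~R * x) + \sum_(1 <= k < n.+1)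
    ((k%:R `^ (- r))%:C * cis (- theta) * cis (k%:Z%:~R * x) +
     (k%:R `^ (- r))%:C * cis theta * cis ((- k%:Z)%:~R * x)))); last first.
  by apply/funext => x; exact: kernel_partial_sum.
have mc := @measurable_circle R.
apply: cintegrableD => //; first exact: cintegrable_cisM.
apply: cintegrable_sum => // k.
by apply: cintegrableD => //; apply: cintegrableZ => //; exact: cintegrable_cisM.
Qed.

(** At most one character of the partial sum has frequency l, and its coefficient has
    modulus 1 for l = 0 and |l|^-r otherwise. *)
Lemma cint_kernel_partial_sum n (l : int) :
  normc (cint leb circle (fun x => (1 + 2 * ksum r n x)%:C * cis (- (l%:~R * x)))) <=
  2 * pi * (maxn 1 `|l|%N)%:R `^ (- r).
Proof.
have mc := @measurable_circle R.
have shift (m : int) (x : R) : cis (m%:~R * x) * cis (- (l%:~R * x)) = cis ((m - l)%:~R * x).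
  by rewrite -cisD intrB mulrBl.
rewrite (_ : (fun x => _) = (fun x => cis ((0 - l)%:~R * x) + \sum_(1 <= k < n.+1)
    ((k%:R `^ (- r))%:C * cis (- theta) * cis ((k%:Z - l)%:~R * x) +
     (k%:R `^ (- r))%:C * cis theta * cis ((- k%:Z - l)%:~R * x)))); last first.
  apply/funext => x; rewrite kernel_partial_sum mulrDl shift; congr (_ + _).
  by rewrite mulr_suml; apply: eq_bigr => k _; rewrite mulrDl -!mulrA !shift.
rewrite cintD//; last 2 first.
- exact: cintegrable_cisM.
- apply: cintegrable_sum => // k.
  by apply: cintegrableD => //; apply: cintegrableZ => //; exact: cintegrable_cisM.
rewrite cint_sum//; last first.
  by move=> k; apply: cintegrableD => //; apply: cintegrableZ => //; exact: cintegrable_cisM.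
have p0 : 0 <= 2 * pi :> R by rewrite ltW// twopi_gt0.
have q0 : `|2 * pi| = 2 * pi :> R by rewrite ger0_norm.
apply: (@le_trans _ _ (2 * pi * ((l == 0)%:R + \sum_(1 <= k < n.+1 | k == `|l|%N) k%:R `^ (- r)))).
  rewrite [leRHS]mulrDr; apply: le_trans (ler_normcD _ _) _; apply: lerD.
    rewrite cint_cis sub0r oppr_eq0; case: eqP => _.
      by rewrite normcR q0 mulr1.
    by rewrite normc0 mulr0.
  rewrite mulr_sumr [leRHS]big_mkcond /= big_nat_cond [leRHS]big_nat_cond.
  elim/big_ind2 : _ => //.
  - by rewrite normc0.
  - move=> x1 x2 y1 y2 h1 h2; apply: le_trans (ler_normcD _ _) _; exact: lerD.
  move=> k; rewrite andbT => /andP[k0 _].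
  have ci := fun m => cintegrable_cisM (m%:~R : R).
  rewrite cintD//; try by apply: cintegrableZ.
  rewrite !cintZ// !cint_cis.
  have cnorm (t : R) : normc ((k%:R `^ (- r))%:C * cis t * (2 * pi)%:C) =
      2 * pi * k%:R `^ (- r).
    by rewrite !normcM normc_cis mulr1 !normcR q0 ger0_norm ?powR_ge0// mulrC.
  have [kl|kl] := eqVneq k `|l|%N.
    have [->|->] : l = k%:Z \/ l = - k%:Z by lia.
      rewrite subrr eqxx ifF ?mulr0 ?addr0 ?cnorm//; apply/negbTE; lia.
    rewrite subrr eqxx ifF ?mulr0 ?add0r ?cnorm//; apply/negbTE; lia.
  by rewrite !ifF ?mulr0 ?addr0 ?normc0//; apply/negbTE; lia.
rewrite ler_wpM2l// big_nat1_eq; have [->|l0] := eqVneq l 0.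
  by rewrite /= addr0 powR1.
rewrite add0r (maxn_idPr _) ?absz_gt0//; case: ifP => // _; exact: powR_ge0.
Qed.

Lemma cintegrable_kernel : cintegrable leb circle (fun x => (F1 r x)%:C : R[i]).
Proof.
have mc := @measurable_circle R.
have [n hn] := kernel_mean_approx ltr01.
rewrite (_ : (fun x => _) = (fun x => (F1 r x - (1 + 2 * ksum r n x))%:C +
   (1 + 2 * ksum r n x)%:C)); last by apply/funext => x; rewrite -rmorphD subrK.
apply: cintegrableD => //; last exact: cintegrable_kernel_partial_sum.
split.
  apply: cmfunR; apply: measurable_funB; first exact: measurable_F1.
  apply: measurable_funD => //; apply: measurable_funM => //; exact: measurable_ksum.
apply: le_lt_trans (ltry 1); apply: le_trans hn.
rewrite le_eqVlt; apply/orP; left; apply/eqP.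
by apply: eq_integral => x _; rewrite normcR.
Qed.

(** The coefficients of the partial sums obey the bound and converge to those of
    the kernel, by approximation in L_1. *)
Lemma cint_kernel_le (l : int) :
  normc (cint leb circle (fun x => (F1 r x)%:C * cis (- (l%:~R * x)))) <=
  2 * pi * (maxn 1 `|l|%N)%:R `^ (- r).
Proof.
have mc := @measurable_circle R.
apply/ler_addgt0Pr => e e0; have [n hn] := kernel_mean_approx (divr_gt0 e0 (ltr0n R 2)).
have iM (h : measurableTypeR R -> R[i]) : cintegrable leb circle h ->
  cintegrable leb circle (fun x => h x * cis (- (l%:~R * x))).
  move=> ih; apply: (@cintegrableM _ _ _ leb circle mc h _ 1) => //.
    by under eq_fun do rewrite -mulNr; exact: cmfun_cisM.
  by move=> x _; rewrite normc_cis.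
have iS := cintegrable_kernel_partial_sum n.
have -> : cint leb circle (fun x => (F1 r x)%:C * cis (- (l%:~R * x))) =
  cint leb circle (fun x => (1 + 2 * ksum r n x)%:C * cis (- (l%:~R * x))) +
  (cint leb circle (fun x => (F1 r x)%:C * cis (- (l%:~R * x)) -
      (1 + 2 * ksum r n x)%:C * cis (- (l%:~R * x)))).
  rewrite cintB//; try apply: iM => //; last exact: cintegrable_kernel.
  by rewrite addrC subrK.
apply: le_trans (ler_normcD _ _) _; apply: lerD; first exact: cint_kernel_partial_sum.
set g := (g in cint leb circle g).
have mg : cmfun g.
  by apply: cmfunD; [|apply: cmfunN]; apply: (iM _ _).1 => //; exact: cintegrable_kernel.
have := cint_norm_le leb mc mg; rewrite -lee_fin => h; apply: (le_trans h).
apply: (@le_trans _ _ (2%:E * (e / 2)%:E)%E); last by rewrite -EFinM mulrC divfK.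
rewrite lee_pmul2l//; apply: le_trans hn.
rewrite le_eqVlt; apply/orP; left; apply/eqP.
by apply: eq_integral => x _; rewrite /g -mulrBl normcM normc_cis mulr1 -rmorphB normcR.
Qed.

End kernel_mean.

(** * The multivariate kernel and convolution *)

Section torus_kernel.
Context {R : realType} (r : R) (r2 : 2^-1 < r).
Local Notation leb := (@lebesgue_measure R).
Local Notation mu := (@lebesgue_pts R).
Local Notation circle := (`[0, 2 * pi]%classic : set (measurableTypeR R)).

Lemma realC_prod (I : finType) (f : I -> R) : (\prod_i f i)%:C = \prod_i (f i)%:C :> R[i].
Proof. by elim/big_rec2: _ => // i x y _ <-; rewrite realCM. Qed.

Lemma cintegrable_Fd n : cintegrable (mu n) torus (fun x => (Fd r x)%:C : R[i]).
Proof.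
have [+ _] := @cint_torus_prod R n (fun _ a => (F1 r a)%:C) (fun _ => cintegrable_kernel r2).
by under eq_fun do rewrite -realC_prod.
Qed.

Lemma Fd_periodic n : tperiodic (@Fd R n r).
Proof.
move=> x j; apply: eq_bigr => i _; rewrite tnth_mktuple.
by case: eqP => _; rewrite ?addr0// F1_periodic.
Qed.

Lemma two_pow_level_le (k : int) : (2 ^ level k <= 2 * maxn 1 `|k|)%N.
Proof.
have := levelP (level k) k; rewrite eqxx => /andP[+ _].
case: (level k) => [|s]; first by lia.
by rewrite expnS mulKn//; lia.
Qed.

(** Within one dyadic level |k| varies by a factor 2, whence the constant 2^r. *)
Lemma frequency_powR_le (k : int) :
  (maxn 1 `|k|%N)%:R `^ (- r) <= 2 `^ r * (2 ^+ level k) `^ (- r).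
Proof.
have r0 : 0 < r by apply: lt_trans r2; rewrite invr_gt0.
rewrite !powRN ler_pdivlMr ?powR_gt0 ?exprn_gt0//.
rewrite ler_pdivrMl ?powR_gt0 ?ltr0n ?leq_max//.
rewrite mulrC -powRM//; apply: (ge0_ler_powR (ltW r0)); rewrite ?nnegrE ?mulr_ge0 ?exprn_ge0//.
by rewrite -natrX -natrM ler_nat two_pow_level_le.
Qed.

Lemma normc_torus_coef_Fd_le n (k : n.-tuple int) :
  normc (torus_coef (fun x => (Fd r x)%:C) k) <=
  ((2 * pi) * 2 `^ r) ^+ n * (2 ^+ tlevel k) `^ (- r).
Proof.
have p0 : 0 <= 2 * pi :> R by rewrite ltW// twopi_gt0.
pose F (i : 'I_n) a : R[i] := (F1 r a)%:C * cis (- ((tnth k i)%:~R * a)).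
have iF i : cintegrable leb circle (F i).
  apply: (@cintegrableM _ _ _ leb circle (@measurable_circle R) _ _ 1 (cintegrable_kernel r2)).
    by rewrite (_ : (fun x => _) = (fun x => cis ((- (tnth k i)%:~R) * x)));
      [exact: cmfun_cisM|apply/funext => x; rewrite mulNr].
  by move=> x _; rewrite normc_cis.
have [_] := cint_torus_prod iF.
rewrite (_ : (fun x => \prod_i F i (tnth x i)) =
    (fun x => (Fd r x)%:C * cis (- dotp k x))); last first.
  by apply/funext => x; rewrite big_split /= -realC_prod -cis_sum sumrN.
rewrite -/(torus_coef _ k) => ->; rewrite normc_prod.
apply: (@le_trans _ _ (\prod_(i < n) ((2 * pi * 2 `^ r) * (2 ^+ level (tnth k i)) `^ (- r)))).
  apply: ler_prod => i _; rewrite normc_ge0 /=.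
  apply: le_trans (cint_kernel_le r2 (tnth k i)) _.
  by rewrite -[leRHS]mulrA ler_wpM2l// frequency_powR_le.
rewrite big_split /= prodr_const card_ord powR_prod; last by move=> i; rewrite exprn_ge0.
by rewrite prodrXr.
Qed.

End torus_kernel.

Section sections_of_integrable.
Context {R : realType} d1 d2 (T1 : measurableType d1) (T2 : measurableType d2).
Context (m1 : {sigma_finite_measure set T1 -> \bar R}).
Context (m2 : {sigma_finite_measure set T2 -> \bar R}).
Context (D1 : set T1) (D2 : set T2) (mD1 : measurable D1) (mD2 : measurable D2).
Context (h : T1 * T2 -> R[i]) (ih : cintegrable (m1 \x m2)%E (D1 `*` D2) h).

Let mnh : measurable_fun setT (fun z => (normc (h z))%:E : \bar R).
Proof. by apply/measurable_EFinP; apply: measurable_normc; exact: ih.1. Qed.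

Let nh0 z : (0 <= (normc (h z))%:E :> \bar R)%E.
Proof. by rewrite lee_fin normc_ge0. Qed.

Let I (x : T1) := (\int[m2]_(y in D2) (normc (h (x, y)))%:E)%E.

Let mI : measurable_fun setT I.
Proof. exact: (@measurable_section_integral R _ _ _ _ m2 D2 mD2 _ mnh nh0). Qed.

Let I_lty : (\int[m1]_(x in D1) I x < +oo)%E.
Proof. by have := ih.2; rewrite tonelli_setX1. Qed.

Lemma cmfun_section1 x : cmfun (fun y => h (x, y)).
Proof. exact: (cmfun_comp ih.1 (measurable_pair1 x)). Qed.

(** The integral of the modulus over the section is itself integrable, hence
    almost everywhere finite. *)
Lemma ae_cintegrable_section1 :
  {ae m1, forall x, D1 x -> cintegrable m2 D2 (fun y => h (x, y))}.
Proof.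
have I0 x : (0 <= I x)%E by apply: integral_ge0 => y _.
have iI : m1.-integrable D1 I.
  apply/integrableP; split; first exact: measurable_funTS.
  by under eq_integral do rewrite gee0_abs//.
apply: filterS (integrable_ae mD1 iI) => x hx Dx; split; first exact: cmfun_section1.
by have := hx Dx; rewrite ge0_fin_numE.
Qed.

Lemma cintegrable_section_cint : cintegrable m1 D1 (fun x => cint m2 D2 (fun y => h (x, y))).
Proof.
have mh := @cmfun_section R _ _ _ _ m2 D2 mD2 _ ih.1.
split=> //; apply: (@le_lt_trans _ _ (\int[m1]_(x in D1) (2%:E * I x))%E).
  apply: ge0_le_integral => //.
  - by move=> x _; rewrite lee_fin normc_ge0.
  - exact: measurable_EFin_normc.
  - by apply: measurable_funeM; exact: measurable_funTS.
  - by move=> x _; apply: (cint_norm_le m2 mD2); exact: cmfun_section1.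
rewrite ge0_integralZl//; last 2 first.
- exact: measurable_funTS.
- by move=> x _; apply: integral_ge0.
by rewrite lte_mul_pinfty.
Qed.

End sections_of_integrable.

Section convolution.
Context {R : realType} {n : nat}.
Local Notation mu := (@lebesgue_pts R).
Context (phi : pts R n -> R[i]) (F : pts R n -> R).
Context (iphi : cintegrable (mu n) torus phi).
Context (iF : cintegrable (mu n) torus (fun x => (F x)%:C)) (pF : tperiodic F).

Let H (z : pts R n * pts R n) : R[i] := phi z.2 * (F (sub_pt z.1 z.2))%:C.

Let mT : measurable (@torus R n). Proof. exact: measurable_torus. Qed.
Let mTT : measurable (@torus R n `*` @torus R n). Proof. exact: measurableX. Qed.

Definition opp_pt (y : pts R n) : pts R n := [tuple (- (tnth y i : R) : R) | i < n].

Lemma sub_ptE (x y : pts R n) : sub_pt x y = add_pt x (opp_pt y).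
Proof. by apply: eq_from_tnth => i; rewrite !tnth_mktuple. Qed.

Lemma measurable_sub_pt :
  measurable_fun setT (fun z : pts R n * pts R n => sub_pt z.1 z.2).
Proof.
apply/measurable_fun_tnthP => i.
rewrite (_ : _ \o _ = fun z : pts R n * pts R n => (tnth z.1 i : R) - (tnth z.2 i : R)).
  by apply: measurable_funB; apply: measurableT_comp (measurable_tnth i) _.
by apply/funext => z /=; rewrite tnth_mktuple.
Qed.

Lemma cmfun_conv_kernel : cmfun H.
Proof.
apply: cmfunM.
  exact: (cmfun_comp iphi.1 measurable_snd).
exact: (cmfun_comp iF.1 measurable_sub_pt).
Qed.

(** Integrate in x first: by translation invariance the inner integral of |F(x - y)|
    is a constant. *)
Lemma cintegrable_conv_kernel : cintegrable (mu n \x mu n)%E (torus `*` torus) H.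
Proof.
split; first exact: cmfun_conv_kernel.
rewrite tonelli_setX2//; last 2 first.
- by apply/measurable_EFinP; apply: measurable_normc; exact: cmfun_conv_kernel.
- by move=> z; rewrite lee_fin normc_ge0.
set A := (\int[mu n]_(x in torus) (normc ((F x)%:C : R[i]))%:E)%E.
have A0 : (0 <= A)%E by apply: integral_ge0 => x _; rewrite lee_fin normc_ge0.
have Afin : A \is a fin_num by rewrite ge0_fin_numE//; exact: iF.2.
rewrite (_ : (\int[mu n]_(y in torus) _ = \int[mu n]_(y in torus) ((normc (phi y))%:E * A))%E); last first.
  apply: eq_integral => y _.
  have := @ge0_integral_torus_shift R n (opp_pt y) (fun x => (normc ((F x)%:C : R[i]))%:E).
  rewrite -/A => <-; last 3 first.
  - by apply/measurable_EFinP; apply: measurable_normc; exact: iF.1.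
  - by move=> x; rewrite lee_fin normc_ge0.
  - by move=> x j; rewrite pF.
  rewrite -ge0_integralZl_EFin ?normc_ge0//; last 2 first.
  - by move=> x _; rewrite lee_fin normc_ge0.
  - apply: measurable_EFin_normc; exact: (cmfun_comp iF.1 (measurable_add_pt (opp_pt y))).
  by apply: eq_integral => x _; rewrite /H normcM EFinM sub_ptE.
rewrite -(fineK Afin) ge0_integralZr//; last 3 first.
- by apply: measurable_EFin_normc; exact: iphi.1.
- by move=> a _; rewrite lee_fin normc_ge0.
- by rewrite lee_fin fine_ge0.
by rewrite muleC lte_mul_pinfty ?lee_fin ?fine_ge0//; exact: iphi.2.
Qed.

Lemma convE x : Defs.conv phi F x = ((2 * pi) ^- n)%:C * cint (mu n) torus (fun y => H (x, y)).
Proof. by []. Qed.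

Lemma conv_sectionE : Defs.conv phi F =
  (fun x => ((2 * pi) ^- n)%:C * cint (mu n) torus (fun y => H (x, y))).
Proof. by apply/funext => x; exact: convE. Qed.

Lemma cintegrable_conv : cintegrable (mu n) torus (Defs.conv phi F).
Proof.
rewrite conv_sectionE; apply: cintegrableZ => //.
exact: (cintegrable_section_cint mT mT cintegrable_conv_kernel).
Qed.

Lemma dotp_add (k : n.-tuple int) (x t : pts R n) :
  dotp k (add_pt x t) = dotp k x + dotp k t.
Proof.
by rewrite /dotp -big_split; apply: eq_bigr => i _ /=; rewrite tnth_mktuple mulrDr.
Qed.

(** Fubini's theorem and the translation x = (x - y) + y, which factors the
    character.  Moving the character into the inner integral needs integrable
    sections, so that step holds almost everywhere only. *)
Lemma torus_coef_conv k : torus_coef (Defs.conv phi F) k =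
  ((2 * pi) ^- n)%:C * (torus_coef phi k * torus_coef (fun x => (F x)%:C) k).
Proof.
pose G x : R[i] := (F x)%:C * cis (- dotp k x).
have iG : cintegrable (mu n) torus G by exact: cintegrable_mul_character.
have pG : tperiodic G.
  move=> x i; rewrite /G pF dotp_shift opprD cisD -mulNr -mulrNz cis_int2pi mulr1.
  by [].
pose Hk z : R[i] := H z * cis (- dotp k z.1).
have mk : cmfun (fun z : pts R n * pts R n => cis (- dotp k z.1) : R[i]).
  exact: (cmfun_comp (cmfun_character k) measurable_fst).
have iHk : cintegrable (mu n \x mu n)%E (torus `*` torus) Hk.
  apply: (cintegrableM mTT (M := 1) cintegrable_conv_kernel mk).
  by move=> z _; rewrite normc_cis.
transitivity (((2 * pi) ^- n)%:C * cint (mu n) torus (fun x => cint (mu n) torus (fun y => Hk (x, y)))).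
  have iS := cintegrable_section_cint mT mT iHk.
  rewrite -cintZ//; apply: ae_eq_cint => //.
  - by apply: cmfunM; [exact: cintegrable_conv.1|exact: cmfun_character].
  - by apply: cmfunM; [exact: cmfun_cst|exact: iS.1].
  apply: filterS (ae_cintegrable_section1 mT mT cintegrable_conv_kernel) => x hx Tx.
  rewrite convE -mulrA; congr (_ * _).
  rewrite mulrC -cintZ//; last exact: hx.
  by apply: eq_cint => y _; rewrite /Hk mulrC.
rewrite -cint_fubini1// cint_fubini2//; congr (_ * _).
rewrite [RHS]mulrC -/(cint _ _ G) -cintZ//; last exact: cintegrable_mul_character.
apply: eq_cint => y _.
rewrite (_ : torus_coef _ k = cint (mu n) torus G)//.
rewrite -(cint_torus_shift (opp_pt y) iG.1 pG) [RHS]mulrC -cintZ//; last first.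
  split; first exact: (cmfun_comp iG.1 (measurable_add_pt (opp_pt y))).
  rewrite (@ge0_integral_torus_shift R n (opp_pt y) (fun x => (normc (G x))%:E)).
  - exact: iG.2.
  - by apply/measurable_EFinP; apply: measurable_normc; exact: iG.1.
  - by move=> x; rewrite lee_fin normc_ge0.
  - by move=> x j; rewrite pG.
apply: eq_cint => x _; rewrite /Hk /H /G -sub_ptE /=.
have -> : dotp k x = dotp k (sub_pt x y) + dotp k y.
  rewrite -dotp_add; congr dotp; apply: eq_from_tnth => i.
  by rewrite !tnth_mktuple subrK.
rewrite opprD cisD; move: (cis _) (cis _) => u v.
ring.
Qed.

End convolution.

(** * The class of convolutions *)

Section W_embedding.
Context {R : realType}.
Local Notation mu := (@lebesgue_pts R).

(** The identity f = phi * F_r holds almost everywhere, which is enough for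
    integrability and for the coefficients. *)
Lemma Wclass_fourier_le d (q r : R) (f : pts R d -> R[i]) : 1 <= q -> 2^-1 < r ->
  Wclass d r q f ->
  cintegrable (mu d) torus f /\ exists phi : pts R d -> R[i],
    [/\ Lq q phi, (lqnorm q phi <= 1)%E &
    forall k, normc (fourier f k) <=
      (2 * pi) ^- d * (2 `^ r) ^+ d * (2 ^+ tlevel k) `^ (- r) * normc (torus_coef phi k)].
Proof.
move=> q1 r2 [pf mf [phi [Lphi phi1 fconv]]].
have mT := @measurable_torus R d.
have iphi := Lq_cintegrable q1 Lphi.
have iF := cintegrable_Fd r2 d; have pF := @Fd_periodic R r d.
have ic := cintegrable_conv iphi iF pF.
have fE : {ae mu d, forall x, torus x -> f x = Defs.conv phi (Fd r) x}.
  by apply: filterS fconv => x ->.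
split.
  split; first exact: mf.
  rewrite (_ : (\int[_]_(x in _) _ = \int[mu d]_(x in torus) (normc (Defs.conv phi (Fd r) x))%:E)%E).
    exact: ic.2.
  apply: ge0_ae_eq_integral => //.
  - exact: measurable_EFin_normc.
  - by apply: measurable_EFin_normc; exact: ic.1.
  - by move=> x _; rewrite lee_fin normc_ge0.
  - by move=> x _; rewrite lee_fin normc_ge0.
  - by apply: filterS fE => x h Tx; rewrite h.
exists phi; split => // k.
have P0 : 0 < (2 * pi) ^+ d :> R by rewrite exprn_gt0// twopi_gt0.
have coefE : torus_coef f k = torus_coef (Defs.conv phi (Fd r)) k.
  apply: ae_eq_cint => //.
  - by apply: cmfunM; [exact: mf|exact: cmfun_character].
  - by apply: cmfunM; [exact: ic.1|exact: cmfun_character].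
  by apply: filterS fE => x h Tx; rewrite h.
rewrite fourierE coefE (torus_coef_conv iphi iF pF) !normcM !normcR.
rewrite ger0_norm ?invr_ge0 ?(ltW P0)//.
rewrite -!mulrA ler_pM2l ?invr_gt0//.
rewrite (mulrC (normc (torus_coef phi k))) !mulrA ler_wpM2r ?normc_ge0//.
rewrite mulrC -ler_pdivlMr ?invr_gt0// invrK.
apply: le_trans (normc_torus_coef_Fd_le r2 k) _.
by rewrite exprMn [leRHS]mulrC [leRHS]mulrA lexx.
Qed.

(** The kernel bound, the constant of block_bound, the passage from (j+1)^d to j^d
    and the normalization of the norm. *)
Definition constW d (q r : R) : R :=
  (2 * pi) ^- d.+1 * (2 `^ r) ^+ d.+1 *
  ((paleyC q ^+ d.+1 + 1) * (2 ^+ d) `^ (1 - q^-1) * ((2 * pi) ^+ d.+1) `^ q^-1).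

(** All the frequencies of the block are treated at once, so that the number J of
    rectangles enters Hoelder's inequality with the exponent 1 - 1/q only. *)
Lemma W_embeds d (q r : R) : 1 < q <= 2 -> q^-1 < r ->
  embeds (Wclass d.+1 r q) (WAclass d.+1 (r - q^-1) (1 - q^-1)).
Proof.
move=> q12 qr; have /andP[q1 q2] := q12.
have q0 : 0 < q by rewrite (lt_trans ltr01).
have r2 : 2^-1 < r by apply: le_lt_trans qr; rewrite lef_pV2 ?posrE.
have P0 : 0 < (2 * pi) ^+ d.+1 :> R by rewrite exprn_gt0// twopi_gt0.
have paley0 : 0 <= paleyC q ^+ d.+1 by rewrite exprn_ge0// ltW// paleyC_gt0// (ltW q1).
have b0 : 0 <= 1 - q^-1 by rewrite subr_ge0 invf_le1// ltW.
have C0 : 0 < constW d q r.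
  rewrite /constW !mulr_gt0 ?invr_gt0 ?exprn_gt0 ?powR_gt0 ?exprn_gt0 ?twopi_gt0//.
  by rewrite ltr_wpDl.
exists (constW d q r) => // f Wf.
have [fi [phi [Lphi phi1 fourier_le]]] := Wclass_fourier_le (ltW q1) r2 Wf.
apply: WAclass_of_block_sums => //; first by case: Wf.
move=> j X j0 uX Xj; pose J : R := j.+1%:R ^+ d.
have J0 : 0 < J by rewrite exprn_gt0.
have sX : (size X)%:R <= 2 ^+ j * J by rewrite mulrC; exact: size_block_le.
pose B : R := ((2 * pi) ^+ d.+1) `^ q^-1 * 1.
have B0 : 0 < B by rewrite /B mulr1 powR_gt0.
have phiB := lqnorm_le_integral q0 ler01 phi1.
have hb := block_bound q12 (Lq_cintegrable (ltW q1) Lphi).1 B0 phiB uX Xj J0 sX.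
pose D : R := (2 * pi) ^- d.+1 * (2 `^ r) ^+ d.+1 * (2 ^+ j) `^ (- r).
have D0 : 0 <= D.
  apply: mulr_ge0; last exact: powR_ge0.
  by apply: mulr_ge0; [rewrite invr_ge0 ltW|rewrite exprn_ge0 ?powR_ge0].
apply: (@le_trans _ _ (D * \sum_(k <- X) normc (torus_coef phi k))).
  rewrite mulr_sumr big_seq [leRHS]big_seq; apply: ler_sum => k kX.
  by apply: le_trans (fourier_le k) _; rewrite Xj.
apply: le_trans (ler_wpM2l D0 hb) _.
apply: (@le_trans _ _ (D * ((paleyC q ^+ d.+1 + 1) * ((2 ^+ j) `^ q^-1 *
   ((2 ^+ d) `^ (1 - q^-1) * (j%:R ^+ d) `^ (1 - q^-1)) * B)))).
  apply: ler_wpM2l => //; apply: ler_wpM2l; first by rewrite addr_ge0.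
  apply: ler_wpM2r; first exact: ltW.
  apply: ler_wpM2l; first exact: powR_ge0.
  rewrite -powRM ?exprn_ge0//; apply: ge0_ler_powR; rewrite ?nnegrE ?mulr_ge0 ?exprn_ge0 ?(ltW J0)//.
  exact: succ_pow_le.
rewrite -pow2_combine /D /B /constW mulr1 le_eqVlt; apply/orP; left; apply/eqP.
ring.
Qed.

End W_embedding.

(** * The two embeddings *)

Theorem proposition1p1 (R : realType) (d : nat) (r q : R)
    (d_gt0 : (0 < d)%N) (rq : q^-1 < r) :
  (1 < q <= 2 ->
    embeds (Wclass d r q) (WAclass d (r - q^-1) (1 - q^-1))) /\
  (1 <= q <= 2 ->
    embeds (Hclass d r q) (WAclass d (r - q^-1) 1)).
Proof.
case: d d_gt0 => // d _; split => [q12|q12]; first exact: W_embeds.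
exact: H_embeds.
Qed.
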